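(* Let $G$ be a finite simple graph. The connected subgraph arrangement $\mathcal{A}_G$ is free if and only if it is accurate.
   Context: Let $G=(N,E)$ be a finite simple graph with vertex set $N=[n]$. For $\varnothing\neq I\subseteq N$, $G[I]$ is the induced subgraph and $H_I:=\ker(\sum_{i\in I}x_i)\subseteq\mathbb{Q}^n$. The connected subgraph arrangement is $\mathcal{A}_G:=\{H_I\mid \varnothing\neq I\subseteq N,\ G[I]\text{ connected}\}$. An arrangement $\mathcal{A}$ in $V=\mathbb{Q}^\ell$ is free if its module of logarithmic derivations $D(\mathcal{A})=\{\theta\in\mathrm{Der}(S)\mid \theta(\alpha_H)\in\alpha_H S \ \forall H\in\mathcal{A}\}$ (with $S$ the polynomial ring on $V$ and $\alpha_H$ a defining form of $H$) is a free $S$-module; its exponents are the degrees of a homogeneous basis. For $X$ in the intersection lattice $L(\mathcal{A})$, the restriction is $\mathcal{A}^X:=\{X\cap H\mid H\in\mathcal{A},\ X\not\subseteq H\}$, an arrangement in $X$. A free arrangement $\mathcal{A}$ with exponents $e_1\le\dots\le e_\ell$ is accurate if for every $1\le d\le\ell$ there is $X_d\in L(\mathcal{A})$ with $\dim X_d=d$ such that $\mathcal{A}^{X_d}$ is free with exponents $e_1\le\dots\le e_d$. *)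

(* Defs.v *)
From HB Require Import structures.
From mathcomp Require Import all_boot all_order all_algebra.
From mathcomp Require Import mpoly.

Set Implicit Arguments.
Unset Strict Implicit.
Unset Printing Implicit Defensive.

Import Order.TTheory GRing.Theory Num.Theory.
Local Open Scope ring_scope.

(* Hyperplane arrangements in V = Q^l.                                      *)
(* A point of V is a row vector 'rV[rat]_l.  A hyperplane H is given by a  *)
(* nonzero defining linear form alpha_H, also encoded as a row vector: the *)
(* form is v |-> \sum_i alpha 0 i * v 0 i.  An arrangement is a finite     *)
(* list of defining forms (repetitions / proportional forms describe the   *)
(* same hyperplane and do not change D(A)).                                *)

Definition arrangement (l : nat) := seq 'rV[rat]_l.

Notation S l := {mpoly rat[l]}.

Definition lin_poly (l : nat) (a : 'rV[rat]_l) : S l :=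
  \sum_(i < l) a 0 i *: 'X_i.

(* Der(S) is the free S-module with basis d/dx_1, ..., d/dx_l; a         *)
(* derivation theta = \sum_i f_i d/dx_i is encoded by (f_i)_i.            *)
Definition der (l : nat) := 'I_l -> S l.

Definition der_app (l : nat) (theta : der l) (a : 'rV[rat]_l) : S l :=
  \sum_(i < l) a 0 i *: theta i.

Definition in_D (l : nat) (A : arrangement l) (theta : der l) : Prop :=
  forall a, a \in A -> exists g : S l, der_app theta a = lin_poly a * g.

Definition is_basis_D (l : nat) (A : arrangement l) (m : nat)
    (B : 'I_m -> der l) : Prop :=
  [/\ forall j, in_D A (B j),
      forall theta, in_D A theta ->
        exists c : 'I_m -> S l,
          forall i, theta i = \sum_(j < m) c j * B j i
    & forall c : 'I_m -> S l,
        (forall i, \sum_(j < m) c j * B j i = 0) -> forall j, c j = 0].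

Definition free_arr (l : nat) (A : arrangement l) : Prop :=
  exists m (B : 'I_m -> der l), is_basis_D A B.

Definition homog_der (l : nat) (theta : der l) (d : nat) : Prop :=
  forall i, theta i \is d.-homog.

Definition free_with_exponents (l : nat) (A : arrangement l) (e : seq nat)
    : Prop :=
  exists B : 'I_(size e) -> der l,
    is_basis_D A B /\ forall j : 'I_(size e), homog_der (B j) (nth 0%N e j).

(* The subspace {v | alpha(v) = 0 for all alpha in B}, as the row space   *)
(* of a square matrix (mxalgebra).  B = [::] gives the whole space V.     *)
Definition forms_mx (l : nat) (B : seq 'rV[rat]_l) : 'M[rat]_(size B, l) :=
  \matrix_(k < size B) nth 0 B k.

Definition inter_space (l : nat) (B : seq 'rV[rat]_l) : 'M[rat]_l :=
  kermx (forms_mx B)^T.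

Definition in_lattice (l : nat) (A : arrangement l) (k : nat)
    (X : 'M[rat]_(k, l)) : Prop :=
  exists mask_ : bitseq, (X :=: inter_space (mask mask_ A))%MS.

(* Restriction A^X, expressed in coordinates on X: P is a d x l matrix    *)
(* whose rows form a basis of X, identifying Q^d with X via w |-> w *m P. *)
(* Each H with X not contained in H restricts to X cap H, whose defining  *)
(* form in these coordinates is alpha *m P^T (nonzero iff X is not in H). *)
Definition restr_arr (l d : nat) (A : arrangement l) (P : 'M[rat]_(d, l))
    : arrangement d :=
  [seq a *m P^T | a <- A & a *m P^T != 0].

Definition accurate (l : nat) (A : arrangement l) : Prop :=
  exists e : seq nat,
    [/\ sorted leq e, free_with_exponents A e &
        forall d : nat, (1 <= d <= l)%N ->
          exists P : 'M[rat]_(d, l),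
            [/\ row_free P, in_lattice A P &
                free_with_exponents (restr_arr A P) (take d e)]].

Definition simple_graph (n : nat) (E : rel 'I_n) : Prop :=
  ssrbool.symmetric E /\ ssrbool.irreflexive E.

Definition induced_rel (n : nat) (E : rel 'I_n) (I : {set 'I_n}) : rel 'I_n :=
  [rel x y | [&& x \in I, y \in I & E x y]].

Definition induced_connected (n : nat) (E : rel 'I_n) (I : {set 'I_n}) : bool :=
  (I != set0) && [forall x in I, forall y in I, connect (induced_rel E I) x y].

Definition subset_form (n : nat) (I : {set 'I_n}) : 'rV[rat]_n :=
  \row_(i < n) (i \in I)%:R.

Definition connected_subgraph_arr (n : nat) (E : rel 'I_n) : arrangement n :=
  [seq subset_form J | J <- enum [pred J : {set 'I_n} | induced_connected E J]].

(* Main.v *)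
Require Import Defs.
From HB Require Import structures.
From mathcomp Require Import all_boot all_order all_algebra.
From mathcomp Require Import perm mpoly.
From mathcomp Require Import zify ring lra.

Set Implicit Arguments.
Unset Strict Implicit.
Unset Printing Implicit Defensive.

Import Order.TTheory GRing.Theory Num.Theory.
Local Open Scope ring_scope.

(* Subdivide the components of G into connected blocks of vertices; a graph H obtained by contracting
   the blocks (and deleting the rest) gives a flat of A_G looking like A_H.  Evaluating a basis of D(A_G)
   along a line through a point p of such a flat, a derivation theta with theta(alpha_H) = alpha_H g_H has
   quotients g_H that agree to high order on the hyperplanes through p, whereas the determinant of a basis
   is a nonzero multiple of the product of the alpha_H (Saito).  Comparing the orders of vanishing at p
   excludes K4, the diamond, the claw with four legs, the cricket, the butterfly, the pan over C4, the net
   and the spider as such H.  A longest induced path then shows that every component of G is a path P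
   together with at most one vertex v that is joined to one vertex of P, to two consecutive ones, or to
   the two ends.
   For these components put x_{p_k} = Y_{k+1} - Y_k and x_v = s, or x_v = s - sum_k x_{p_k} for a cycle:
   A_G becomes the arrangement of the hyperplanes s = 0, Y_a = Y_b and, for blk(a) < blk(b),
   Y_b - Y_a = s, for a weight function blk on the points.  Its restrictions to the flats obtained by
   fixing the points of a window at prescribed multiples of s have an explicit basis, made of
   derivations built from discrete primitives t |-> Phi(t) with Phi(t + s) - Phi(t) = s R(t) for products R
   of linear forms; the exponents are initial segments of those of A_G.  Disjoint components are merged. *)

(** * Linear forms and linear substitutions *)

(** The obstruction is local. If [r + 1] independent forms through [p] have quotients agreeing to
    order [k], then after a constant base change one column of a basis matrix vanishes to order 1 on
    a line through [p] and [r] columns to order [k + 1]; so [1 + r (k + 1)] cannot exceed the number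
    of hyperplanes through [p]. For [k = 1] a circuit among the forms is enough; only K4 and the
    diamond need more, [k = 4] and [k = 2]. In the other direction tangency dictates the primitives:
    a derivation that kills [s] and sends each [Y_a] to [Phi(Y_a)] preserves [Y_b - Y_a = s] as soon
    as [R(Y_a)] is divisible by [Y_b - Y_a - s]. Accuracy asks that fixing points removes the
    largest exponents first. The exponent of a point is the number of points minus its rank inside
    its block, so the points are sorted by rank, then by weight. The same order turns each step
    inside a window into a hyperplane of the arrangement, which is why windows are flats. *)

Lemma lin_poly_is_linear d : linear (@lin_poly d).
Proof.
move=> c a b; rewrite /lin_poly scaler_sumr -big_split /=.
by apply: eq_bigr => i _; rewrite !mxE scalerDl scalerA.
Qed.
HB.instance Definition _ d := GRing.isLinear.Build rat 'rV[rat]_d (S d) *:%R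
  (@lin_poly d) (@lin_poly_is_linear d).

Lemma lin_poly_coef d (a : 'rV[rat]_d) i : (lin_poly a)@_U_(i) = a 0 i.
Proof.
rewrite /lin_poly raddf_sum (bigD1 i) //= mcoeffZ mcoeffX eqxx mulr1.
rewrite big1 ?addr0 // => j ne; rewrite mcoeffZ mcoeffX.
by case: eqP => [/mnmP/(_ j)|_]; rewrite ?mulr0 // !mnm1E eqxx eq_sym (negbTE ne).
Qed.

Lemma lin_poly_inj d : injective (@lin_poly d).
Proof.
by move=> a b eq_ab; apply/rowP => i; rewrite -!lin_poly_coef eq_ab.
Qed.

Lemma lin_poly_eq0 d (a : 'rV[rat]_d) : (lin_poly a == 0) = (a == 0).
Proof. by rewrite -[X in lin_poly _ == X](linear0 (@lin_poly d)) (inj_eq (@lin_poly_inj d)). Qed.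

Lemma lin_poly_delta d (i : 'I_d) : lin_poly (delta_mx 0 i) = 'X_i.
Proof.
rewrite /lin_poly (bigD1 i) //= mxE !eqxx scale1r big1 ?addr0 // => j ne.
by rewrite mxE (negbTE ne) andbF scale0r.
Qed.

Lemma lin_poly_homog d (a : 'rV[rat]_d) : lin_poly a \is 1.-homog.
Proof.
apply: rpred_sum => i _; apply: dhomogZ.
by rewrite dhomogX /= mdeg1.
Qed.

Lemma mmap_lin_poly d (K : comNzRingType) (f : {rmorphism rat -> K})
    (h : 'I_d -> K) (a : 'rV[rat]_d) :
  mmap f h (lin_poly a) = \sum_i f (a 0 i) * h i.
Proof.
by rewrite raddf_sum /=; apply: eq_bigr => i _; rewrite mmapZ mmapX mmap1U.
Qed.

Lemma mpoly_ind_ring d (P : S d -> Prop) :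
  (forall c, P c%:MP) -> (forall i, P 'X_i) ->
  (forall p q, P p -> P q -> P (p + q)) ->
  (forall p q, P p -> P q -> P (p * q)) -> forall p, P p.
Proof.
move=> PC PX PD PM p; rewrite [p]mpolyE.
apply: (big_ind P); [by rewrite -mpolyC0; apply: PC | exact: PD |].
move=> m _; rewrite -mul_mpolyC; apply: (PM) => //.
rewrite mpolyXE_id; apply: (big_ind P); [by rewrite -mpolyC1; apply: PC | exact: PM |].
move=> i _; elim: (m i : nat) => [|k IH]; first by rewrite expr0 -mpolyC1; apply: PC.
by rewrite exprS; apply: PM.
Qed.

Definition lsub d d' (T : 'M[rat]_(d, d')) : S d -> S d' :=
  mmap (@mpolyC d' rat) (fun i => lin_poly (row i T)).

HB.instance Definition _ d d' (T : 'M[rat]_(d, d')) :=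
  GRing.RMorphism.copy (lsub T) (mmap (@mpolyC d' rat) (fun i => lin_poly (row i T))).

Lemma lsubC d d' (T : 'M[rat]_(d, d')) c : lsub T c%:MP = c%:MP.
Proof. exact: mmapC. Qed.

Lemma lsubX d d' (T : 'M[rat]_(d, d')) i : lsub T 'X_i = lin_poly (row i T).
Proof. by rewrite /lsub mmapX mmap1U. Qed.

Lemma lsubZ d d' (T : 'M[rat]_(d, d')) c p : lsub T (c *: p) = c *: lsub T p.
Proof. by rewrite /lsub mmapZ mul_mpolyC. Qed.

Lemma lsub_lin d d' (T : 'M[rat]_(d, d')) a :
  lsub T (lin_poly a) = lin_poly (a *m T).
Proof.
rewrite mulmx_sum_row linear_sum raddf_sum /=; apply: eq_bigr => i _.
by rewrite lsubZ lsubX linearZ.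
Qed.

Lemma lsub_comp d d' d'' (T : 'M[rat]_(d, d')) (U : 'M[rat]_(d', d'')) p :
  lsub U (lsub T p) = lsub (T *m U) p.
Proof.
elim/mpoly_ind_ring: p => [c|i|p q Hp Hq|p q Hp Hq].
- by rewrite !lsubC.
- by rewrite !lsubX lsub_lin row_mul.
- by rewrite !raddfD /= Hp Hq.
- by rewrite !rmorphM /= Hp Hq.
Qed.

Lemma lsub1 d (p : S d) : lsub 1%:M p = p.
Proof.
elim/mpoly_ind_ring: p => [c|i|p q Hp Hq|p q Hp Hq].
- by rewrite lsubC.
- by rewrite lsubX row1 lin_poly_delta.
- by rewrite raddfD /= Hp Hq.
- by rewrite rmorphM /= Hp Hq.
Qed.

Lemma lsub_homog d d' (T : 'M[rat]_(d, d')) k p :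
  p \is k.-homog -> lsub T p \is k.-homog.
Proof.
move/dhomogP => hp; rewrite /lsub /mmap big_seq; apply: rpred_sum => m /hp <-.
rewrite mul_mpolyC; apply: dhomogZ; rewrite /mmap1 /= mdegE.
elim/big_rec2: _ => [|i e q _ hq]; first exact: dhomog1.
apply: dhomogM => //; have := dhomogMn (m i) (lin_poly_homog (row i T)).
by rewrite mul1n.
Qed.

(* Substituting for one variable so as to kill the form detects divisibility by it. *)
Definition kill_mx d (a : 'rV[rat]_d) (k : 'I_d) : 'M[rat]_d :=
  1%:M - (a 0 k)^-1 *: (delta_mx k 0 *m a).

Lemma kill_mxK d (a : 'rV[rat]_d) k : a 0 k != 0 -> a *m kill_mx a k = 0.
Proof.
move=> nz; rewrite mulmxBr mulmx1 -scalemxAr mulmxA.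
have -> : a *m delta_mx k (0 : 'I_1) = (a 0 k)%:M.
  by apply/matrixP => i j; rewrite !ord1 -colE !mxE eqxx mulr1n.
by rewrite mul_scalar_mx scalerA mulVf // scale1r subrr.
Qed.

(** Each variable changes only by a multiple of [a], and congruence modulo [a] respects sums and
    products; this stands in for division with remainder. *)
Lemma lsub_kill_mod d (a : 'rV[rat]_d) k (p : S d) :
  exists g, p = lsub (kill_mx a k) p + lin_poly a * g.
Proof.
elim/mpoly_ind_ring: p => [c|i|p q [g Hp] [h Hq]|p q [g Hp] [h Hq]].
- by exists 0; rewrite lsubC mulr0 addr0.
- exists ((i == k)%:R * (a 0 k)^-1)%:MP; rewrite lsubX.
  have -> : row i (kill_mx a k) = delta_mx 0 i - ((i == k)%:R * (a 0 k)^-1) *: a.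
    by apply/rowP => j; rewrite !mxE big_ord1 !mxE andbT eqxx /= (eq_sym j) ; ring.
  by rewrite linearB linearZ /= lin_poly_delta [lin_poly a * _]mulrC mul_mpolyC subrK.
- by exists (g + h); rewrite raddfD /= {1}Hp {1}Hq; ring.
- set P := lsub _ _ in Hp; set Q := lsub _ _ in Hq.
  exists (P * h + g * Q + lin_poly a * g * h); rewrite rmorphM /= -/P -/Q {1}Hp {1}Hq; ring.
Qed.

Definition dvdl d (a : 'rV[rat]_d) (f : S d) := exists g, f = lin_poly a * g.

Lemma dvdl_kill d (a : 'rV[rat]_d) k f : a 0 k != 0 ->
  dvdl a f <-> lsub (kill_mx a k) f = 0.
Proof.
move=> nz; split=> [[g ->]|f0].
  by rewrite rmorphM /= lsub_lin kill_mxK // linear0 mul0r.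
by have [g Hg] := lsub_kill_mod a k f; exists g; rewrite {1}Hg f0 add0r.
Qed.

Lemma rV_neq0P d (a : 'rV[rat]_d) : a != 0 -> exists k, a 0 k != 0.
Proof.
by case/rV0Pn => k nz; exists k.
Qed.

(** A nonzero linear form is prime, since its multiples are the kernel of a morphism into the domain
    [S d]. *)
Lemma dvdlM d (a : 'rV[rat]_d) f g : a != 0 -> dvdl a (f * g) -> dvdl a f \/ dvdl a g.
Proof.
move=> /rV_neq0P[k nz]; rewrite !(dvdl_kill _ nz) rmorphM => /eqP.
by rewrite mulf_eq0 => /orP[] /eqP; [left|right].
Qed.

Lemma dvdl_mull d (a : 'rV[rat]_d) f g : dvdl a g -> dvdl a (f * g).
Proof. by case=> h ->; exists (f * h); rewrite mulrCA. Qed.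

Lemma dvdl_mulr d (a : 'rV[rat]_d) f g : dvdl a f -> dvdl a (f * g).
Proof. by rewrite mulrC; apply: dvdl_mull. Qed.

Lemma dvdlD d (a : 'rV[rat]_d) f g : dvdl a f -> dvdl a g -> dvdl a (f + g).
Proof. by case=> h -> [h' ->]; exists (h + h'); rewrite mulrDr. Qed.

Lemma dvdl0 d (a : 'rV[rat]_d) : dvdl a 0.
Proof. by exists 0; rewrite mulr0. Qed.

Lemma dvdl_sum d (a : 'rV[rat]_d) (I : Type) (r : seq I) (P : pred I) (F : I -> S d) :
  (forall i, P i -> dvdl a (F i)) -> dvdl a (\sum_(i <- r | P i) F i).
Proof.
by move=> H; apply: (big_ind (dvdl a)) => //; [exact: dvdl0 | exact: dvdlD].
Qed.

Lemma dvdl_lin d (a b : 'rV[rat]_d) : a != 0 -> dvdl a (lin_poly b) -> (b <= a)%MS.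
Proof.
move=> /rV_neq0P[k nz]; rewrite (dvdl_kill _ nz) lsub_lin => /eqP.
rewrite lin_poly_eq0 /kill_mx mulmxBr mulmx1 subr_eq0 => /eqP ->.
by rewrite -scalemxAr scalemx_sub // mulmxA submxMl.
Qed.

Lemma dvdl1 d (a : 'rV[rat]_d) : a != 0 -> ~ dvdl a 1.
Proof.
move=> /rV_neq0P[k nz]; rewrite (dvdl_kill _ nz) rmorph1 => /eqP.
by rewrite oner_eq0.
Qed.

Lemma dvdl_prod d (a : 'rV[rat]_d) (L : seq 'rV[rat]_d) : a != 0 ->
  dvdl a (\prod_(b <- L) lin_poly b) -> exists2 b, b \in L & (b <= a)%MS.
Proof.
move=> nz; elim: L => [|b L IH]; first by rewrite big_nil => /dvdl1.
rewrite big_cons => /(dvdlM nz) [/(dvdl_lin nz) Hb | /IH[c cL Hc]].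
  by exists b => //; rewrite mem_head.
by exists c => //; rewrite in_cons cL orbT.
Qed.

Definition nonprop d (a b : 'rV[rat]_d) := ~~ (b <= a)%MS.

Lemma prod_dvd d (L : seq 'rV[rat]_d) (f : S d) :
  0 \notin L -> pairwise (@nonprop d) L -> (forall a, a \in L -> dvdl a f) ->
  exists g, f = (\prod_(a <- L) lin_poly a) * g.
Proof.
elim: L => [|a L IH] /=; first by move=> _ _ _; exists f; rewrite big_nil mul1r.
rewrite in_cons negb_or eq_sym => /andP[nza nzL] /andP[/allP npa npL] H.
have [|g Hg] := IH nzL npL; first by move=> b bL; apply: H; rewrite in_cons bL orbT.
have : dvdl a f by apply: H; rewrite mem_head.
rewrite Hg => /(dvdlM nza) [/(dvdl_prod nza) [b bL ba] | [h ->]].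
  by have := npa _ bL; rewrite /nonprop ba.
by exists h; rewrite big_cons; ring.
Qed.

Lemma lin_prod_neq0 d (L : seq 'rV[rat]_d) : 0 \notin L -> \prod_(a <- L) lin_poly a != 0.
Proof.
elim: L => [|a L IH]; first by rewrite big_nil oner_eq0.
rewrite in_cons negb_or big_cons mulf_eq0 lin_poly_eq0 eq_sym => /andP[/negbTE -> /IH].
by [].
Qed.

Lemma lin_prod_homog d (L : seq 'rV[rat]_d) :
  \prod_(a <- L) lin_poly a \is (size L).-homog.
Proof.
elim: L => [|a L IH]; first by rewrite big_nil dhomog1.
by rewrite big_cons; apply: (dhomogM (lin_poly_homog a) IH).
Qed.

Lemma msize_dhomog d k (p : S d) : p != 0 -> p \is k.-homog -> msize p = k.+1.
Proof.
move=> nz hp; rewrite (dhomog_uniq nz hp (dhomog_msize hp)) prednK //.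
by rewrite lt0n msize_poly_eq0.
Qed.

(** * Saito's criterion *)

Lemma der_appE d (theta : der d) (a : 'rV[rat]_d) :
  der_app theta a = \sum_i (a 0 i)%:MP * theta i.
Proof. by apply: eq_bigr => i _; rewrite mul_mpolyC. Qed.

Lemma der_app_is_linear d (theta : der d) : linear (der_app theta).
Proof.
move=> c a b; rewrite /der_app scaler_sumr -big_split /=.
by apply: eq_bigr => i _; rewrite !mxE scalerDl scalerA.
Qed.
HB.instance Definition _ d (theta : der d) := GRing.isLinear.Build rat 'rV[rat]_d (S d) *:%R
  (der_app theta) (der_app_is_linear theta).

Lemma der_app_delta d (theta : der d) i : der_app theta (delta_mx 0 i) = theta i.
Proof.
rewrite /der_app (bigD1 i) //= mxE !eqxx scale1r big1 ?addr0 // => j ne.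
by rewrite mxE (negbTE ne) andbF scale0r.
Qed.

Lemma in_D_dvdl d (A : arrangement d) theta a : in_D A theta -> a \in A -> dvdl a (der_app theta a).
Proof. by move=> H aA; exact: H. Qed.

Lemma der_app_mx d (B : 'M[S d]_d) (a : 'rV[rat]_d) i :
  (B *m (map_mx (@mpolyC d rat) a)^T) i 0 = der_app (B i) a.
Proof. by rewrite mxE der_appE; apply: eq_bigr => j _; rewrite !mxE mulrC. Qed.

(** The identity [\adj B *m B = \det B], applied to the column of [a], writes [\det B * a_k] as a
    combination of the values at [a], and some [a_k] is a nonzero constant. *)
Lemma dvdl_det d (a : 'rV[rat]_d) (B : 'M[S d]_d) : a != 0 ->
  (forall i, dvdl a (der_app (B i) a)) -> dvdl a (\det B).
Proof.
move=> /rV0Pn[k nz] H.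
have E : \adj B *m (B *m (map_mx (@mpolyC d rat) a)^T) =
    \det B *: (map_mx (@mpolyC d rat) a)^T.
  by rewrite mulmxA mul_adj_mx mul_scalar_mx.
have [g Hg] : dvdl a (\det B * (a 0 k)%:MP).
  have := congr1 (fun M : 'cV_d => M k 0) E; rewrite /= !mxE => <-.
  apply: dvdl_sum => i _; apply: dvdl_mull.
  by move: (der_app_mx B a i) (H i); rewrite !mxE => ->.
exists ((a 0 k)^-1%:MP * g); rewrite mulrCA -Hg mulrCA -mpolyCM mulVf //.
by rewrite mulr1.
Qed.

Lemma det_homog d k (B : 'M[S d]_k) (e : 'I_k -> nat) :
  (forall i j, B i j \is (e i).-homog) -> \det B \is (\sum_i e i)%N.-homog.
Proof.
move=> hB; apply: rpred_sum => s _; rewrite -signr_odd.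
have hP : \prod_(i < k) B i (s i) \is (\sum_i e i)%N.-homog.
  by elim/big_rec2: _ => [|i n p _ hp]; [exact: dhomog1 | exact: dhomogM].
case: odd; rewrite ?expr0 ?mul1r // expr1 mulN1r; exact: rpredNr.
Qed.

(** The data of Saito's criterion. [L] selects distinct hyperplanes of [A], at least as many as the
    sum of the degrees; the reverse inequality is automatic, because their product divides the
    nonzero determinant. *)
Definition saito_free d (A : arrangement d) (e : seq nat) : Prop :=
  size e = d /\ exists (B : 'M[S d]_d) (L : seq 'rV[rat]_d),
  [/\ forall i, in_D A (B i), forall i j, B i j \is (nth 0%N e i).-homog, \det B != 0,
      (sumn e <= size L)%N
    & [/\ 0 \notin L, pairwise (@nonprop d) L &
          forall a, a \in L -> exists2 c, c != 0 & c *: a \in A]].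

Lemma dvdl_scale d c (a : 'rV[rat]_d) theta : c != 0 ->
  dvdl (c *: a) (der_app theta (c *: a)) -> dvdl a (der_app theta a).
Proof.
move=> nz [g]; rewrite !linearZ /= => /(congr1 (fun p => c^-1 *: p)).
by rewrite scalerA mulVf // scale1r => ->; exists g; rewrite -scalerAl scalerA mulVf // scale1r.
Qed.

(** The product of the forms in [L] divides the determinant of any [d] derivations of [D(A)]. By
    degrees [\det B] is a constant multiple of that product, so the quotients in Cramer's rule are
    polynomials. *)
Lemma saito_basis d (A : arrangement d) (e : seq nat) : saito_free A e ->
  exists B : 'I_d -> der d, is_basis_D A B /\ forall j, homog_der (B j) (nth 0%N e j).
Proof.
case=> se [B [L [BD Bh Bdet sL [L0 Lp LA]]]].
exists (fun i => B i); split=> //.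
have dvdA (M : 'M[S d]_d) : (forall i, in_D A (M i)) ->
    exists g, \det M = (\prod_(a <- L) lin_poly a) * g.
  move=> MD; apply: prod_dvd => // a aL; apply: dvdl_det.
    by apply: contraNneq L0 => <-.
  move=> i; have [c nzc cA] := LA _ aL; apply: (dvdl_scale nzc); exact: in_D_dvdl.
have [u Hu] := dvdA B BD.
have Qnz := lin_prod_neq0 L0.
have unz : u != 0 by apply: contraNneq Bdet => u0; rewrite Hu u0 mulr0.
have detsz : msize (\det B) = (sumn e).+1.
  apply: msize_dhomog => //; rewrite sumnE (big_nth 0%N) big_mkord se.
  exact: det_homog.
(* Since [sumn e <= size L], no degree is left for the cofactor [u]. *)
have [c [nzc uE]] : exists c : rat, c != 0 /\ u = c%:MP.
  have := detsz; rewrite Hu msizeM // (msize_dhomog Qnz (lin_prod_homog L)) addSn /=.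
  have := msize_poly_eq0 u; rewrite (negbTE unz) => /negbT; rewrite -lt0n => u_gt0.
  move=> Hs; have /eqP : msize u = 1%N by apply/eqP; rewrite eqn_leq u_gt0 andbT -(leq_add2l (size L)) Hs addn1 ltnS.
  by move/msize_poly1P => [c nzc ->]; exists c.
split=> //.
- move=> theta thD.
  (* Replacing row [j] by [theta] stays inside [D(A)]; [\det (M j)] is Cramer's numerator for the
     coefficient of [B j]. *)
  pose M j := \matrix_(i < d, k < d) if i == j then theta k else B i k.
  have MD j i : in_D A (M j i).
    move=> a aA; have [ij|ij] := eqVneq i j.
      have [g Hg] := thD a aA; exists g; rewrite -Hg.
      by apply: eq_bigr => k _; rewrite mxE ij eqxx.
    have [g Hg] := BD i a aA; exists g; rewrite -Hg.
    by apply: eq_bigr => k _; rewrite mxE (negbTE ij).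
  have /fin_all_exists[h Hh] : forall j, exists g, \det (M j) = (\prod_(a <- L) lin_poly a) * g.
    by move=> j; apply: dvdA.
  have cofE j : \det (M j) = \sum_k theta k * cofactor B j k.
    rewrite (expand_det_row _ j); apply: eq_bigr => k _; rewrite mxE eqxx.
    congr (_ * _); rewrite /cofactor; congr (_ * \det _).
    by apply/matrixP => x y; rewrite !mxE eq_sym (negbTE (neq_lift _ _)).
  exists (fun j => (c^-1)%:MP * h j) => i.
  apply: (mulfI Bdet); rewrite mulr_sumr.
  transitivity (\sum_j \det (M j) * B j i).
    transitivity (((\row_k theta k) *m (\adj B *m B)) 0 i).
      by rewrite mul_adj_mx mul_mx_scalar !mxE.
    rewrite mulmxA mxE; apply: eq_bigr => j _; congr (_ * _).
    by rewrite mxE cofE; apply: eq_bigr => k _; rewrite !mxE.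
  have cc : c%:MP * (c^-1)%:MP = 1 :> S d by rewrite -mpolyCM divff.
  by apply: eq_bigr => j _; rewrite Hh Hu uE -[LHS]mul1r -cc; ring.
- move=> w Hw j.
  have : (\row_k w k) *m B = 0 by apply/rowP => i; rewrite !mxE -[RHS](Hw i); apply: eq_bigr => k _; rewrite mxE.
  move/(congr1 (fun M => (M *m \adj B) 0 j)).
  rewrite -mulmxA mul_mx_adj mul0mx mul_mx_scalar !mxE => /eqP.
  by rewrite mulf_eq0 (negbTE Bdet) => /eqP.
Qed.

Lemma saito_free_exponents d (A : arrangement d) e : saito_free A e -> free_with_exponents A e.
Proof. by move=> H; have := saito_basis H; case: H => se _; move: A; rewrite -se. Qed.

Lemma row_freeE k l (P : 'M[rat]_(k, l)) :
  (forall w : 'rV_k, w *m P = 0 -> w = 0) -> row_free P.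
Proof.
move=> H; rewrite -kermx_eq0; apply/eqP/row_matrixP => i; rewrite row0.
by apply: H; rewrite -row_mul mulmx_ker row0.
Qed.

Lemma saito_free_perm d (A : arrangement d) e e' : perm_eq e' e -> saito_free A e -> saito_free A e'.
Proof.
move=> pe [se [B [L [BD Bh Bdet sL HL]]]].
have se' : size e' == d by rewrite (perm_size pe) se.
have /tuple_permP[s Hs] : perm_eq e' (tcast se (in_tuple e)) by rewrite val_tcast.
have He' (i : 'I_d) : nth 0%N e' i = nth 0%N e (s i).
  rewrite Hs -(tnth_nth 0%N) tnth_mktuple (tnth_nth 0%N) val_tcast //.
split; first exact/eqP.
exists (row_perm s B), L; split=> //.
- move=> i a aA; have [g Hg] := BD (s i) a aA; exists g; rewrite -Hg.
  by apply: eq_bigr => k _; rewrite mxE.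
- by move=> i j; rewrite mxE He'; exact: Bh.
- by rewrite row_permE det_mulmx det_perm mulf_neq0 // signr_eq0.
- by rewrite (perm_sumn pe).
Qed.

Lemma lsub_inj d d' (T : 'M[rat]_(d, d')) (U : 'M[rat]_(d', d)) : T *m U = 1%:M -> injective (lsub T).
Proof.
by move=> TU; apply: (@can_inj _ _ _ (lsub U)) => p; rewrite lsub_comp TU lsub1.
Qed.

Lemma saito_free_prod d1 d2 (A1 : arrangement d1) (A2 : arrangement d2)
    (A : arrangement (d1 + d2)) e1 e2 :
  (forall a, a \in A -> (exists2 b, b \in A1 & a = row_mx b 0) \/
                        (exists2 b, b \in A2 & a = row_mx 0 b)) ->
  (forall b, b \in A1 -> row_mx b 0 \in A) ->
  (forall b, b \in A2 -> row_mx 0 b \in A) ->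
  saito_free A1 e1 -> saito_free A2 e2 -> saito_free A (e1 ++ e2).
Proof.
move=> HA HA1 HA2 [se1 [B1 [L1 [BD1 Bh1 Bdet1 sL1 [L01 Lp1 LA1]]]]].
move=> [se2 [B2 [L2 [BD2 Bh2 Bdet2 sL2 [L02 Lp2 LA2]]]]].
split; first by rewrite size_cat se1 se2.
pose i1 : {rmorphism S d1 -> S (d1 + d2)} := lsub (row_mx 1%:M 0 : 'M[rat]_(d1, d1 + d2)).
have i1E p : i1 p = lsub (row_mx 1%:M 0) p by [].
pose i2 : {rmorphism S d2 -> S (d1 + d2)} := lsub (row_mx 0 1%:M : 'M[rat]_(d2, d1 + d2)).
have i2E p : i2 p = lsub (row_mx 0 1%:M) p by [].
have i1_inj : injective i1.
  by apply: (@lsub_inj _ _ _ (col_mx 1%:M 0)); rewrite mul_row_col mulmx1 mul0mx addr0.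
have i2_inj : injective i2.
  by apply: (@lsub_inj _ _ _ (col_mx 0 1%:M)); rewrite mul_row_col mulmx1 mul0mx add0r.
have rm1 (b : 'rV[rat]_d1) : lin_poly (row_mx b (0 : 'rV_d2)) = i1 (lin_poly b).
  by rewrite i1E lsub_lin mul_mx_row mulmx1 mulmx0.
have rm2 (b : 'rV[rat]_d2) : lin_poly (row_mx (0 : 'rV_d1) b) = i2 (lin_poly b).
  by rewrite i2E lsub_lin mul_mx_row mulmx1 mulmx0.
pose B := block_mx (map_mx i1 B1) 0 0 (map_mx i2 B2).
have B11 i b : der_app (B (lshift d2 i)) (row_mx b 0) = i1 (der_app (B1 i) b).
  rewrite /der_app big_split_ord /= [X in _ + X]big1 ?addr0; last first.
    by move=> j _; rewrite row_mxEr mxE scale0r.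
  by rewrite raddf_sum; apply: eq_bigr => j _; rewrite row_mxEl block_mxEul mxE; exact/esym/lsubZ.
have B12 i b : der_app (B (lshift d2 i)) (row_mx 0 b) = 0.
  rewrite /der_app big_split_ord /= !big1 ?addr0 // => j _.
    by rewrite row_mxEr block_mxEur mxE scaler0.
  by rewrite row_mxEl mxE scale0r.
have B21 i b : der_app (B (rshift d1 i)) (row_mx b 0) = 0.
  rewrite /der_app big_split_ord /= !big1 ?addr0 // => j _.
    by rewrite row_mxEr mxE scale0r.
  by rewrite row_mxEl block_mxEdl mxE scaler0.
have B22 i b : der_app (B (rshift d1 i)) (row_mx 0 b) = i2 (der_app (B2 i) b).
  rewrite /der_app big_split_ord /= [X in X + _]big1 ?add0r; last first.
    by move=> j _; rewrite row_mxEl mxE scale0r.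
  by rewrite raddf_sum; apply: eq_bigr => j _; rewrite row_mxEr block_mxEdr mxE; exact/esym/lsubZ.
exists B, ([seq row_mx b 0 | b <- L1] ++ [seq row_mx 0 b | b <- L2]); split.
- move=> i a /HA; rewrite -[i]splitK.
  case: (split i) => {}i /= [] [b bA ->].
  + by have [g Hg] := BD1 i b bA; exists (i1 g); rewrite B11 rm1 Hg rmorphM.
  + by exists 0; rewrite B12 mulr0.
  + by exists 0; rewrite B21 mulr0.
  + by have [g Hg] := BD2 i b bA; exists (i2 g); rewrite B22 rm2 Hg rmorphM.
- move=> i j; rewrite nth_cat se1 -[i]splitK -[j]splitK.
  case: (split i) (split j) => {}i [] {}j /=.
  + by rewrite ltn_ord block_mxEul mxE; apply: lsub_homog.
  + by rewrite ltn_ord block_mxEur mxE rpred0.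
  + by rewrite ltnNge leq_addr /= addKn block_mxEdl mxE rpred0.
  + by rewrite ltnNge leq_addr /= addKn block_mxEdr mxE; apply: lsub_homog.
- rewrite det_ublock !det_map_mx mulf_neq0 //.
    by rewrite -(rmorph0 i1) (inj_eq i1_inj).
  by rewrite -(rmorph0 i2) (inj_eq i2_inj).
- by rewrite sumn_cat size_cat !size_map leq_add.
have z1 b : (row_mx b 0 == 0 :> 'rV[rat]_(d1 + d2)) = (b == 0).
  by apply/eqP/eqP => [|->]; rewrite -?row_mx0 // => /eq_row_mx[].
have z2 b : (row_mx 0 b == 0 :> 'rV[rat]_(d1 + d2)) = (b == 0).
  by apply/eqP/eqP => [|->]; rewrite -?row_mx0 // => /eq_row_mx[].
split.
- rewrite mem_cat; apply/norP; split; apply/mapP => -[b bL /esym/eqP].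
    by rewrite z1 => /eqP b0; rewrite -b0 bL in L01.
  by rewrite z2 => /eqP b0; rewrite -b0 bL in L02.
- rewrite pairwise_cat !pairwise_map; apply/and3P; split.
  + apply/allrelP => x y /mapP[b bL ->] /mapP[c cL ->].
    apply/sub_rVP => -[k]; rewrite scale_row_mx scaler0 => /eq_row_mx[_ c0].
    by rewrite -c0 cL in L02.
  + apply: sub_pairwise Lp1 => x y; apply: contra => /sub_rVP[k].
    by rewrite scale_row_mx scaler0 => /eq_row_mx[-> _]; rewrite scalemx_sub.
  + apply: sub_pairwise Lp2 => x y; apply: contra => /sub_rVP[k].
    by rewrite scale_row_mx scaler0 => /eq_row_mx[_ ->]; rewrite scalemx_sub.
- move=> a; rewrite mem_cat => /orP[] /mapP[b bL ->].
    have [c nzc cA] := LA1 _ bL; exists c => //.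
    by rewrite scale_row_mx scaler0; exact: HA1.
  have [c nzc cA] := LA2 _ bL; exists c => //.
  by rewrite scale_row_mx scaler0; exact: HA2.
Qed.

(** Needed in full dimension: the flat is then the whole space, but it comes with a basis [P] of its
    own, and freeness has to be carried back to the standard coordinates. *)
Lemma saito_free_unitmx d (A : arrangement d) (P : 'M[rat]_d) e :
  P \in unitmx -> 0 \notin A -> saito_free (restr_arr A P) e -> saito_free A e.
Proof.
move=> uP A0 [se [B [L [BD Bh Bdet sL [L0 Lp LA]]]]]; split=> //.
have uPT : P^T \in unitmx by rewrite unitmx_tr.
pose i1 : {rmorphism S d -> S d} := lsub (invmx P^T).
have i1E p : i1 p = lsub (invmx P^T) p by [].
have i1_inj : injective i1 by apply: (@lsub_inj _ _ _ P^T); rewrite mulVmx.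
have restrP a : a \in A -> a *m P^T \in restr_arr A P.
  move=> aA; apply: map_f; rewrite mem_filter aA andbT.
  by apply: contraNneq A0 => /(congr1 (mulmx^~ (invmx P^T))); rewrite mulmxK // mul0mx => <-.
exists (map_mx i1 B *m map_mx (@mpolyC d rat) P), [seq b *m invmx P^T | b <- L]; split.
- move=> i a aA; have [g Hg] := BD i _ (restrP a aA); exists (i1 g).
  have -> : lin_poly a = i1 (lin_poly (a *m P^T)) by rewrite i1E lsub_lin mulmxK.
  rewrite -rmorphM -Hg /der_app raddf_sum /=.
  under eq_bigr => k _ do rewrite mxE scaler_sumr.
  rewrite exchange_big /=; apply: eq_bigr => k _.
  rewrite (lsubZ (invmx P^T)) [(a *m P^T) 0 k]mxE scaler_suml; apply: eq_bigr => j _.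
  by rewrite !mxE mulrC mul_mpolyC scalerA.
- move=> i j; rewrite mxE; apply: rpred_sum => k _; rewrite !mxE mulrC mul_mpolyC.
  by apply: dhomogZ; exact: lsub_homog.
- rewrite det_mulmx !det_map_mx mulf_neq0 //; first by rewrite -(rmorph0 i1) (inj_eq i1_inj).
  by rewrite mpolyC_eq0 -unitfE.
- by rewrite size_map.
have inj : injective (fun b : 'rV[rat]_d => b *m invmx P^T).
  by apply: (can_inj (g := fun b => b *m P^T)) => b; rewrite mulmxKV.
split.
- by rewrite -(mul0mx _ (invmx P^T)) (mem_map inj).
- rewrite pairwise_map; apply: sub_pairwise Lp => x y; apply: contra => /sub_rVP[k].
  by rewrite scalemxAl => /inj ->; rewrite scalemx_sub.
- move=> a /mapP[b bL ->]; have [c nzc] := LA _ bL.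
  case/mapP => x; rewrite mem_filter => /andP[_ xA] cb; exists c => //.
  by rewrite scalemxAl cb mulmxK.
Qed.

(** * Accuracy relative to a set of coordinates *)

Definition supported n (C : {set 'I_n}) (v : 'rV[rat]_n) := forall u, u \notin C -> v 0 u = 0.

(** Accuracy inside the coordinate subspace of [C], so that components can be merged. The condition
    on [v] says that the row space of [P] is a flat there. Dimension 0 is included because a merged
    flat may take nothing from one of its two factors. *)
Definition accurate_on n (A : arrangement n) (C : {set 'I_n}) (e : seq nat) : Prop :=
  [/\ sorted leq e, size e = #|C| &
   forall d, (d <= #|C|)%N -> exists P : 'M[rat]_(d, n),
   [/\ forall r, supported C (row r P), row_free P,
       forall v, supported C v -> (forall a, a \in A -> a *m P^T = 0 -> a *m v^T = 0) -> (v <= P)%MS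
     & saito_free (restr_arr A P) (take d e)]].

(** This decides how a dimension [d] is split between the flats of two factors: the smallest
    exponents of a product come from initial segments of both lists. *)
Lemma take_merge_leq (e1 e2 : seq nat) d : (d <= size e1 + size e2)%N ->
  exists d1 d2, [/\ (d1 <= size e1)%N, (d2 <= size e2)%N, (d1 + d2 = d)%N &
    perm_eq (take d (merge leq e1 e2)) (take d1 e1 ++ take d2 e2)].
Proof.
elim: e1 e2 d => [|x e1 IH1] e2 d.
  by move=> le_d; exists 0%N, d; split.
elim: e2 d => [|y e2 IH2] d.
  by rewrite addn0 => le_d; exists d, 0%N; split=> //=; rewrite ?addn0 // cats0.
case: d => [_|d]; first by exists 0%N, 0%N; split; rewrite ?take0.
rewrite /=; case: ifP => _ le_d.
  have [|d1 [d2 [l1 l2 dE pE]]] := IH1 (y :: e2) d; first by move: le_d; rewrite /= addSn.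
  by exists d1.+1, d2; split; rewrite ?ltnS // ?addSn ?dE //= perm_cons.
have [|d1 [d2 [l1 l2 dE pE]]] := IH2 d; first by move: le_d; rewrite /= addnS.
exists d1, d2.+1; split; rewrite ?ltnS // ?addnS ?dE //.
apply: (@perm_trans _ (y :: (take d1 (x :: e1) ++ take d2 e2))); first by rewrite perm_cons.
by have /permPl := perm_catCA [:: y] (take d1 (x :: e1)) (take d2 e2); apply.
Qed.

Lemma supported_dot n (C D : {set 'I_n}) (a v : 'rV[rat]_n) : [disjoint C & D] ->
  supported C a -> supported D v -> a *m v^T = 0.
Proof.
move=> dCD ha hv; apply/rowP => j; rewrite ord1 !mxE big1 // => u _; rewrite mxE.
have [uC|/ha ->] := boolP (u \in C); last by rewrite mul0r.
by rewrite hv ?mulr0 // (disjointFr dCD uC).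
Qed.

Definition restr_vec n (C : {set 'I_n}) (v : 'rV[rat]_n) : 'rV[rat]_n :=
  \row_u if u \in C then v 0 u else 0.

Lemma restr_vec_supp n (C : {set 'I_n}) v : supported C (restr_vec C v).
Proof. by move=> u uC; rewrite mxE (negbTE uC). Qed.

Lemma supported_rows n d (C : {set 'I_n}) (P : 'M[rat]_(d, n)) (w : 'rV_d) :
  (forall r, supported C (row r P)) -> supported C (w *m P).
Proof.
move=> H u uC; rewrite mxE big1 // => r _.
by have := H r u uC; rewrite mxE => ->; rewrite mulr0.
Qed.

Lemma supported_mul0 n d (C D : {set 'I_n}) (a : 'rV[rat]_n) (P : 'M[rat]_(d, n)) :
  [disjoint C & D] -> supported C a -> (forall r, supported D (row r P)) -> a *m P^T = 0.
Proof.
move=> dCD ha hP; apply/rowP => r; have := supported_dot dCD ha (hP r).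
by move/rowP/(_ 0); rewrite !mxE => E; rewrite -[RHS]E; apply: eq_bigr => u _; rewrite !mxE.
Qed.

Lemma accurate_on_merge n (A A1 A2 : arrangement n) (C1 C2 : {set 'I_n}) e1 e2 :
  [disjoint C1 & C2] -> A =i A1 ++ A2 ->
  (forall a, a \in A1 -> supported C1 a) -> (forall a, a \in A2 -> supported C2 a) ->
  accurate_on A1 C1 e1 -> accurate_on A2 C2 e2 ->
  accurate_on A (C1 :|: C2) (merge leq e1 e2).
Proof.
move=> dC HA HA1 HA2 [s1 z1 H1] [s2 z2 H2].
have dC' : [disjoint C2 & C1] by rewrite disjoint_sym.
split.
- by apply: merge_sorted => //; exact: leq_total.
- by rewrite size_merge size_cat z1 z2 cardsU (disjoint_setI0 dC) cards0 subn0.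
move=> d; rewrite cardsU (disjoint_setI0 dC) cards0 subn0 -z1 -z2.
case/take_merge_leq => d1 [d2 [l1 l2 <- pE]].
have [|P1 [sP1 fP1 lP1 SP1]] := H1 d1; first by rewrite -z1.
have [|P2 [sP2 fP2 lP2 SP2]] := H2 d2; first by rewrite -z2.
have A1P2 a : a \in A1 -> a *m P2^T = 0 by move=> /HA1 /(supported_mul0 dC); apply.
have A2P1 a : a \in A2 -> a *m P1^T = 0 by move=> /HA2 /(supported_mul0 dC'); apply.
exists (col_mx P1 P2); split.
- move=> r u; rewrite !inE negb_or => /andP[u1 u2]; rewrite mxE -[r]splitK.
  case: (split r) => {}r /=; rewrite ?col_mxEu ?col_mxEd.
    by have := sP1 r u u1; rewrite mxE.
  by have := sP2 r u u2; rewrite mxE.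
- apply: row_freeE => w; rewrite -[w]hsubmxK mul_row_col => w0.
  have w1 : lsubmx w *m P1 = 0.
    apply/rowP => u; have [uC|uC] := boolP (u \in C1); last first.
      by rewrite (supported_rows _ sP1) // mxE.
    have := congr1 (fun M : 'rV_n => M 0 u) w0; rewrite !mxE => E; rewrite -[RHS]E.
    have := supported_rows (rsubmx w) sP2 (u := u); rewrite (disjointFr dC uC) => /(_ isT).
    by rewrite mxE => ->; rewrite addr0.
  move: w0; rewrite w1 add0r => /eqP; rewrite mulmx_free_eq0 // => /eqP ->.
  by move/eqP: w1; rewrite mulmx_free_eq0 // => /eqP ->; rewrite row_mx0.
- move=> v sv Hv.
  have vE : v = restr_vec C1 v + restr_vec C2 v.
    apply/rowP => u; rewrite !mxE; have [uC|uC] := boolP (u \in C1).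
      by rewrite (disjointFr dC uC) addr0.
    by have [|uC2] := boolP (u \in C2); rewrite add0r // sv // !inE negb_or uC.
  rewrite vE; apply: (@submx_trans _ _ _ _ _ _ (P1 + P2)%MS); last by rewrite addsmxE.
  apply: addmx_sub_adds.
    apply: lP1 => [|a aA aP]; first exact: restr_vec_supp.
    have : a *m v^T = 0.
      by apply: Hv; rewrite ?HA ?mem_cat ?aA // tr_col_mx mul_mx_row aP A1P2 // row_mx0.
    rewrite {1}vE linearD mulmxDr (supported_dot dC (HA1 _ aA) (@restr_vec_supp _ C2 v)).
    by rewrite addr0.
  apply: lP2 => [|a aA aP]; first exact: restr_vec_supp.
  have : a *m v^T = 0.
    by apply: Hv; rewrite ?HA ?mem_cat ?aA ?orbT // tr_col_mx mul_mx_row aP A2P1 // row_mx0.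
  rewrite {1}vE linearD mulmxDr (supported_dot dC' (HA2 _ aA) (@restr_vec_supp _ C1 v)).
  by rewrite add0r.
- apply: saito_free_perm pE _.
  apply: (saito_free_prod _ _ _ SP1 SP2).
  + move=> b /mapP[a]; rewrite mem_filter HA mem_cat tr_col_mx mul_mx_row => /andP[nz /orP[] aA] ->.
      left; exists (a *m P1^T); last by rewrite A1P2.
      apply: map_f; rewrite mem_filter aA andbT.
      by apply: contraNneq nz => ->; rewrite A1P2 // row_mx0.
    right; exists (a *m P2^T); last by rewrite A2P1.
    apply: map_f; rewrite mem_filter aA andbT.
    by apply: contraNneq nz => ->; rewrite A2P1 // row_mx0.
  + move=> b /mapP[a]; rewrite mem_filter => /andP[nz aA] ->.
    apply/mapP; exists a; last by rewrite tr_col_mx mul_mx_row A1P2.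
    rewrite mem_filter HA mem_cat aA andbT tr_col_mx mul_mx_row.
    by apply: contraNneq nz; rewrite -row_mx0 => /eq_row_mx[->].
  + move=> b /mapP[a]; rewrite mem_filter => /andP[nz aA] ->.
    apply/mapP; exists a; last by rewrite tr_col_mx mul_mx_row A2P1.
    rewrite mem_filter HA mem_cat aA orbT andbT tr_col_mx mul_mx_row.
    by apply: contraNneq nz; rewrite -row_mx0 => /eq_row_mx[_ ->].
Qed.

Lemma saito_free_nil (A : arrangement 0) : saito_free A [::].
Proof.
split=> //; exists 1%:M, [::]; split=> //; try by case.
by rewrite det1 oner_eq0.
Qed.

Lemma accurate_on_set0 n (A : arrangement n) : accurate_on A set0 [::].
Proof.
split=> //; rewrite ?cards0 // => d; rewrite leqn0 => /eqP ->; exists 0; split.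
- by case.
- by apply: row_freeE => w _; apply/rowP; case.
- by move=> v sv _; rewrite (_ : v = 0) ?sub0mx //; apply/rowP => u; rewrite sv ?inE // mxE.
- exact: saito_free_nil.
Qed.

(** The mask keeps all the forms that vanish on [P]; one inclusion is then clear and the hypothesis
    is the other. *)
Lemma in_lattice_restr l (A : arrangement l) d (P : 'M[rat]_(d, l)) :
  (forall v : 'rV_l, (forall a, a \in A -> a *m P^T = 0 -> a *m v^T = 0) -> (v <= P)%MS) -> in_lattice A P.
Proof.
move=> H; exists [seq a *m P^T == 0 | a <- A]; rewrite -filter_mask /inter_space.
set B := filter _ A; apply/eqmxP/andP; split.
  apply/sub_kermxP/row_matrixP => i; rewrite row0; apply/rowP => k; rewrite !mxE.
  have : nth 0 B k \in B by apply: mem_nth.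
  rewrite mem_filter => /andP[/eqP/rowP/(_ i)]; rewrite !mxE => E _; rewrite -[RHS]E.
  by apply: eq_bigr => u _; rewrite !mxE mulrC.
apply/row_subP => i; apply: H => a aA aP.
have aB : a \in B by rewrite mem_filter aA aP eqxx.
have : row i (kermx (forms_mx B)^T) *m (forms_mx B)^T = 0 by rewrite -row_mul mulmx_ker row0.
move: (aB); rewrite -index_mem => iB; move/rowP/(_ (Ordinal iB)); rewrite !mxE => E.
apply/rowP => j; rewrite ord1 !mxE -[RHS]E; apply: eq_bigr => u _.
by rewrite !mxE /= nth_index // mulrC.
Qed.

Lemma accurate_on_accurate n (A : arrangement n) e : 0 \notin A ->
  accurate_on A setT e -> accurate A.
Proof.
move=> A0 [se ze H]; rewrite cardsT card_ord in ze H; exists e; split=> //.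
  have [P [_ fP _ SP]] := H n (leqnn n); apply: saito_free_exponents.
  apply: (saito_free_unitmx (P := P)) => //; first by rewrite -row_free_unit.
  by move: SP; rewrite take_oversize ?ze.
move=> d /andP[_ le_d]; have [P [_ fP lP SP]] := H d le_d; exists P; split=> //.
  by apply: in_lattice_restr => v; apply: lP => u; rewrite inE.
exact: saito_free_exponents.
Qed.

(** * Discrete primitives *)

Section Beta.
Variables (K : comNzRingType) (f : {rmorphism rat -> K}).
Implicit Types (s t : K) (R : {poly K}).

(* Homogenised Bernoulli-type polynomials: beta s t m has difference s * t ^ m under t |-> t + s. *)
Fixpoint betas s t n : seq K :=
  if n is k.+1 then
    rcons (betas s t k) (f (k.+1%:R)^-1 *
      (t ^+ k.+1 - \sum_(i < k) 'C(k.+1, i)%:R * s ^+ (k - i) * (betas s t k)`_i))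
  else [::].

Definition beta s t m := (betas s t m.+1)`_m.

Lemma size_betas s t n : size (betas s t n) = n.
Proof. by elim: n => //= n IH; rewrite size_rcons IH. Qed.

Lemma nth_betas s t n i : (i < n)%N -> (betas s t n)`_i = beta s t i.
Proof.
elim: n => // n IH; rewrite ltnS leq_eqVlt => /orP[/eqP -> //|lt_in].
by rewrite /= nth_rcons size_betas lt_in IH.
Qed.

Lemma betaE s t m : beta s t m = f (m.+1%:R)^-1 *
  (t ^+ m.+1 - \sum_(i < m) 'C(m.+1, i)%:R * s ^+ (m - i) * beta s t i).
Proof.
rewrite /beta /= nth_rcons size_betas ltnn eqxx; congr (_ * (_ - _)).
by apply: eq_bigr => i _; rewrite nth_betas.
Qed.

Lemma f_invS m : f (m.+1%:R)^-1 * m.+1%:R = 1.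
Proof.
rewrite -(rmorph_nat f) -rmorphM mulVf ?rmorph1 //.
by rewrite pnatr_eq0.
Qed.

(** The recursion solves [(t + s)^(m+1) - t^(m+1) = \sum_(i <= m) C(m+1, i) s^(m-i) (s t^i)] for its
    last term, the earlier [s t^i] being already differences of [beta s t i]. *)
Lemma beta_shift s t m : beta s (t + s) m - beta s t m = s * t ^+ m.
Proof.
elim/ltn_ind: m => m IH; rewrite !betaE -mulrBr.
rewrite [t + s]addrC exprDn big_ord_recr /= subnn expr0 mul1r binn mulr1n [s + t]addrC.
rewrite big_ord_recr /= subSn // subnn expr1 binSn.
rewrite -[RHS]mul1r -[in RHS](f_invS m) -[RHS]mulrA; congr (_ * _).
transitivity (m.+1%:R * (s * t ^+ m) + (\sum_(i < m) s ^+ (m.+1 - i) * t ^+ i *+ 'C(m.+1, i)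
    - \sum_(i < m) 'C(m.+1, i)%:R * s ^+ (m - i) * (beta s (t + s) i - beta s t i))).
  under [X in _ = _ + (_ - X)]eq_bigr => i _ do rewrite mulrBr.
  rewrite sumrB -mulr_natl; ring.
rewrite -sumrB big1 ?addr0 // => i _; rewrite IH // subSn; last exact: ltnW.
by rewrite exprS -mulr_natl; ring.
Qed.

Lemma beta_t0 s m : beta s 0 m = 0.
Proof.
elim/ltn_ind: m => m IH; rewrite betaE expr0n /= sub0r big1 ?oppr0 ?mulr0 // => i _.
by rewrite IH ?mulr0.
Qed.

Lemma beta_s0 t m : beta 0 t m = f (m.+1%:R)^-1 * t ^+ m.+1.
Proof.
rewrite betaE big1 ?subr0 // => i _.
by rewrite expr0n subn_eq0 leqNgt ltn_ord mulr0 mul0r.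
Qed.

(** [beta] is a value in [K] and not a polynomial in [t], so the factor [t - t'] is extracted along
    the recursion. *)
Lemma beta_dvd s t t' m : exists h, beta s t m - beta s t' m = (t - t') * h.
Proof.
elim/ltn_ind: m => m IH.
have /fin_all_exists[h Hh] : forall i : 'I_m, exists h, beta s t i - beta s t' i = (t - t') * h.
  by move=> i; apply: IH.
exists (f (m.+1%:R)^-1 * (\sum_(i < m.+1) t ^+ (m - i) * t' ^+ i
   - \sum_(i < m) 'C(m.+1, i)%:R * s ^+ (m - i) * h i)).
rewrite !betaE -mulrBr mulrCA; congr (_ * _).
rewrite mulrBr -subrXX mulr_sumr.
under [X in _ = _ - X]eq_bigr => i _ do rewrite mulrCA -Hh mulrBr.
by rewrite sumrB; ring.
Qed.

(** For [s = 0] this is the ordinary integral of [R] from 0 to [t], the form in which it enters the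
    determinant. *)
Definition prim s (R : {poly K}) t := \sum_(m < size R) R`_m * beta s t m.

Lemma primE N s R t : (size R <= N)%N -> prim s R t = \sum_(m < N) R`_m * beta s t m.
Proof.
move=> le_N; rewrite /prim (big_ord_widen _ (fun m => R`_m * beta s t m) le_N) big_mkcond /=.
apply: eq_bigr => i _; case: ltnP => // le_i.
by rewrite nth_default // mul0r.
Qed.

Lemma prim_shift s R t : prim s R (t + s) - prim s R t = s * R.[t].
Proof.
rewrite /prim -sumrB horner_coef mulr_sumr; apply: eq_bigr => i _.
by rewrite -mulrBr beta_shift mulrCA.
Qed.

Lemma prim_t0 s R : prim s R 0 = 0.
Proof. by rewrite /prim big1 // => i _; rewrite beta_t0 mulr0. Qed.

Lemma prim_dvd s R t t' : exists h, prim s R t - prim s R t' = (t - t') * h.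
Proof.
have /fin_all_exists[h Hh] : forall i : 'I_(size R), exists h, beta s t i - beta s t' i = (t - t') * h.
  by move=> i; apply: beta_dvd.
exists (\sum_(i < size R) R`_i * h i); rewrite /prim -sumrB mulr_sumr; apply: eq_bigr => i _.
by rewrite -mulrBr Hh mulrCA.
Qed.

Lemma prim_mulXn k (V : {poly K}) t :
  prim 0 ('X^k * V) t = t ^+ k.+1 * \sum_(j < size V) V`_j * f ((k + j).+1%:R)^-1 * t ^+ j.
Proof.
rewrite (@primE (k + size V)); last first.
  by apply: leq_trans (size_polyMleq _ _) _; rewrite size_polyXn.
rewrite big_split_ord /= big1 ?add0r => [|i _]; last first.
  by rewrite coefXnM ltn_ord mul0r.
rewrite mulr_sumr; apply: eq_bigr => j _; rewrite coefXnM ltnNge leq_addr /= addKn.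
by rewrite beta_s0 -addSn exprD; ring.
Qed.
End Beta.

Lemma beta_morph (K K' : comNzRingType) (f : {rmorphism rat -> K}) (g : {rmorphism K -> K'})
    (f' : {rmorphism rat -> K'}) s t m : (forall c, g (f c) = f' c) ->
  g (beta f s t m) = beta f' (g s) (g t) m.
Proof.
move=> gf; elim/ltn_ind: m => m IH; rewrite !betaE rmorphM gf rmorphB rmorphXn rmorph_sum.
congr (_ * (_ - _)); apply: eq_bigr => i _.
by rewrite !rmorphM rmorph_nat rmorphXn IH.
Qed.

Lemma prim_morph (K K' : comNzRingType) (f : {rmorphism rat -> K}) (g : {rmorphism K -> K'})
    (f' : {rmorphism rat -> K'}) s R t : (forall c, g (f c) = f' c) ->
  g (prim f s R t) = prim f' (g s) (map_poly g R) (g t).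
Proof.
move=> gf; rewrite [RHS](@primE _ _ (size R)); last by rewrite map_polyE (leq_trans (size_Poly _)) // size_map.
rewrite /prim rmorph_sum; apply: eq_bigr => i _.
by rewrite rmorphM (beta_morph _ _ _ gf) coef_map.
Qed.

Section Homog.
Variable d : nat.
Implicit Types (s t : S d) (R : {poly S d}).

Lemma beta_homog s t m : s \is 1.-homog -> t \is 1.-homog ->
  beta (@mpolyC d rat) s t m \is m.+1.-homog.
Proof.
move=> hs ht; elim/ltn_ind: m => m IH; rewrite betaE mul_mpolyC; apply: dhomogZ.
apply: rpredB; first by have := dhomogMn m.+1 ht; rewrite mul1n.
apply: rpred_sum => i _; rewrite -mulrA mulr_natl; apply: rpredMn.
have := dhomogM (dhomogMn (m - i) hs) (IH i (ltn_ord i)).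
by rewrite mul1n addnS subnK // ltnW.
Qed.

(** Homogeneity of total degree [D], the variable of [{poly S d}] counting for one; the equation
    [m + e = D] avoids a truncated subtraction. *)
Definition hpoly D R :=
  (forall m e, (m + e = D)%N -> R`_m \is e.-homog) /\ (size R <= D.+1)%N.

Lemma hpoly_prim D s t R : s \is 1.-homog -> t \is 1.-homog -> hpoly D R ->
  prim (@mpolyC d rat) s R t \is D.+1.-homog.
Proof.
move=> hs ht [hR /primE ->]; apply: rpred_sum => i _.
have iD := ltn_ord i; rewrite ltnS in iD.
have := dhomogM (hR i (D - i)%N (subnKC iD)) (beta_homog i hs ht).
by rewrite addnS subnK.
Qed.

Lemma hpolyM D D' R R' : hpoly D R -> hpoly D' R' -> hpoly (D + D') (R * R').
Proof.
move=> [hR sR] [hR' sR']; split; last first.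
  by apply: leq_trans (size_polyMleq _ _) _; rewrite -subn1 leq_subLR; apply: leq_trans (leq_add sR sR') _; rewrite addSn add1n addnS.
move=> m e me; rewrite coefM; apply: rpred_sum => k _.
have km := ltn_ord k; rewrite ltnS in km.
have [kD|kD] := leqP k D; last by rewrite nth_default ?mul0r ?rpred0 // (leq_trans sR).
have [kD'|kD'] := leqP (m - k) D'; last first.
  by rewrite [R'`_ _]nth_default ?mulr0 ?rpred0 // (leq_trans sR').
have := dhomogM (hR k (D - k)%N (subnKC kD)) (hR' (m - k)%N (D' - (m - k))%N (subnKC kD')).
suff -> : (D - k + (D' - (m - k)) = e)%N by [].
lia.
Qed.

Lemma hpolyXn k : hpoly k 'X^k.
Proof.
split; last by rewrite size_polyXn.
move=> m e me; rewrite coefXn; have [mk|_] := eqVneq m k; last exact: rpred0.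
have -> : e = 0%N by lia.
exact: dhomog1.
Qed.

Lemma hpolyXsubC (c : S d) : c \is 1.-homog -> hpoly 1 ('X - c%:P).
Proof.
move=> hc; split; last by rewrite size_XsubC.
move=> m e; case: m => [|[|m]] me.
- have -> : e = 1%N by lia.
  by rewrite coefB coefX coefC /= sub0r rpredN.
- have -> : e = 0%N by lia.
  by rewrite coefB coefX coefC /= subr0; exact: dhomog1.
- by exfalso; lia.
Qed.

Lemma hpoly_prod (I : finType) (P : pred I) (F : I -> {poly S d}) :
  (forall i, P i -> hpoly 1 (F i)) -> hpoly #|P| (\prod_(i | P i) F i).
Proof.
move=> H; rewrite -sum1_card; elim/big_rec2: _ => [|i n p Pi hp].
  by rewrite -(expr0 'X); exact: hpolyXn.
by apply: hpolyM => //; exact: H.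
Qed.
End Homog.

Lemma poly_nonroot (p : {poly rat}) : p != 0 -> exists x, p.[x] != 0.
Proof.
move=> nz; pose rs := [seq i%:R : rat | i <- iota 0 (size p)].
have [/roots_geq_poly_eq0 H|] := boolP (all (root p) rs).
  case/eqP: nz; apply: H; last by rewrite size_map size_iota.
  rewrite map_inj_uniq ?iota_uniq // => i j /eqP.
  by rewrite eqr_nat => /eqP.
by rewrite -has_predC => /hasP[x _ /= px]; exists x.
Qed.

Section BlockDet.
Variables (n : nat) (blk m : 'I_n -> nat).

(** The weights of the block-Shi derivations at [s = 0], where the shifts between blocks disappear.
    Inside one block the products coincide and only the exponents [m] tell the points apart. *)
Definition block_weight (K : comNzRingType) (y : 'I_n -> K) (i : 'I_n) : {poly K} :=
  'X^(m i) * \prod_(a | blk a != blk i) ('X - (y a)%:P).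

Definition block_mat (K : comNzRingType) (f : {rmorphism rat -> K}) (y : 'I_n -> K) : 'M[K]_n :=
  \matrix_(i, b) prim f 0 (block_weight y i) (y b).

Lemma map_block_weight (K K' : comNzRingType) (g : {rmorphism K -> K'}) y i :
  map_poly g (block_weight y i) = block_weight (g \o y) i.
Proof.
rewrite rmorphM /= map_polyXn rmorph_prod; congr (_ * _); apply: eq_bigr => a _.
by rewrite rmorphB /= map_polyX map_polyC.
Qed.

Lemma map_block_mat (K K' : comNzRingType) (f : {rmorphism rat -> K}) (g : {rmorphism K -> K'})
    (f' : {rmorphism rat -> K'}) y : (forall c, g (f c) = f' c) ->
  map_mx g (block_mat f y) = block_mat f' (g \o y).
Proof.
by move=> gf; apply/matrixP => i j; rewrite !mxE (prim_morph _ _ _ gf) map_block_weight rmorph0.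
Qed.
End BlockDet.

(* The point b with the smallest weight is sent to 0: at leading order its column is
   supported on the diagonal, and it leaves a matrix of the same kind. *)
Lemma block_det n (blk m : 'I_n -> nat) :
  (forall i j, blk i = blk j -> m i = m j -> i = j) ->
  exists2 y : 'I_n -> rat, forall a, y a != 0 & \det (block_mat blk m (idfun : rat -> rat) y) != 0.
Proof.
elim: n blk m => [|n IH] blk m inj.
  by exists (fun _ => 1) => [_|]; rewrite ?det_mx00 oner_eq0.
have [b _ bmin] := arg_minnP m (isT : xpredT (ord0 : 'I_n.+1)).
pose blk' i := blk (lift b i).
(* Sending [y b] to 0 turns the factor [X - y b], present in the weights of the other blocks, into
   one more power of [X]. *)
pose m' i := (m (lift b i) + (blk b != blk (lift b i)))%N.
have [|y' y'0 det'] := IH blk' m'.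
  move=> i j eb; rewrite /m' /blk' in eb *; rewrite eb => /addIn em.
  exact/(@lift_inj _ b)/inj.
pose yp (a : 'I_n.+1) : {poly rat} := if unlift b a is Some i then (y' i)%:P else 'X.
have ypb : yp b = 'X by rewrite /yp unlift_none.
have ypl i : yp (lift b i) = (y' i)%:P by rewrite /yp liftK.
pose M := block_mat blk m (polyC : {rmorphism rat -> {poly rat}}) yp.
pose V i := \prod_(a | blk a != blk i) ('X - (yp a)%:P).
pose q i : {poly rat} := 'X^(m i - m b) * \sum_(j < size (V i)) (V i)`_j * (((m i + j).+1%:R)^-1)%:P * 'X^j.
have Mb i : M i b = 'X^((m b).+1) * q i.
  rewrite mxE ypb prim_mulXn mulrA -exprD addSn subnKC //.
  exact: bmin.
pose c : rat := (m b).+1%:R^-1 * \prod_(a | blk a != blk b) - (yp a).[0].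
(* For [i != b] the constant term vanishes: either [m i > m b], or [m i = m b], the blocks differ by
   [inj], and the point [b] itself contributes a factor 0. *)
have q0 i : (q i).[0] = (i == b)%:R * c.
  have V0 : (V i)`_0 = \prod_(a | blk a != blk i) - yp a.
    rewrite -horner_coef0 horner_prod; apply: eq_bigr => a _.
    by rewrite hornerXsubC sub0r.
  rewrite hornerM hornerXn horner_sum.
  have -> : \sum_(j < size (V i)) ((V i)`_j * (((m i + j).+1%:R)^-1)%:P * 'X^j).[0] =
      (m i).+1%:R^-1 * ((V i)`_0).[0].
    case E : (size (V i)) => [|k].
      rewrite big_ord0; move/eqP: E; rewrite size_poly_eq0 => /eqP ->.
      by rewrite coef0 horner0 mulr0.
    rewrite big_ord_recl /= big1 ?addr0 => [|j _].
      by rewrite addn0 expr0 mulr1 hornerM hornerC mulrC.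
    by rewrite hornerM hornerXn expr0n mulr0.
  rewrite V0 horner_prod.
  under [X in _ * (_ * X)]eq_bigr => a _ do rewrite hornerN.
  have [->|ne] := eqVneq i b; first by rewrite subnn expr0 !mul1r.
  rewrite mul0r; have [mi|mi] := eqVneq (m i) (m b); last first.
    rewrite expr0n subn_eq0 leqNgt ltn_neqAle eq_sym mi /=.
    by rewrite (bmin i isT) mul0r.
  have bi : blk b != blk i by apply: contra ne => /eqP/esym/inj; rewrite mi => ->.
  by rewrite (bigD1 b) //= ypb hornerX oppr0 mul0r !mulr0.
have c0 : c != 0.
  rewrite mulf_neq0 ?invr_eq0 ?pnatr_eq0 //; apply/prodf_neq0 => a ab.
  rewrite oppr_eq0; have [i ->|ae] := unliftP b a; first by rewrite ypl hornerC.
  by rewrite ae eqxx in ab.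
pose g0 : {rmorphism {poly rat} -> rat} := horner_eval 0.
have minor0 : (\det (row' b (col' b M))).[0] = \det (block_mat blk' m' (idfun : rat -> rat) y').
  rewrite -[LHS]/(g0 _) -det_map_mx; congr (\det _); apply/matrixP => i j.
  rewrite !mxE (@prim_morph _ _ _ g0 (idfun : rat -> rat)) => [|x]; last exact: hornerC.
  rewrite ypl map_block_weight rmorph0; congr (prim _ _ _ _); last exact: hornerC.
  rewrite /block_weight /m' exprD -mulrA; congr (_ * _).
  have [bi|bi] := boolP (blk b != blk (lift b i)).
    rewrite (bigD1_ord b) //= ypb expr1; congr (_ * _).
      by rewrite [g0 'X]hornerX subr0.
    by apply: eq_big => // a _; rewrite ypl [g0 _]hornerC.
  rewrite expr0 mul1r big_mkcond (bigD1_ord b) //= (negbTE bi) mul1r -big_mkcond /=.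
  by apply: eq_big => // a _; rewrite ypl [g0 _]hornerC.
have detM : \det M = 'X^((m b).+1) * \sum_i q i * cofactor M i b.
  rewrite (expand_det_col _ b) mulr_sumr; apply: eq_bigr => i _.
  by rewrite Mb mulrA.
have detM0 : \det M != 0.
  rewrite detM mulf_neq0 //; first by rewrite monic_neq0 ?monicXn.
  apply/eqP => /(congr1 (horner^~ 0)); rewrite horner0 horner_sum.
  rewrite (bigD1 b) //= big1 ?addr0 => [|i ne]; last by rewrite hornerM q0 (negbTE ne) !mul0r.
  rewrite hornerM q0 eqxx mul1r /cofactor hornerM minor0 -signr_odd oddD addbb expr0 hornerC mul1r.
  by move/eqP; rewrite mulf_eq0 (negbTE c0) (negbTE det').
(* The extra factor ['X] makes the chosen value of the point [b] nonzero, as the induction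
   requires. *)
have [|x] := @poly_nonroot (\det M * 'X); first by rewrite mulf_neq0 // polyX_eq0.
rewrite hornerMX mulf_eq0 negb_or => /andP[detx x0].
exists (fun a => (yp a).[x]).
  by move=> a; have [i ->|->] := unliftP b a; rewrite ?ypl ?ypb ?hornerC ?hornerX.
pose gx : {rmorphism {poly rat} -> rat} := horner_eval x.
move: detx; rewrite -[_.[x]]/(gx _) -det_map_mx (@map_block_mat _ _ _ _ _ _ _ (idfun : rat -> rat)) // => y.
exact: hornerC.
Qed.

(** * Block-Shi arrangements *)

Section Ranks.
Variable blk : nat -> nat.

Definition cnt c i := count (fun a => blk a == c) (iota 0 i).
Definition rk i := cnt (blk i) i.
Definition pos i := (i - rk i)%N.

Lemma cntS c i : cnt c i.+1 = (cnt c i + (blk i == c))%N.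
Proof. by rewrite /cnt -addn1 iotaD count_cat /= addn0. Qed.

Lemma cnt_mono c i j : (i <= j)%N -> (cnt c i <= cnt c j)%N.
Proof. by move=> /subnKC <-; rewrite /cnt iotaD count_cat leq_addr. Qed.

Lemma cnt_leq c i : (cnt c i <= i)%N.
Proof. by rewrite /cnt; apply: leq_trans (count_size _ _) _; rewrite size_iota. Qed.

Lemma cnt_rank c i r : (r < cnt c i)%N -> exists a, [/\ (a < i)%N, blk a = c & rk a = r].
Proof.
elim: i => [|i IH] //; rewrite cntS.
have [lt_r _|ge_r] := ltnP r (cnt c i).
  by have [a [ai ac ar]] := IH lt_r; exists a; split=> //; apply: ltnW.
case: eqP => [bi|_]; last by rewrite addn0 ltnNge ge_r.
rewrite addn1 ltnS => le_r; exists i; split=> //.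
by rewrite /rk bi; apply/eqP; rewrite eqn_leq le_r ge_r.
Qed.

Lemma rk_lt_cnt i j : (i < j)%N -> (rk i < cnt (blk i) j)%N.
Proof. by move=> lt_ij; apply: leq_trans (cnt_mono _ lt_ij); rewrite cntS eqxx addn1. Qed.

Variable N : nat.
Hypothesis sorted_blk : forall i j, (i < j < N)%N -> (rk i < rk j)%N \/ rk i = rk j /\ (blk i < blk j)%N.

Lemma rk_mono i j : (i <= j < N)%N -> (rk i <= rk j)%N.
Proof.
case/andP => le_ij jN; move: le_ij; rewrite leq_eqVlt => /orP[/eqP -> //|lt_ij].
have [|/ltnW //|[-> _] //] := @sorted_blk i j; by rewrite lt_ij.
Qed.

Lemma rk_step i : (i.+1 < N)%N -> (rk i.+1 <= (rk i).+1)%N.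
Proof.
move=> iN; case E : (rk i.+1) => [|r] //; rewrite ltnS.
have [|a [ai _ <-]] := @cnt_rank (blk i.+1) i.+1 r; first by rewrite -/(rk i.+1) E.
by apply: rk_mono; rewrite -ltnS ai ltnW.
Qed.

(** Every step inside a window is one hyperplane of the arrangement: [Y_(i+1) = Y_i + s] when the
    position grows, which the inequality of the weights permits, and [Y_(i+1) = Y_i] otherwise. This
    makes the window a flat and drives the inductions along it. *)
Lemma pos_step i : (i.+1 < N)%N ->
  (pos i.+1 = (pos i).+1 /\ (blk i < blk i.+1)%N) \/ pos i.+1 = pos i.
Proof.
move=> iN; have ri := cnt_leq (blk i) i; rewrite -/(rk i) in ri.
have := rk_step iN; rewrite /pos leq_eqVlt ltnS => /orP[/eqP -> |]; first by right; rewrite subSS.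
have [|lt_r|[<- lt_b _]] := @sorted_blk i i.+1; rewrite ?ltnSn //.
  by rewrite leqNgt lt_r.
by left; rewrite subSn.
Qed.

Lemma pos_surj i x : (i < N)%N -> (x <= pos i)%N -> exists2 j, (j <= i)%N & pos j = x.
Proof.
elim: i => [|i IH] iN; first by rewrite /pos sub0n leqn0 => /eqP ->; exists 0%N.
have [xi _|xi] := leqP x (pos i).
  by have [j ji jx] := IH (ltnW iN) xi; exists j => //; apply: leqW.
have [[pE _]|pE] := pos_step iN; rewrite pE => xi'.
  by exists i.+1 => //; rewrite pE; apply/eqP; rewrite eqn_leq xi xi'.
by move: xi; rewrite ltnNge xi'.
Qed.

(** Restricted to the flat, a free point [b] meets the window in the hyperplanes [y_b = x s], and
    the exponents require all these [x] to occur. The positions fill an interval starting at 0; a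
    shifted form can add one value at its upper end. *)
Lemma window_cover K b x : (0 < K)%N -> (K <= b < N)%N -> (x <= K - cnt (blk b) K)%N ->
  exists2 i, (i < K)%N & pos i = x \/ ((blk i < blk b)%N /\ x = (pos i).+1).
Proof.
case: K => // k _ /andP[kb bN] xle.
have kN : (k < N)%N by apply: leq_trans bN; apply: ltnW.
have [xk|xk] := leqP x (pos k).
  by have [j jk <-] := pos_surj kN xk; exists j => //; left.
have rkk : (rk k <= k)%N by apply: cnt_leq.
have kcnt : (cnt (blk b) k.+1 <= k.+1)%N by apply: cnt_leq.
(* Only [x = pos k + 1] is left, with [k] the last point of the window. The block of [b] then has
   exactly [rk k] points in the window, so the next one comes after [k], and the order gives
   [blk k < blk b]. *)
have le_c : (cnt (blk b) k.+1 <= rk k)%N by move: xk xle; rewrite /pos; lia.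
have rkb : (rk k <= rk b)%N by apply: rk_mono; rewrite ltnW.
have ge_c : (rk k <= cnt (blk b) k.+1)%N.
  case E : (rk k) => [|h] //.
  have [|a [ab ac ar]] := @cnt_rank (blk b) b h; first by rewrite -/(rk b) -E.
  have ak : (a < k)%N.
    rewrite ltnNge; apply/negP => ka.
    have : (rk k <= rk a)%N by apply: rk_mono; rewrite ka (ltn_trans ab).
    by rewrite E ar ltnn.
  have := rk_lt_cnt (ltnW ak : (a < k.+1)%N); rewrite ac ar; exact.
have cE : cnt (blk b) k.+1 = rk k by apply/eqP; rewrite eqn_leq le_c.
exists k => //; right; split; last by move: xk xle; rewrite cE /pos; lia.
have [lt_r|ge_r] := ltnP (rk k) (rk b).
  have [a [ab ac ar]] := cnt_rank lt_r.
  have ka : (k < a)%N.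
    rewrite ltnNge; apply/negP => ak.
    have := rk_lt_cnt (ak : (a < k.+1)%N); by rewrite ac ar cE ltnn.
  have [|lt|[_]] := @sorted_blk k a; rewrite ?ka ?(ltn_trans ab) //; last by rewrite ac.
  by rewrite ar ltnn in lt.
have [|lt|[_] //] := @sorted_blk k b; first by rewrite kb.
by move: lt; rewrite ltnNge ge_r.
Qed.
End Ranks.

Lemma cnt_card (blk : nat -> nat) c N : cnt blk c N = #|[pred a : 'I_N | blk a == c]|.
Proof.
rewrite /cnt -val_enum_ord count_map -size_filter cardE; congr size.
by rewrite [RHS]/enum_mem -enumT; apply: eq_filter.
Qed.

Lemma iota_ord m (b : 'I_m) : iota 0 m = iota 0 b ++ iota b (m - b).
Proof. by rewrite -{2}[b : nat]add0n -iotaD subnKC // ltnW. Qed.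

(** If [blk a < c], the factor of [a] is unshifted and vanishes at [Y a]. Otherwise [c < blk b], and
    the factor of [b], shifted by [s], takes the value [-(Y b - Y a - s)]. The shift by blocks is
    designed for this dichotomy. *)
Lemma weight_root (R : comNzRingType) k N (blk : 'I_N -> nat) c (s : R) (Y : 'I_N -> R) a b :
  (blk a < blk b)%N -> exists h,
  ('X^k * \prod_(a | blk a != c) ('X - (Y a - (if (c < blk a)%N then s else 0))%:P)).[Y a]
    = (Y b - Y a - s) * h.
Proof.
move=> ab; rewrite hornerM horner_prod.
have [ac|ac] := ltnP (blk a) c.
  exists 0; rewrite (bigD1 a) /=; last by rewrite neq_ltn ac.
  by rewrite ltnNge (ltnW ac) /= hornerXsubC subr0 subrr mul0r !mulr0.
have bc : (c < blk b)%N by apply: leq_ltn_trans ab.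
rewrite (bigD1 b) /=; last by rewrite neq_ltn bc orbT.
rewrite bc hornerXsubC.
set u := ('X^_).[_]; set v := \prod_(_ | _) _.
by exists (- u * v); ring.
Qed.

Lemma shifted_difference (R : comNzRingType) (x y s A B C h k : R) :
  A - B = (y - (x + s)) * h -> B - C = s * ((y - x - s) * k) ->
  A - C = (y - x - s) * (h + s * k).
Proof.
move=> AB BC; have -> : A - C = (A - B) + (B - C) by ring.
by rewrite AB BC; ring.
Qed.

Section BlockShi.
Variables (blk : nat -> nat) (K n : nat).
Hypothesis K_gt0 : (0 < K)%N.
Let N := (K + n)%N.
Hypothesis sorted_blk : forall i j, (i < j < N)%N ->
  (rk blk i < rk blk j)%N \/ rk blk i = rk blk j /\ (blk i < blk j)%N.

Definition sform : 'rV[rat]_(1 + n) := delta_mx 0 (lshift n 0).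
Definition yfree (b : 'I_n) : 'rV[rat]_(1 + n) := delta_mx 0 (rshift 1 b).
(* The first K points form one class, point i of it sitting at pos i * s; the others are free. *)
Definition yform (i : 'I_(K + n)) : 'rV[rat]_(1 + n) :=
  match split i with inl a => (pos blk a)%:R *: sform | inr b => yfree b end.

Definition shi_form (a : 'rV[rat]_(1 + n)) : Prop :=
  [\/ a = sform, exists i j, a = yform j - yform i |
      exists i j : 'I_(K + n), (blk i < blk j)%N /\ a = yform j - yform i - sform].

Lemma yform_l a : yform (lshift n a) = (pos blk a)%:R *: sform.
Proof. by rewrite /yform -/(unsplit (inl a)) unsplitK. Qed.

Lemma yform_r b : yform (rshift K b) = yfree b.
Proof. by rewrite /yform -/(unsplit (inr b)) unsplitK. Qed.

Let s : S (1 + n) := 'X_(lshift n 0).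
Let Y i := lin_poly (yform i).

Lemma lin_sform : lin_poly sform = s.
Proof. exact: lin_poly_delta. Qed.

Let bsize c := cnt blk c N.
Let blkf (i : 'I_n) := blk (K + i).

(** The product, over window and free points alike, gives tangency; the power of [X] separates
    points of the same block and brings the total degree to [N - rk - 1], one less than the
    exponent. *)
Definition shi_weight (i : 'I_n) : {poly S (1 + n)} :=
  'X^(bsize (blkf i) - (rk blk (K + i)).+1) *
  \prod_(a : 'I_(K + n) | blk a != blkf i) ('X - (Y a - (if (blkf i < blk a)%N then s else 0))%:P).

Definition shi_prim i t := prim (@mpolyC (1 + n) rat) s (shi_weight i) t.

Lemma shi_weight_root i (a b : 'I_(K + n)) : (blk a < blk b)%N ->
  exists h, (shi_weight i).[Y a] = (Y b - Y a - s) * h.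
Proof.
exact: (@weight_root _ _ (K + n) (fun a => blk a)).
Qed.

(** The derivation must respect the relations [Y_a = pos a * s] while killing [s]. When the position
    grows, the weight at [Y_a] is a multiple of [Y_(a+1) - Y_a - s = 0], so the primitive keeps its
    value 0. *)
Lemma shi_prim_class i (a : 'I_K) : shi_prim i (Y (lshift n a)) = 0.
Proof.
case: a => a aK; elim: a aK => [|a IH] aK.
  by rewrite /Y yform_l /pos /= sub0n scale0r linear0 /shi_prim prim_t0.
have aN : (a.+1 < N)%N by apply: leq_trans aK _; exact: leq_addr.
have {}IH := IH (ltnW aK).
have [[pE bE]|pE] := pos_step sorted_blk aN; last first.
  by rewrite -IH /Y !yform_l /= pE.
pose x : 'I_(K + n) := lshift n (Ordinal (ltnW aK)).
pose x' : 'I_(K + n) := lshift n (Ordinal aK).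
have YE : Y x' = Y x + s.
  by rewrite /Y !yform_l /= pE -natr1 scalerDl scale1r linearD /= lin_sform.
have [h Hh] := @shi_weight_root i x x' bE.
have := prim_shift (@mpolyC (1 + n) rat) s (shi_weight i) (Y x).
rewrite -YE Hh; have -> : Y x' - Y x - s = 0 by rewrite YE; ring.
by rewrite mul0r mulr0 -/(shi_prim i (Y x)) IH subr0.
Qed.

Lemma shi_weight_hpoly (i : 'I_n) : hpoly (N - (rk blk (K + i)).+1) (shi_weight i).
Proof.
have iN : (K + i < N)%N by rewrite ltn_add2l.
have rc : (rk blk (K + i) < bsize (blkf i))%N := rk_lt_cnt blk iN.
have card_ne : (#|[pred a : 'I_(K + n) | blk a != blkf i]| + bsize (blkf i))%N = N.
  by rewrite /bsize cnt_card addnC cardC card_ord.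
have card_eq : (bsize (blkf i) - (rk blk (K + i)).+1 + #|[pred a : 'I_(K + n) | blk a != blkf i]|
    = N - (rk blk (K + i)).+1)%N.
  by move: rc card_ne; lia.
rewrite -card_eq; apply: hpolyM; first exact: hpolyXn.
apply: hpoly_prod => a _; apply: hpolyXsubC; apply: rpredB; first exact: lin_poly_homog.
case: ifP => _; last exact: rpred0.
by rewrite -lin_sform lin_poly_homog.
Qed.

(** The first row is the Euler derivation; each further row kills [s] and applies one primitive to
    all the free points. *)
Definition shi_mx : 'M[S (1 + n)]_(1 + n) :=
  block_mx (const_mx s) (\row_b 'X_(rshift 1 b)) 0 (\matrix_(i, b) shi_prim i 'X_(rshift 1 b)).

Lemma shi_mx0 a : der_app (shi_mx (lshift n 0)) a = lin_poly a.
Proof.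
rewrite /der_app /lin_poly; apply: eq_bigr => j _; congr (_ *: _).
rewrite -[j]splitK; case: (split j) => {}j /=; rewrite ?block_mxEul ?block_mxEur mxE //.
by rewrite ord1.
Qed.

Lemma shi_mx_s i : der_app (shi_mx (rshift 1 i)) sform = 0.
Proof. by rewrite der_app_delta block_mxEdl mxE. Qed.

Lemma shi_mx_y i a : der_app (shi_mx (rshift 1 i)) (yform a) = shi_prim i (Y a).
Proof.
rewrite -[a]splitK; case: (split a) => {}a /=.
  by rewrite shi_prim_class yform_l linearZ /= shi_mx_s scaler0.
by rewrite /Y yform_r der_app_delta block_mxEdr mxE lin_poly_delta.
Qed.

(** For [Y_y - Y_x - s] one passes through [Y_x + s]: the primitive changes by a multiple of
    [Y_y - (Y_x + s)], then by [s] times the weight at [Y_x], divisible by [shi_weight_root]. *)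
Lemma shi_mx_tangent i a : shi_form a -> dvdl a (der_app (shi_mx i) a).
Proof.
move=> Ha; rewrite -[i]splitK; case: (split i) => {}i /=.
  by exists 1; rewrite ord1 shi_mx0 mulr1.
case: Ha => [->|[x [y ->]]|[x [y [xy ->]]]].
- by rewrite shi_mx_s; exact: dvdl0.
- have [h Hh] := prim_dvd (@mpolyC (1 + n) rat) s (shi_weight i) (Y y) (Y x).
  by exists h; rewrite !linearB /= !shi_mx_y Hh.
- have [h Hh] := prim_dvd (@mpolyC (1 + n) rat) s (shi_weight i) (Y y) (Y x + s).
  have [k Hk] := shi_weight_root i xy.
  have := prim_shift (@mpolyC (1 + n) rat) s (shi_weight i) (Y x); rewrite Hk => Hs.
  exists (h + s * k); rewrite !linearB /= shi_mx_s subr0 !shi_mx_y lin_sform -!/(Y _).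
  exact: shifted_difference Hh Hs.
Qed.

Definition shi_exponents : seq nat := 1%N :: [seq (N - rk blk (K + i))%N | i <- iota 0 n].

Lemma shi_mx_homog i j : shi_mx i j \is (nth 0%N shi_exponents i).-homog.
Proof.
rewrite -[i]splitK -[j]splitK; case: (split i) (split j) => {}i [] {}j; rewrite [unsplit _]/= [unsplit (_ j)]/=.
- by rewrite ord1 block_mxEul mxE dhomogX /= mdeg1.
- by rewrite ord1 block_mxEur mxE dhomogX /= mdeg1.
- by rewrite block_mxEdl mxE rpred0.
have -> : nth 0%N shi_exponents (rshift 1 i) = (N - rk blk (K + i))%N.
  by rewrite /= add0n (nth_map 0%N) ?size_iota // nth_iota.
rewrite block_mxEdr mxE.
have iN : (K + i < N)%N by rewrite ltn_add2l.
have -> : (N - rk blk (K + i) = (N - (rk blk (K + i)).+1).+1)%N.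
  by rewrite subnSK //; apply: leq_ltn_trans iN; exact: cnt_leq.
by apply: hpoly_prim (shi_weight_hpoly i); rewrite ?dhomogX /= ?mdeg1.
Qed.

(** After the factor [s] is split off, the other block may be specialised to [s = 0]. The window
    collapses to 0, each of its points outside the block of [i] becoming a power of [X], and
    [block_det] applies. *)
Lemma shi_mx_det : \det shi_mx != 0.
Proof.
rewrite det_ublock mulf_neq0 //.
  by rewrite (mx11_scalar (const_mx s)) det_scalar1 mxE -msize_poly_eq0 msizeX.
pose m (i : 'I_n) := (bsize (blkf i) - (rk blk (K + i)).+1 +
   #|[pred a : 'I_K | blk a != blkf i]|)%N.
have [|y _ det_y] := @block_det n blkf m.
  move=> i j bE; rewrite /m bE => /addIn mE; apply/val_inj/(@addnI K).
  have rc (k : 'I_n) : (rk blk (K + k) < bsize (blkf k))%N.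
    by apply: rk_lt_cnt; rewrite ltn_add2l.
  have := rc i; have := rc j; rewrite -bE => rj ri.
  have rE : rk blk (K + i) = rk blk (K + j) by move: mE; rewrite -?bE; lia.
  have lt_rk (x z : 'I_n) : blkf x = blkf z -> (K + x < K + z)%N -> (rk blk (K + x) < rk blk (K + z))%N.
    by move=> xz xz'; have := rk_lt_cnt blk xz'; rewrite -/(blkf x) xz.
  case: (ltngtP (K + i) (K + j)) => // lt.
    by have := lt_rk _ _ bE lt; rewrite rE ltnn.
  by have := lt_rk _ _ (esym bE) lt; rewrite rE ltnn.
pose v (u : 'I_(1 + n)) : rat := match split u with inl _ => 0 | inr b => y b end.
have vs : s.@[v] = 0 by rewrite mevalXU /v -/(unsplit (inl 0)) unsplitK.
have vy b : ('X_(rshift 1 b) : S (1 + n)).@[v] = y b by rewrite mevalXU /v -/(unsplit (inr b)) unsplitK.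
pose g : {rmorphism S (1 + n) -> rat} := meval v.
apply: contraNneq det_y => /(congr1 g); rewrite rmorph0 -det_map_mx => <-.
apply/eqP/esym; congr (\det _); apply/matrixP => i b; rewrite !mxE.
rewrite (@prim_morph _ _ _ g (idfun : rat -> rat)); last by move=> c; rewrite [g _]mevalC.
rewrite [g s]vs [g 'X__]vy; congr (prim _ _ _ _).
rewrite /block_weight /shi_weight /m exprD -mulrA rmorphM /= map_polyXn; congr (_ * _).
rewrite rmorph_prod big_split_ord /=; congr (_ * _).
  rewrite -prodr_const; apply: eq_bigr => a _; rewrite rmorphB /= map_polyX map_polyC.
  rewrite /Y yform_l linearZ /= lin_sform.
  suff -> : g ((pos blk a)%:R *: s - (if (blkf i < blk a)%N then s else 0)) = 0 by rewrite subr0.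
  by rewrite rmorphB /= mevalZ; case: ifP => _; rewrite ?meval0 vs mulr0 subr0.
apply: eq_bigr => a _; rewrite rmorphB /= map_polyX map_polyC.
rewrite /Y yform_r lin_poly_delta.
congr (_ - _%:P).
by rewrite raddfB /= vy; case: ifP => _; rewrite ?meval0 ?vs subr0.
Qed.

Definition shi_key (k : option 'I_n * int) : 'rV[rat]_(1 + n) :=
  k.2%:~R *: sform + oapp yfree 0 k.1.

(* Keys of the hyperplanes y_b = c s and y_b = y_a + c s, with a < b. *)
Definition shi_keys (b : 'I_n) : seq (option 'I_n * int) :=
  [seq (None, x%:Z) | x <- iota 0 (K - cnt blk (blkf b) K).+1] ++
  ([seq (Some a, 0) | a : 'I_n <- enum 'I_n & (a < b)%N] ++
   [seq (Some a, if (blkf a < blkf b)%N then 1 else - 1) |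
     a : 'I_n <- enum 'I_n & (a < b)%N && (blkf a != blkf b)]).

Lemma yfreeE b (u : 'I_n) : yfree b 0 (rshift 1 u) = (u == b)%:R.
Proof. by rewrite mxE eqxx /= (inj_eq (@rshift_inj _ _)). Qed.

Lemma yfree0 b : yfree b 0 (lshift n 0) = 0.
Proof. by rewrite mxE eq_lrshift. Qed.

Lemma sformE (u : 'I_n) : sform 0 (rshift 1 u) = 0.
Proof. by rewrite mxE eq_rlshift andbF. Qed.

Lemma shi_keyE k (u : 'I_n) : shi_key k 0 (rshift 1 u) = (k.1 == Some u)%:R.
Proof.
rewrite 2!mxE sformE mulr0 add0r; case: k.1 => [a|] /=; last by rewrite mxE.
by rewrite yfreeE eq_sym.
Qed.

Lemma shi_key0 k : shi_key k 0 (lshift n 0) = k.2%:~R.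
Proof.
rewrite 2!mxE [sform _ _]mxE !eqxx mulr1; case: k.1 => [a|] /=; last by rewrite mxE addr0.
by rewrite yfree0 addr0.
Qed.

Lemma shi_key_inj : injective shi_key.
Proof.
move=> [o x] [o' x'] eq_k.
have := congr1 (fun M : 'rV_(1 + n) => M 0 (lshift n 0)) eq_k.
rewrite !shi_key0 /= => /eqP; rewrite eqr_int => /eqP ->; congr (_, _).
have H u := congr1 (fun M : 'rV_(1 + n) => M 0 (rshift 1 u)) eq_k.
case: o o' H {eq_k} => [a|] [a'|] H //; [move: (H a)|move: (H a)|move: (H a')];
  rewrite !shi_keyE /= eqxx.
- by case: eqP => [-> //|_] /eqP; rewrite eqr_nat.
- by move=> /eqP; rewrite eqr_nat.
- by move=> /eqP; rewrite eqr_nat.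
Qed.

Lemma shi_keys_uniq b : uniq (shi_keys b).
Proof.
rewrite !cat_uniq; apply/and3P; split.
- by rewrite map_inj_uniq ?iota_uniq // => x y [].
- apply/hasPn => k; rewrite mem_cat => /orP[] /mapP[a _ ->]; by apply/mapP => -[].
apply/and3P; split.
- by rewrite map_inj_uniq; [apply: filter_uniq; exact: enum_uniq | move=> x y []].
- apply/hasPn => k /mapP[a _ ->]; apply/mapP => -[a' _ [_]].
  by case: ifP.
- by rewrite map_inj_uniq; [apply: filter_uniq; exact: enum_uniq | move=> x y []].
Qed.

Lemma shi_keys_lt b k a : k \in shi_keys b -> k.1 = Some a -> (a < b)%N.
Proof.
rewrite !mem_cat => /or3P[] /mapP[x]; first by move=> _ ->.
  by rewrite mem_filter => /andP[xb _] -> [<-].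
by rewrite mem_filter => /andP[/andP[xb _] _] -> [<-].
Qed.

Lemma cnt_blkf (b : 'I_n) : (cnt blk (blkf b) K + count (fun a : 'I_n => (a < b)%N && (blkf a == blkf b)) (enum 'I_n)
   = rk blk (K + b))%N.
Proof.
rewrite /rk [in RHS]/cnt iotaD count_cat add0n -/(cnt blk _ K); congr (_ + _)%N.
have -> : iota K b = map (fun a : 'I_n => K + a)%N [seq a : 'I_n <- enum 'I_n | (a < b)%N].
  rewrite -{1}[K]addn0 iotaDl (map_comp (addn K) (@nat_of_ord n)); congr map.
  rewrite -(filter_map (@nat_of_ord n) (fun i => i < b)%N) val_enum_ord.
  rewrite (iota_ord b) filter_cat (@eq_in_filter _ _ xpredT) ?filter_predT => [|x].
    rewrite (@eq_in_filter _ _ pred0) ?filter_pred0 ?cats0 // => x.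
    by rewrite mem_iota => /andP[bx _]; rewrite ltnNge bx.
  by rewrite mem_iota.
rewrite count_map count_filter; apply: eq_count => a /=.
by rewrite andbC.
Qed.

Lemma count_ord_lt m (b : 'I_m) : count (fun a : 'I_m => (a < b)%N) (enum 'I_m) = b.
Proof.
rewrite -(count_map (@nat_of_ord m) (fun i => i < b)%N) val_enum_ord.
rewrite (iota_ord b) count_cat (@eq_in_count _ _ xpredT) => [|x]; last by rewrite mem_iota.
rewrite count_predT size_iota (@eq_in_count _ _ pred0) ?count_pred0 ?addn0 // => x.
by rewrite mem_iota => /andP[bx _]; rewrite ltnNge bx.
Qed.

(** The values missing in the window and the missing shifted forms both come from earlier points in
    the block of [b]; together these points number [rk]. *)
Lemma size_shi_keys b : (size (shi_keys b) + rk blk (K + b) = K + b.*2.+1)%N.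
Proof.
rewrite !size_cat !size_map size_iota !size_filter count_ord_lt.
have := cnt_blkf b; have := cnt_leq blk (blkf b) K.
set u := count (fun a : 'I_n => (a < b)%N && (blkf a == blkf b)) _.
set w := count (fun a : 'I_n => (a < b)%N && (blkf a != blkf b)) _.
have E : (u + w)%N = b.
  rewrite -[RHS](count_ord_lt b) /u /w; elim: (enum 'I_n) => //= x l IH.
  by case: (x < b)%N (blkf x == blkf b) => [] [] /=; lia.
by lia.
Qed.

Definition shi_vec (b : 'I_n) (k : option 'I_n * int) := yfree b - shi_key k.

Definition shi_list : seq 'rV[rat]_(1 + n) :=
  sform :: [seq shi_vec b k | b <- enum 'I_n, k <- shi_keys b].

Lemma shi_vecE b k u : shi_vec b k 0 (rshift 1 u) = (u == b)%:R - (k.1 == Some u)%:R.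
Proof. by rewrite mxE [X in _ + X]mxE yfreeE shi_keyE. Qed.

Lemma shi_vec_top b k (u : 'I_n) : k \in shi_keys b -> (b <= u)%N -> shi_vec b k 0 (rshift 1 u) = (u == b)%:R.
Proof.
move=> kb bu; rewrite shi_vecE; case: (k.1 =P Some u) => [/(shi_keys_lt kb)|_]; last by rewrite subr0.
by rewrite ltnNge bu.
Qed.

(** The forms are triangular: [shi_vec b k] has coefficient 1 at [y_b] and 0 at every later free
    point, so a proportionality fixes [b] and then the factor 1. *)
Lemma shi_list_prop x y : x \in shi_list -> y \in shi_list -> (y <= x)%MS -> y = x.
Proof.
have key b k (u : 'I_n) : k \in shi_keys b -> (b <= u)%N -> shi_vec b k 0 (rshift 1 u) = (u == b)%:R := @shi_vec_top b k u.
rewrite !in_cons => /orP[/eqP ->|/allpairsPdep[b [k [_ kb ->]]]].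
  case/orP => [/eqP -> //|/allpairsPdep[b' [k' [_ kb' ->]]]] /sub_rVP[c].
  move/(congr1 (fun M : 'rV_(1 + n) => M 0 (rshift 1 b'))).
  by rewrite key // eqxx mxE sformE mulr0 => /eqP; rewrite oner_eq0.
case/orP => [/eqP ->|/allpairsPdep[b' [k' [_ kb' ->]]]] /sub_rVP[c].
  move=> E; have := congr1 (fun M : 'rV_(1 + n) => M 0 (rshift 1 b)) E.
  rewrite sformE mxE key // eqxx mulr1 => c0.
  have := congr1 (fun M : 'rV_(1 + n) => M 0 (lshift n 0)) E.
  by rewrite -c0 scale0r mxE !mxE !eqxx => /eqP; rewrite oner_eq0.
move=> E; have co u : shi_vec b' k' 0 (rshift 1 u) = c * shi_vec b k 0 (rshift 1 u).
  by rewrite E mxE.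
case: (ltngtP b b') => [lt|lt|/val_inj bb].
- have := co b'; rewrite !key // ?eqxx; last exact: ltnW.
  by rewrite -val_eqE /= (gtn_eqF lt) mulr0 => /eqP; rewrite oner_eq0.
- have := co b; rewrite !key // ?eqxx; last exact: ltnW.
  rewrite -val_eqE /= (gtn_eqF lt) mulr1 => c0.
  by have := co b'; rewrite -c0 mul0r key // eqxx => /eqP; rewrite oner_eq0.
- subst b'; have := co b; rewrite !key // eqxx mulr1 => c1.
  by rewrite E -c1 scale1r.
Qed.

Lemma shi_list_uniq : uniq shi_list.
Proof.
rewrite cons_uniq; apply/andP; split; last first.
  apply: allpairs_uniq_dep => [|b _|].
  - exact: enum_uniq.
  - exact: shi_keys_uniq.
  - move=> [b k] [b' k'] /allpairsPdep[x [y [_ yx [bE kE]]]] /allpairsPdep[x' [y' [_ yx' [bE' kE']]]].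
    subst x y x' y' => /= E.
    have bb : b = b'.
      case: (ltngtP b b') => [lt|lt|/val_inj //].
        move/(congr1 (fun M : 'rV_(1 + n) => M 0 (rshift 1 b'))): E.
        rewrite !shi_vec_top // ?eqxx ?(ltnW lt) // -val_eqE /= (gtn_eqF lt) => /esym/eqP.
        by rewrite oner_eq0.
      move/(congr1 (fun M : 'rV_(1 + n) => M 0 (rshift 1 b))): E.
      rewrite !shi_vec_top // ?eqxx ?(ltnW lt) // -val_eqE /= (gtn_eqF lt) => /eqP.
      by rewrite oner_eq0.
    by move: E; rewrite bb => /addrI/oppr_inj/shi_key_inj ->.
apply/allpairsPdep => -[b [k [_ kb /(congr1 (fun M : 'rV_(1 + n) => M 0 (rshift 1 b)))]]].
by rewrite sformE shi_vec_top // eqxx => /eqP; rewrite eq_sym oner_eq0.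
Qed.

Lemma shi_list_form a : a \in shi_list -> exists2 c, c != 0 & shi_form (c *: a).
Proof.
rewrite in_cons => /orP[/eqP ->|/allpairsPdep[b [k [_ kb ->]]]].
  by exists 1; rewrite ?oner_eq0 // scale1r; apply: Or31.
have yb : yfree b = yform (rshift K b) by rewrite yform_r.
move: kb; rewrite !mem_cat => /or3P[] /mapP[x]; rewrite ?mem_iota ?mem_filter /= => Hx ->.
- have [|||i iK Hi] := @window_cover blk N sorted_blk K (K + b) x => //.
  + by rewrite leq_addr ltn_add2l ltn_ord.
  exists 1; rewrite ?oner_eq0 // scale1r.
  have yi : yform (lshift n (Ordinal iK)) = (pos blk i)%:R *: sform by rewrite yform_l.
  case: Hi => [iE|[ib iE]].
    apply: Or32; exists (lshift n (Ordinal iK)), (rshift K b).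
    by rewrite /shi_vec /shi_key /= yb yi iE addr0.
  apply: Or33; exists (lshift n (Ordinal iK)), (rshift K b); split=> //.
  by rewrite /shi_vec /shi_key /= -pmulrn yb yi iE addr0 -addrA -opprD -natr1 scalerDl scale1r.
- exists 1; rewrite ?oner_eq0 // scale1r; apply: Or32; exists (rshift K x), (rshift K b).
  by rewrite -yb yform_r /shi_vec /shi_key /= scale0r add0r.
have [xb|xb] := ltnP (blkf x) (blkf b).
  exists 1; rewrite ?oner_eq0 // scale1r; apply: Or33; exists (rshift K x), (rshift K b); split=> //.
  by rewrite -yb yform_r /shi_vec /shi_key /= scale1r opprD addrCA addrC.
have bx : (blkf b < blkf x)%N.
  by case/andP: Hx => /andP[_ ne] _; rewrite ltn_neqAle eq_sym ne.
exists (- 1); rewrite ?oppr_eq0 ?oner_eq0 // scaleN1r; apply: Or33.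
exists (rshift K b), (rshift K x); split=> //.
by rewrite -yb yform_r /shi_vec /shi_key /= scaleN1r !opprD !opprK addrC -addrA addrC -addrA.
Qed.

(** The ranks cancel by [size_shi_keys], and [\sum_(b < n) (2 b + 1) = n^2] accounts for [n] times
    [N = K + n]. *)
Lemma size_shi_list : sumn shi_exponents = size shi_list.
Proof.
have -> : size shi_list = (size [seq shi_vec b k | b <- enum 'I_n, k <- shi_keys b]).+1 by [].
have -> : sumn shi_exponents = (sumn [seq (N - rk blk (K + i))%N | i <- iota 0 n]).+1 by [].
rewrite size_allpairs_dep !sumnE !big_map -enumT big_enum /=; congr _.+1.
rewrite -{1}[n in iota 0 n]subn0 -/(index_iota 0 n) big_mkord.
apply: (@addIn (\sum_(b < n) rk blk (K + b))); rewrite -!big_split /=.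
rewrite (eq_bigr (fun=> N)) => [|b _]; last first.
  have rb : (rk blk (K + b) <= K + b)%N by apply: cnt_leq.
  by rewrite subnK // (leq_trans rb) // leq_add2l ltnW.
under [RHS]eq_bigr => b _ do rewrite size_shi_keys.
rewrite [RHS]big_split /= !sum_nat_const card_ord.
suff -> : (\sum_(b < n) b.*2.+1 = n * n)%N by rewrite -mulnDr.
by elim: (n) => [|k IH]; rewrite ?big_ord0 // big_ord_recr /= IH; lia.
Qed.

Lemma block_shi_free (A : arrangement (1 + n)) :
  (forall a, a \in A -> exists c a', shi_form a' /\ a = c *: a') ->
  (forall a', shi_form a' -> a' != 0 -> exists2 c, c != 0 & c *: a' \in A) ->
  saito_free A shi_exponents.
Proof.
move=> HA HA'; split; first by rewrite /= size_map size_iota.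
have sL : sform \in shi_list by rewrite mem_head.
have L0 : 0 \notin shi_list.
  apply/negP => /(shi_list_prop sL) /(_ (sub0mx _ _)) /(congr1 (fun M : 'rV_(1 + n) => M 0 (lshift n 0))).
  by rewrite !mxE !eqxx => /eqP; rewrite eq_sym oner_eq0.
exists shi_mx, shi_list; split.
- move=> i a /HA[c [a' [fa ->]]]; have [g Hg] := shi_mx_tangent i fa.
  by exists g; rewrite !linearZ /= Hg scalerAl.
- exact: shi_mx_homog.
- exact: shi_mx_det.
- by rewrite size_shi_list.
split=> //.
- have : pairwise [rel x y | x != y] shi_list by rewrite -uniq_pairwise shi_list_uniq.
  apply: (@sub_in_pairwise _ (mem shi_list)) => [x y xL yL /= ne|]; last exact/allP.
  by apply: contra ne => /(shi_list_prop xL yL) ->.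
- move=> a aL; have [c nz fa] := shi_list_form aL.
  have [|c' nz' ca] := HA' _ fa.
    by rewrite scaler_eq0 negb_or nz /=; apply: contraNneq L0 => <-.
  by exists (c' * c); rewrite ?mulf_neq0 // -scalerA.
Qed.
End BlockShi.

(** * Accuracy of block-Shi arrangements *)

Section Presentation.
Variables (n N : nat) (blk : 'I_N -> nat).

Definition univ_s : 'rV[rat]_(1 + N) := delta_mx 0 (lshift N 0).
Definition univ_y (i : 'I_N) : 'rV[rat]_(1 + N) := delta_mx 0 (rshift 1 i).

Definition univ_form (f : 'rV[rat]_(1 + N)) : Prop :=
  [\/ f = univ_s, exists i j, i != j /\ f = univ_y j - univ_y i |
      exists i j, (blk i < blk j)%N /\ f = univ_y j - univ_y i - univ_s].

(* X expresses the coordinates of Q^n through s and the translation-invariant points Y_i;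
   T is a section of the map X. *)
Definition shi_presented (A : arrangement n) (C : {set 'I_n}) : Prop :=
  #|C| = N /\ exists (X T : 'M[rat]_(n, 1 + N)),
  [/\ forall a, a \in A -> exists c f, univ_form f /\ a *m X = c *: f,
      forall f, univ_form f -> exists a c, [/\ a \in A, c != 0 & a *m X = c *: f],
      forall v, supported C v -> v *m T *m X^T = v,
      (row_mx 0 (const_mx 1) : 'rV_(1 + N)) *m X^T = 0 &
      forall u, u \notin C -> row u X = 0].
End Presentation.

Lemma dot_univ_s N (z : 'rV[rat]_(1 + N)) : univ_s N *m z^T = (z 0 (lshift _ 0))%:M.
Proof. by rewrite -rowE; apply/matrixP => i j; rewrite !ord1 !mxE eqxx. Qed.

Lemma dot_univ_y N (z : 'rV[rat]_(1 + N)) i : univ_y i *m z^T = (z 0 (rshift _ i))%:M.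
Proof. by rewrite -rowE; apply/matrixP => x j; rewrite !ord1 !mxE eqxx. Qed.

Lemma scalar_mx1_eq0 (x : rat) : (x%:M : 'M_1) = 0 -> x = 0.
Proof. by move/matrixP/(_ 0 0); rewrite !mxE eqxx mulr1n. Qed.

Section Step.
Variables (n K k : nat) (blk : nat -> nat).
Hypothesis K_gt0 : (0 < K)%N.
Hypothesis sorted_blk : forall i j, (i < j < K + k)%N ->
  (rk blk i < rk blk j)%N \/ rk blk i = rk blk j /\ (blk i < blk j)%N.
Let blko (i : 'I_(K + k)) := blk i.

Definition shi_restr : 'M[rat]_(1 + (K + k), 1 + k) :=
  col_mx (@sform k) (\matrix_i yform blk i).

Lemma univ_s_restr : univ_s _ *m shi_restr = @sform k.
Proof. by rewrite -rowE rowKu row_id. Qed.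

Lemma univ_y_restr i : univ_y i *m shi_restr = yform blk i.
Proof. by rewrite -rowE rowKd rowK. Qed.

Lemma univ_form_restr f : univ_form blko f -> shi_form blk K (f *m shi_restr).
Proof.
case=> [->|[i [j [_ ->]]]|[i [j [ij ->]]]].
- by rewrite univ_s_restr; apply: Or31.
- by rewrite mulmxBl !univ_y_restr; apply: Or32; exists i, j.
- by rewrite !mulmxBl !univ_y_restr univ_s_restr; apply: Or33; exists i, j.
Qed.

Lemma shi_form_lift a : shi_form blk K a -> a != 0 -> exists2 f, univ_form blko f & f *m shi_restr = a.
Proof.
case=> [->|[i [j ->]]|[i [j [ij ->]]]] nz.
- by exists (univ_s _); [apply: Or31 | rewrite univ_s_restr].
- exists (univ_y j - univ_y i); last by rewrite mulmxBl !univ_y_restr.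
  by apply: Or32; exists i, j; split=> //; apply: contraNneq nz => ->; rewrite subrr.
- exists (univ_y j - univ_y i - univ_s _); last by rewrite !mulmxBl !univ_y_restr univ_s_restr.
  by apply: Or33; exists i, j.
Qed.

(** The flat is parametrised by [s] and the [k] free points, hence has dimension [1 + k]; its
    restriction is the block-Shi arrangement with the first [K] points fixed. *)
Lemma accurate_step (A : arrangement n) (C : {set 'I_n}) : shi_presented blko A C ->
  exists P : 'M[rat]_(1 + k, n),
   [/\ forall r, supported C (row r P), row_free P,
       forall v, supported C v -> (forall a, a \in A -> a *m P^T = 0 -> a *m v^T = 0) -> (v <= P)%MS
     & saito_free (restr_arr A P) (shi_exponents blk K k)].
Proof.
case=> _ [X [T [HA HA' HT HX X0]]].
exists (X *m shi_restr)^T; rewrite /restr_arr trmxK.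
have i0K : (0 < K + k)%N by rewrite ltn_addr.
pose i0 : 'I_(K + k) := lshift k (Ordinal K_gt0).
have y0 : yform blk i0 = 0 by rewrite yform_l /pos /= sub0n scale0r.
have key f v : univ_form blko f -> (forall a, a \in A -> a *m (X *m shi_restr) = 0 -> a *m v^T = 0) ->
    supported C v -> f *m shi_restr = 0 -> f *m (v *m T)^T = 0.
  move=> ff Hv sv f0; have [a [c [aA nzc aX]]] := HA' _ ff.
  have := Hv _ aA; rewrite mulmxA aX -scalemxAl f0 scaler0 => /(_ erefl).
  rewrite -{1}(HT _ sv) trmx_mul trmxK mulmxA aX -scalemxAl => /eqP.
  by rewrite scaler_eq0 (negbTE nzc) => /eqP.
split.
- move=> r u uC; rewrite !mxE; have := X0 u uC => /rowP Xu.
  by rewrite big1 // => j _; have := Xu j; rewrite !mxE => ->; rewrite mul0r.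
- apply: row_freeE => w w0.
  have Hw f : univ_form blko f -> f *m shi_restr *m w^T = 0.
    move=> ff; have [a [c [aA nzc aX]]] := HA' _ ff.
    have := congr1 (fun M => M *m a^T) w0; rewrite mul0mx -mulmxA -trmx_mul mulmxA aX.
    rewrite -scalemxAl => /(congr1 trmx); rewrite trmx0 trmx_mul trmxK -scalemxAl => /eqP.
    by rewrite scaler_eq0 (negbTE nzc) => /eqP.
  have dotd (u : 'I_(1 + k)) : (delta_mx 0 u : 'rV_(1 + k)) *m w^T = 0 -> w 0 u = 0.
    by rewrite -rowE => /rowP/(_ 0); rewrite !mxE.
  apply/rowP => u; rewrite [RHS]mxE -[u]splitK; case: (split u) => {}u /=.
    rewrite ord1; apply: dotd; rewrite -/(@sform k) -univ_s_restr; apply: Hw.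
    exact: Or31.
  apply: dotd; rewrite -/(yfree u) -(yform_r blk K) -[yform _ _]subr0 -y0 -!univ_y_restr -mulmxBl.
  apply: Hw; apply: Or32; exists i0, (rshift K u); split=> //.
  by rewrite eq_lrshift.
- move=> v sv Hv; pose z := v *m T.
  have kz f := key f v ^~ Hv; pose zs := z 0 (lshift _ 0); pose zy i := z 0 (rshift 1 i).
  have dotB i j : (univ_y j - univ_y i) *m z^T = (zy j - zy i)%:M.
    by rewrite mulmxBl !dot_univ_y -raddfB.
  (* The forms of the steps inside the window vanish on the flat, hence at [z], which determines the
     window points of [z] from the first one and [zs]. *)
  have class (a : 'I_K) : zy (lshift k a) = zy i0 + (pos blk a)%:R * zs.
    case: a => a aK; elim: a aK => [|a IH] aK.
      by rewrite /pos sub0n mul0r addr0; congr zy; apply: val_inj.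
    have aN : (a.+1 < K + k)%N by apply: leq_trans aK _; exact: leq_addr.
    have {}IH := IH (ltnW aK).
    pose x : 'I_(K + k) := lshift k (Ordinal (ltnW aK)).
    pose x' : 'I_(K + k) := lshift k (Ordinal aK).
    have [[pE bE]|pE] := pos_step sorted_blk aN.
      have : (univ_y x' - univ_y x - univ_s _) *m z^T = 0.
        apply: kz => //; first by apply: Or33; exists x, x'.
        by rewrite !mulmxBl !univ_y_restr univ_s_restr !yform_l /= pE -natr1 scalerDl scale1r addrAC addrK subrr.
      rewrite mulmxBl dotB dot_univ_s -raddfB /= => /scalar_mx1_eq0/eqP; rewrite subr_eq0 subr_eq => /eqP ->.
      by rewrite IH /= pE -natr1 -/zs; ring.
    have : (univ_y x' - univ_y x) *m z^T = 0.
      apply: kz => //; last by rewrite mulmxBl !univ_y_restr !yform_l /= pE subrr.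
      by apply: Or32; exists x, x'; split=> //; rewrite -val_eqE /= neq_ltn ltnSn.
    by rewrite dotB => /scalar_mx1_eq0/eqP; rewrite subr_eq0 => /eqP ->; rewrite IH /= pE.
  (* Points are read relative to [i0], which the flat places at 0; a common translation is invisible
     to [X]. *)
  pose w : 'rV_(1 + k) := row_mx zs%:M (\row_b (zy (rshift K b) - zy i0)).
  pose ones : 'rV[rat]_(1 + (K + k)) := row_mx 0 (const_mx 1).
  have z1 : (z - zy i0 *: ones) 0 (lshift _ 0) = zs.
    have o1 : ones 0 (lshift (K + k) 0) = 0 by rewrite row_mxEl mxE.
    by rewrite mxE [X in _ + X]mxE [X in _ - X]mxE o1 mulr0 subr0.
  have z2 i : (z - zy i0 *: ones) 0 (rshift 1 i) = zy i - zy i0.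
    have o1 : ones 0 (rshift 1 i) = 1 by rewrite row_mxEr mxE.
    by rewrite mxE [X in _ + X]mxE [X in _ - X]mxE o1 mulr1.
  have wR : w *m shi_restr^T = z - zy i0 *: ones.
    apply/rowP => u; rewrite mxE.
    have -> : \sum_j w 0 j * shi_restr^T j u = (row u shi_restr *m w^T) 0 0.
      by rewrite mxE; apply: eq_bigr => j _; rewrite !mxE mulrC.
    have dotw (t : 'I_(1 + k)) : ((delta_mx 0 t : 'rV_(1 + k)) *m w^T) 0 0 = w 0 t by rewrite -rowE !mxE.
    rewrite -[u]splitK; case: (split u) => {}u /=.
      by rewrite ord1 rowKu row_id z1 dotw row_mxEl mxE eqxx mulr1n.
    rewrite rowKd rowK z2 -[u]splitK; case: (split u) => {}u /=.
      rewrite yform_l -scalemxAl mxE dotw row_mxEl mxE eqxx mulr1n class; ring.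
    by rewrite yform_r dotw row_mxEr mxE.
  have -> : v = w *m (X *m shi_restr)^T; last exact: submxMl.
  rewrite trmx_mul mulmxA wR mulmxBl -scalemxAl HX scaler0 subr0.
  by rewrite /z HT.
- apply: block_shi_free => // [a /mapP[b]|a' fa nz].
    rewrite mem_filter => /andP[_ bA] ->; have [c [f [ff fX]]] := HA _ bA.
    exists c, (f *m shi_restr); split; first exact: univ_form_restr.
    by rewrite mulmxA fX scalemxAl.
  have [f ff fR] := shi_form_lift fa nz; have [a [c [aA nzc aX]]] := HA' _ ff.
  exists c => //; rewrite -fR scalemxAl -aX -mulmxA; apply: map_f.
  by rewrite mem_filter aA mulmxA aX -scalemxAl fR scaler_eq0 negb_or nzc nz.
Qed.
End Step.

(** Windows only yield dimensions at least 1. Dimension 0 says that the forms have no common zero on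
    [C] except the origin: [s] vanishes and all the points coincide. *)
Lemma accurate_set0_dim n N (blk : 'I_N.+1 -> nat) (A : arrangement n) C :
  shi_presented blk A C ->
  exists P : 'M[rat]_(0, n),
   [/\ forall r, supported C (row r P), row_free P,
       forall v, supported C v -> (forall a, a \in A -> a *m P^T = 0 -> a *m v^T = 0) -> (v <= P)%MS
     & saito_free (restr_arr A P) [::]].
Proof.
case=> _ [X [T [HA HA' HT HX X0]]]; exists 0; split.
- by case.
- by apply: row_freeE => w _; apply/rowP; case.
- move=> v sv Hv; pose z := v *m T; pose ones : 'rV[rat]_(1 + N.+1) := row_mx 0 (const_mx 1).
  have Hf f : univ_form blk f -> f *m z^T = 0.
    move=> ff; have [a [c [aA nzc aX]]] := HA' _ ff.
    have : a *m v^T = 0 by apply: Hv => //; apply/rowP; case.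
    rewrite -(HT _ sv) trmx_mul trmxK mulmxA aX -scalemxAl => /eqP.
    by rewrite scaler_eq0 (negbTE nzc) => /eqP.
  have z_s : z 0 (lshift _ 0) = 0.
    by have := Hf _ (Or31 _ _ erefl); rewrite dot_univ_s => /scalar_mx1_eq0.
  have z_y i : z 0 (rshift 1 i) = z 0 (rshift 1 ord0).
    have [-> //|ne] := eqVneq i ord0; apply/eqP; rewrite -subr_eq0; apply/eqP.
    have : univ_form blk (univ_y i - univ_y ord0) by apply: Or32; exists ord0, i; rewrite eq_sym.
    by move/Hf; rewrite mulmxBl !dot_univ_y -raddfB => /scalar_mx1_eq0.
  have -> : v = 0; last by rewrite sub0mx.
  rewrite -(HT _ sv) -/z; have -> : z = z 0 (rshift 1 ord0) *: ones.
    apply/rowP => u; rewrite [RHS]mxE -[u]splitK; case: (split u) => {}u /=.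
      have -> : ones 0 (lshift N.+1 u) = 0 by rewrite row_mxEl mxE.
      by rewrite mulr0 ord1 z_s.
    have -> : ones 0 (rshift 1 u) = 1 by rewrite row_mxEr mxE.
    by rewrite mulr1 z_y.
  by rewrite -scalemxAl HX scaler0.
- exact: saito_free_nil.
Qed.

(** Ranks do not decrease along the order, so reading the points backwards lists the exponents
    increasingly. Dimension [k + 1] leaves the last [k] points free, and theirs are the first [k] of
    these exponents. *)
Lemma accurate_on_sorted n N (blk : nat -> nat) (A : arrangement n) C :
  (forall i j, (i < j < N.+1)%N ->
    (rk blk i < rk blk j)%N \/ rk blk i = rk blk j /\ (blk i < blk j)%N) ->
  shi_presented (fun i : 'I_N.+1 => blk i) A C ->
  accurate_on A C (1%N :: [seq (N.+1 - rk blk (N - j))%N | j <- iota 0 N]).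
Proof.
move=> sb pres; have cC : #|C| = N.+1 by case: pres.
have rk_le i : (rk blk i <= i)%N by exact: cnt_leq.
split.
- rewrite (sorted_pairwise leq_trans) /=; apply/andP; split.
    by apply/allP => x /mapP[j _ ->]; have := rk_le (N - j)%N; lia.
  rewrite pairwise_map.
  have : pairwise ltn (iota 0 N) by rewrite -(sorted_pairwise ltn_trans) iota_ltn_sorted.
  apply: sub_pairwise => x y /= xy; apply: leq_sub2l; apply: (rk_mono sb).
  by rewrite leq_sub2l ?(ltnW xy) // ltnS leq_subr.
- by rewrite /= size_map size_iota cC.
rewrite cC => -[_|k]; first by rewrite take0; exact: accurate_set0_dim pres.
rewrite ltnS => kN; pose K := (N - k).+1.
have NE : N.+1 = (K + k)%N by rewrite /K addSn subnK.
have sbK : forall i j, (i < j < K + k)%N ->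
    (rk blk i < rk blk j)%N \/ rk blk i = rk blk j /\ (blk i < blk j)%N by rewrite -NE.
have presK : shi_presented (fun i : 'I_(K + k) => blk i) A C.
  by move: pres; rewrite -NE.
have [P [sP fP lP SP]] := accurate_step (ltn0Sn _) sbK presK.
exists P; split=> //; apply: saito_free_perm SP.
rewrite /= /shi_exponents perm_cons -NE perm_sym -(perm_rev _) perm_sym.
have -> : take k [seq (N.+1 - rk blk (N - j))%N | j <- iota 0 N] =
    rev [seq (N.+1 - rk blk (K + i))%N | i <- iota 0 k]; last exact: perm_refl.
have sz : size (take k [seq (N.+1 - rk blk (N - j))%N | j <- iota 0 N]) = k.
  by rewrite size_takel // size_map size_iota.
apply: (@eq_from_nth _ 0%N); first by rewrite sz size_rev size_map size_iota.
rewrite sz => i ik; have iN : (i < N)%N by apply: leq_trans kN.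
rewrite nth_take // (nth_map 0%N) ?size_iota // nth_iota // nth_rev ?size_map ?size_iota //.
rewrite (nth_map 0%N) ?size_iota ?nth_iota //; try lia.
by congr (_ - rk _ _)%N; rewrite /K; lia.
Qed.

(** * Sorting and renumbering the points *)

Section SortPoints.
Variables (N : nat) (b : 'I_N -> nat).

Definition prior (i : 'I_N) := count (fun a : 'I_N => (a < i)%N && (b a == b i)) (enum 'I_N).
Definition point_le (i j : 'I_N) := (prior i < prior j)%N || ((prior i == prior j) && (b i <= b j)%N).

Lemma prior_lt i j : b i = b j -> (i < j)%N -> (prior i < prior j)%N.
Proof.
move=> bij ij; rewrite /prior -bij.
have ui := enum_uniq 'I_N; have mi : i \in enum 'I_N by rewrite mem_enum.
rewrite -!size_filter; set s1 := filter _ _; set s2 := filter _ _.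
have u1 : uniq (i :: s1) by rewrite /= mem_filter ltnn /= filter_uniq.
suff : (size (i :: s1) <= size s2)%N by [].
apply: uniq_leq_size => // x; rewrite in_cons => /orP[/eqP ->|].
  by rewrite mem_filter ij eqxx mi.
by rewrite !mem_filter => /andP[/andP[xi ->] ->]; rewrite (ltn_trans xi).
Qed.

Lemma point_le_total : total point_le.
Proof. by move=> i j; rewrite /point_le; case: (ltngtP (prior i) (prior j)) => //= _; exact: leq_total. Qed.

Lemma point_le_trans : transitive point_le.
Proof.
move=> y x z; rewrite /point_le => /orP[xy|/andP[/eqP -> bxy]] /orP[yz|/andP[/eqP <- byz]].
- by rewrite (ltn_trans xy yz).
- by rewrite xy.
- by rewrite yz.
- by rewrite eqxx (leq_trans bxy byz) orbT.
Qed.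

(** Inside a block [prior] is strictly increasing, so sorting by [prior] and then by weight keeps
    the order inside each block. The rank of a point in the sorted list is therefore its [prior] in
    the original one. *)
Lemma sort_points : exists2 p : 'S_N, True & exists blk : nat -> nat,
  (forall i : 'I_N, blk i = b (p i)) /\
  forall i j, (i < j < N)%N -> (rk blk i < rk blk j)%N \/ rk blk i = rk blk j /\ (blk i < blk j)%N.
Proof.
pose s := sort point_le (enum 'I_N).
have ss : size s = N by rewrite size_sort size_enum_ord.
have us : uniq s by rewrite sort_uniq enum_uniq.
case: (posnP N) => [N0|N_gt0].
  exists 1%g => //; exists (fun=> 0%N); split; first by case=> m mN; exfalso; move: mN; rewrite N0.
  by move=> i j /andP[_]; rewrite N0.
pose x0 : 'I_N := Ordinal N_gt0.
pose f (i : 'I_N) := nth x0 s i.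
have f_inj : injective f.
  by move=> i j /eqP; rewrite nth_uniq ?ss // => /eqP/val_inj.
exists (perm f_inj) => //; pose blk i := b (nth x0 s i).
exists blk; split; first by move=> i; rewrite permE.
have sp : pairwise point_le s.
  by rewrite -(sorted_pairwise point_le_trans); apply: sort_sorted; exact: point_le_total.
have le_nth i j : (i < j < N)%N -> point_le (nth x0 s i) (nth x0 s j).
  case/andP=> ij jN; apply: (pairwiseP x0 sp); rewrite ?inE ?ss //; exact: ltn_trans jN.
have rkE i : (i < N)%N -> rk blk i = prior (nth x0 s i).
  move=> iN; rewrite /rk /cnt /prior.
  have -> : count (fun a => blk a == blk i) (iota 0 i) =
      count (fun x => b x == b (nth x0 s i)) (take i s).
    rewrite -[take i s](mkseq_nth x0) /mkseq size_takel ?ss ?(ltnW iN) // count_map.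
    by apply: eq_in_count => a; rewrite mem_iota /= => ai; rewrite nth_take.
  have ps : perm_eq s (enum 'I_N) by rewrite perm_sort.
  rewrite -(seq.permP ps) -[X in _ = count _ X](cat_take_drop i) [RHS]count_cat.
  rewrite [X in (_ + X)%N](_ : _ = 0)%N ?addn0.
    apply: eq_in_count => x /(nthP x0)[j]; rewrite size_takel ?ss ?(ltnW iN) // => ji.
    rewrite nth_take // => <-; have [bE|] := eqVneq (b (nth x0 s j)) (b (nth x0 s i)); last by rewrite andbF.
    rewrite andbT; apply/esym; rewrite ltnNge leq_eqVlt negb_or; apply/andP; split.
      by rewrite val_eqE nth_uniq ?ss ?(ltn_trans ji) // neq_ltn ji orbT.
    apply/negP => /(prior_lt (esym bE)) lt.
    have := le_nth j i; rewrite ji iN => /(_ isT); rewrite /point_le ltnNge (ltnW lt) /=.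
    by rewrite eqn_leq leqNgt lt.
  apply/eqP; rewrite -leqn0 leqNgt -has_count; apply/negP => /hasP[x /(nthP x0)[j]].
  rewrite size_drop ss ltn_subRL => jN; rewrite nth_drop => <- /andP[lt /eqP bE].
  have [j0|j_gt0] := posnP j; first by rewrite j0 addn0 ltnn in lt.
  have := le_nth i (i + j)%N; rewrite jN -{1}[i]addn0 ltn_add2l j_gt0 => /(_ isT).
  by rewrite /point_le ltnNge (ltnW (prior_lt bE lt)) /= eqn_leq leqNgt (prior_lt bE lt).
move=> i j /andP[ij jN]; have iN := ltn_trans ij jN; rewrite !rkE //.
have := le_nth i j; rewrite ij jN => /(_ isT) /orP[->|/andP[/eqP pE]]; first by left.
rewrite leq_eqVlt => /orP[/eqP bE|lt]; right; split=> //.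
exfalso; case: (ltngtP (nth x0 s i) (nth x0 s j)) => [lt|lt|/val_inj/eqP].
- by have := prior_lt bE lt; rewrite pE ltnn.
- by have := prior_lt (esym bE) lt; rewrite pE ltnn.
- by rewrite nth_uniq ?ss // (ltn_eqF ij).
Qed.
End SortPoints.

Definition univ_perm N (p : 'S_N) : 'M[rat]_(1 + N) := col_mx (univ_s N) (\matrix_i univ_y (p i)).

Lemma univ_s_perm N (p : 'S_N) : univ_s N *m univ_perm p = univ_s N.
Proof. by rewrite -rowE rowKu row_id. Qed.

Lemma univ_y_perm N (p : 'S_N) i : univ_y i *m univ_perm p = univ_y (p i).
Proof. by rewrite -rowE rowKd rowK. Qed.

Lemma univ_permK N (p : 'S_N) : univ_perm p *m univ_perm p^-1 = 1%:M.
Proof.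
apply/row_matrixP => u; rewrite row_mul row1 -[u]splitK; case: (split u) => {}u /=.
  by rewrite ord1 rowKu row_id univ_s_perm.
by rewrite rowKd rowK univ_y_perm permK.
Qed.

Lemma univ_form_perm N (b : 'I_N -> nat) (p : 'S_N) f :
  univ_form b f -> univ_form (fun i => b (p i)) (f *m univ_perm p^-1).
Proof.
case=> [->|[i [j [ij ->]]]|[i [j [ij ->]]]].
- by rewrite univ_s_perm; apply: Or31.
- rewrite mulmxBl !univ_y_perm; apply: Or32; exists (p^-1 i)%g, (p^-1 j)%g.
  by rewrite (inj_eq perm_inj).
- rewrite !mulmxBl !univ_y_perm univ_s_perm; apply: Or33; exists (p^-1 i)%g, (p^-1 j)%g.
  by rewrite !permKV.
Qed.

Lemma shi_presented_perm n N (b : 'I_N -> nat) (p : 'S_N) (A : arrangement n) C :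
  shi_presented b A C -> shi_presented (fun i => b (p i)) A C.
Proof.
case=> cC [X [T [HA HA' HT HX X0]]]; split=> //.
exists (X *m univ_perm p^-1), (T *m (univ_perm p)^T); split.
- move=> a aA; have [c [f [ff fX]]] := HA _ aA.
  by exists c, (f *m univ_perm p^-1); rewrite mulmxA fX scalemxAl; split=> //; exact: univ_form_perm.
- move=> f ff; have ff' : univ_form b (f *m univ_perm p).
    case: ff => [->|[i [j [ij ->]]]|[i [j [ij ->]]]].
    + by rewrite univ_s_perm; apply: Or31.
    + by rewrite mulmxBl !univ_y_perm; apply: Or32; exists (p i), (p j); rewrite (inj_eq perm_inj).
    + by rewrite !mulmxBl !univ_y_perm univ_s_perm; apply: Or33; exists (p i), (p j).
  have [a [c [aA nzc aX]]] := HA' _ ff'; exists a, c; split=> //.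
  by rewrite mulmxA aX -scalemxAl -mulmxA univ_permK mulmx1.
- move=> v sv.
  have -> : v *m (T *m (univ_perm p)^T) *m (X *m univ_perm p^-1)^T =
      v *m T *m (univ_perm p^-1 *m univ_perm p)^T *m X^T by rewrite !trmx_mul !mulmxA.
  by rewrite -{2}[p]invgK univ_permK trmx1 mulmx1 HT.
- rewrite trmx_mul mulmxA; set o : 'rV_(1 + N) := row_mx _ _.
  suff -> : o *m (univ_perm p^-1)^T = o by [].
  apply: trmx_inj; rewrite trmx_mul trmxK; apply/row_matrixP => u; rewrite row_mul.
  rewrite -[u]splitK; case: (split u) => {}u /=.
    rewrite ord1 rowKu row_id dot_univ_s row_mxEl mxE; apply/rowP => x.
    by rewrite [RHS]mxE [RHS]mxE row_mxEl !mxE mul0rn.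
  rewrite rowKd rowK dot_univ_y row_mxEr mxE; apply/rowP => x.
  by rewrite [RHS]mxE [RHS]mxE row_mxEr !mxE !ord1.
- by move=> u uC; rewrite row_mul X0 // mul0mx.
Qed.

Lemma univ_form_ext N (b b' : 'I_N -> nat) f : b =1 b' -> univ_form b f -> univ_form b' f.
Proof.
move=> bb [->|H|[i [j [ij ->]]]]; [exact: Or31 | exact: Or32 | apply: Or33].
by exists i, j; rewrite -!bb.
Qed.

Lemma shi_presented_ext n N (b b' : 'I_N -> nat) (A : arrangement n) C :
  b =1 b' -> shi_presented b A C -> shi_presented b' A C.
Proof.
move=> bb [cC [X [T [HA HA' HT HX X0]]]]; split=> //; exists X, T; split=> //.
  by move=> a /HA[c [f [ff fX]]]; exists c, f; split=> //; exact: univ_form_ext ff.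
by move=> f ff; apply: HA'; apply: univ_form_ext ff => i; rewrite bb.
Qed.

Theorem shi_presented_accurate n N (b : 'I_N.+1 -> nat) (A : arrangement n) C :
  shi_presented b A C -> exists e, accurate_on A C e.
Proof.
move=> pres; have [p _ [blk [bE sb]]] := sort_points b.
exists (1%N :: [seq (N.+1 - rk blk (N - j))%N | j <- iota 0 N]).
apply: (accurate_on_sorted sb); apply: shi_presented_ext (shi_presented_perm p pres).
by move=> i; rewrite bE.
Qed.

(** * Free arrangements: the determinant of a basis *)

(** Comparing traces gives [m Q = l Q]; this is how a basis of [D(A)], of unspecified size, is found
    to have [l] elements. *)
Lemma trace_square (R : idomainType) m l (Q : R) (M : 'M_(m, l)) (N : 'M_(l, m)) :
  Q != 0 -> injective (fun k : nat => k%:R : R) -> M *m N = Q%:M -> N *m M = Q%:M -> m = l.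
Proof.
move=> Qnz inj MN NM; have := mxtrace_mulC M N; rewrite MN NM !mxtrace_scalar => /eqP.
by rewrite -!(mulr_natl Q) -subr_eq0 -mulrBl mulf_eq0 (negbTE Qnz) orbF subr_eq0 => /eqP/inj.
Qed.

(** The product [Q] of the forms times any coordinate derivation is tangent, so the scalar matrix
    [Q] factors through a basis; uniqueness of the coefficients gives the product in the other order
    too. *)
Lemma free_square_basis l (A : arrangement l) : 0 \notin A -> free_arr A ->
  exists B N : 'M[S l]_l, [/\ forall i, in_D A (B i),
    forall T : 'M[S l]_l, (forall i, in_D A (T i)) -> exists C, T = C *m B &
    N *m B = (\prod_(a <- A) lin_poly a)%:M].
Proof.
move=> A0 [m [B [BD Bgen Bfree]]].
pose Q : S l := \prod_(a <- A) lin_poly a.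
have Qnz : Q != 0 := lin_prod_neq0 A0.
pose M : 'M[S l]_(m, l) := \matrix_(i, j) B i j.
have gen (T : 'M[S l]_l) : (forall i, in_D A (T i)) -> exists C, T = C *m M.
  move=> TD; have /fin_all_exists[c Hc] : forall i, exists c : 'I_m -> S l, forall j, T i j = \sum_k c k * B k j.
    by move=> i; apply: Bgen.
  exists (\matrix_(i, k) c i k); apply/matrixP => i j; rewrite mxE Hc.
  by apply: eq_bigr => k _; rewrite !mxE.
have QD i : in_D A ((Q%:M : 'M[S l]_l) i).
  move=> a aA; have -> : der_app ((Q%:M : 'M[S l]_l) i) a = a 0 i *: Q.
    rewrite /der_app (bigD1 i) //= big1 ?addr0 => [|j ne]; first by rewrite mxE eqxx mulr1n.
    by rewrite mxE eq_sym (negbTE ne) mulr0n scaler0.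
  rewrite /Q (perm_big _ (perm_to_rem aA)) big_cons.
  by exists (a 0 i *: \prod_(b <- rem a A) lin_poly b); rewrite scalerAr.
have [N HN] := gen _ QD.
have MN : M *m N = Q%:M.
  apply/eqP; rewrite -subr_eq0; apply/eqP.
  have E : (M *m N - Q%:M) *m M = 0 by rewrite mulmxBl -mulmxA -HN mul_mx_scalar mul_scalar_mx subrr.
  apply/matrixP => i j; rewrite [RHS]mxE; apply: (Bfree (fun j => (M *m N - Q%:M) i j)) => k.
  have := congr1 (fun X : 'M_(m, l) => X i k) E; rewrite !mxE => E'; rewrite -[RHS]E'.
  by apply: eq_bigr => j' _; rewrite !mxE.
have ml : m = l.
  apply: trace_square Qnz _ MN _; last by rewrite -HN.
  move=> x y /(congr1 (meval (fun=> 0))); rewrite !rmorph_nat => /eqP.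
  by rewrite eqr_nat => /eqP.
subst m; exists M, N; split=> // i a aA.
have [g Hg] := BD i a aA; exists g; rewrite -Hg; apply: eq_bigr => j _; by rewrite mxE.
Qed.

(** Unique factorisation for products of linear forms: each prime [a] is absorbed by [D] or by [E],
    and what finally remains of [D] is a constant by size. *)
Lemma dvd_lin_prod d (L : seq 'rV[rat]_d) (D E : S d) : 0 \notin L ->
  D * E = \prod_(a <- L) lin_poly a ->
  exists c L', [/\ c != 0, subseq L' L & D = c *: \prod_(a <- L') lin_poly a].
Proof.
elim: L D E => [|a L IH] D E.
  rewrite big_nil => _ DE.
  have nzD : D != 0 by apply: contraPneq DE => ->; rewrite mul0r => /esym/eqP; rewrite oner_eq0.
  have nzE : E != 0 by apply: contraPneq DE => ->; rewrite mulr0 => /esym/eqP; rewrite oner_eq0.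
  have := msizeM nzD nzE; rewrite DE msize1 => /esym/eqP Hs.
  have sD : (0 < msize D)%N by rewrite lt0n msize_poly_eq0.
  have sE : (0 < msize E)%N by rewrite lt0n msize_poly_eq0.
  have /msize_poly1P[c nzc ->] : msize D == 1%N.
    by move: Hs sD sE; case: (msize D) => [|[|x]] //; case: (msize E) => [|y] //; rewrite !addnS.
  by exists c, [::]; split=> //; rewrite big_nil -mul_mpolyC mulr1.
rewrite in_cons negb_or eq_sym big_cons => /andP[nza nzL] DE.
have : dvdl a (D * E) by exists (\prod_(b <- L) lin_poly b).
have la : lin_poly a != 0 by rewrite lin_poly_eq0.
case/(dvdlM nza) => -[g Hg].
  have [|c [L' [nzc sL' Hc]]] := IH g E nzL; first by apply: (mulfI la); rewrite -DE Hg mulrA.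
  exists c, (a :: L'); split=> //; first by rewrite /= eqxx.
  by rewrite Hg Hc big_cons scalerAr.
have [|c [L' [nzc sL' Hc]]] := IH D g nzL; first by apply: (mulfI la); rewrite -DE Hg; ring.
by exists c, L'; split=> //; apply: subseq_trans sL' (subseq_cons _ _).
Qed.

Lemma row_free_complete r l (U : 'M[rat]_(r, l)) : row_free U ->
  exists2 P : 'M[rat]_l, P \in unitmx & exists2 f : 'I_r -> 'I_l, injective f &
    forall i, row (f i) P = row i U.
Proof.
move=> fU; have rl : (r <= l)%N by rewrite -(eqP fU) rank_leq_col.
have [k lE] : exists k, l = (r + k)%N by exists (l - r)%N; rewrite subnKC.
subst l; pose W := U^C%MS.
have rW : \rank W = k by rewrite mxrank_compl (eqP fU) addKn.
pose W' : 'M_(k, r + k) := castmx (rW, erefl) (row_base W).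
have W'W : (W' :=: W)%MS by apply: eqmx_trans (eqmx_cast _ _) (eq_row_base W).
exists (col_mx U W').
  have := addsmx_compl_full U; rewrite -row_full_unit -!sub1mx => /submx_trans; apply.
  by rewrite -addsmxE addsmxS // W'W.
exists (lshift k) => [|i]; first exact: lshift_inj.
by rewrite rowKu.
Qed.

Lemma not_uniq_perm (T : eqType) (s : seq T) :
  ~~ uniq s -> exists a s', perm_eq s [:: a, a & s'].
Proof.
elim: s => //= x s IH; rewrite negb_and negbK => /orP[xs|/IH[a [s' ps]]].
  by exists x, (rem x s); rewrite perm_cons perm_to_rem.
exists a, (x :: s'); apply: (@perm_trans _ [:: x, a, a & s']); first by rewrite perm_cons.
by have /permPl := perm_catCA [:: x] [:: a; a] s'; apply.
Qed.

Lemma big_flatten_nseq (R : comNzRingType) (T : Type) (F : T -> R) k (s : seq T) :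
  \prod_(x <- flatten (nseq k s)) F x = (\prod_(x <- s) F x) ^+ k.
Proof. by elim: k => [|k IH]; rewrite ?big_nil // exprS -IH /= big_cat. Qed.

Lemma dvdl_exp d (a : 'rV[rat]_d) f e : a != 0 -> dvdl a (f ^+ e) -> dvdl a f.
Proof.
move=> a0; elim: e => [|e IH]; first by rewrite expr0 => /(dvdl1 a0).
by rewrite exprS => /(dvdlM a0)[].
Qed.

Section BasisDet.
Variables (l : nat) (A : arrangement l).
Hypotheses (A0 : 0 \notin A) (uA : uniq A).
Hypothesis Aprop : forall a b, a \in A -> b \in A -> (b <= a)%MS -> a = b.

(* The derivations tangent to a = 0, multiplied by the other forms, show that a divides the
   determinant only once. *)
Lemma simple_factor_mx a : a \in A -> exists T : 'M[S l]_l, (forall i, in_D A (T i)) /\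
  exists c, c != 0 /\ \det T = c *: (lin_poly a * (\prod_(b <- rem a A) lin_poly b) ^+ l).
Proof.
move=> aA; have a0 : a != 0 by apply: contraNneq A0 => <-.
pose q : S l := \prod_(b <- rem a A) lin_poly b.
have fa : row_free a by rewrite /row_free rank_rV a0.
have [P uP [f _ fP]] := row_free_complete fa.
have uPT : P^T \in unitmx by rewrite unitmx_tr.
pose C := invmx P^T.
have Ca i : (C *m a^T) i 0 = (i == f 0)%:R.
  have -> : a^T = P^T *m (delta_mx (f 0) 0 : 'cV_l).
    by rewrite -trmx_delta -trmx_mul -rowE fP row_id.
  by rewrite /C mulKmx // mxE eqxx andbT.
(* In coordinates containing [a], given by [P], these are the dual derivations times [q]; the only
   one not annihilating [a] receives the additional factor [a]. *)
pose dg : 'rV[S l]_l := \row_i (if i == f 0 then lin_poly a * q else q).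
pose T := diag_mx dg *m map_mx (@mpolyC l rat) C.
have TE i b : der_app (T i) b = dg 0 i * ((C *m b^T) i 0)%:MP.
  rewrite der_appE [(C *m b^T) i 0]mxE rmorph_sum mulr_sumr; apply: eq_bigr => j _.
  rewrite /T mul_diag_mx !mxE rmorphM; set u := if _ then _ else _.
  by rewrite mulrC -mulrA.
exists T; split.
  move=> i b bA; rewrite TE; have [eab|nab] := eqVneq a b.
    subst b; rewrite Ca mxE; have [_|_] := eqVneq i (f 0); last by exists 0; rewrite !mulr0.
    by exists q; rewrite mulr1.
  have br : b \in rem a A by rewrite (rem_filter _ uA) mem_filter /= eq_sym nab.
  have qb : dvdl b q by rewrite /q (perm_big _ (perm_to_rem br)) big_cons; apply: dvdl_mulr; exists 1; rewrite mulr1.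
  by apply: dvdl_mulr; rewrite mxE; case: ifP => _ //; apply: dvdl_mull.
exists (\det C); split; first by have : C \in unitmx; [rewrite unitmx_inv | rewrite unitmxE unitfE].
rewrite det_mulmx det_diag det_map_mx mulrC mul_mpolyC; congr (_ *: _).
rewrite (bigD1 (f 0)) //= mxE eqxx -mulrA; congr (_ * _).
have -> : q ^+ l = \prod_(i < l) q by rewrite prodr_const card_ord.
rewrite [RHS](bigD1 (f 0)) //=; congr (_ * _).
by apply: eq_bigr => i ne; rewrite mxE (negbTE ne).
Qed.

(** [\det B] divides a power of the product of the forms, so it is itself a product of forms of [A].
    None occurs twice, for [T = X *m B] would make it divide the product of the others. This bounds
    the order of vanishing of the determinant from above. *)
Lemma basis_det : free_arr A -> exists B : 'M[S l]_l,
  (forall i, in_D A (B i)) /\ exists c L, [/\ c != 0, uniq L, {subset L <= A} &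
      \det B = c *: \prod_(a <- L) lin_poly a].
Proof.
move=> /(free_square_basis A0)[B [N [BD Bgen NB]]]; exists B; split=> //.
have detE : \det B * \det N = \prod_(a <- flatten (nseq l A)) lin_poly a.
  have := congr1 determinant NB; rewrite det_mulmx det_scalar mulrC => ->.
  by rewrite big_flatten_nseq.
have sub0 : {subset flatten (nseq l A) <= A}.
  by move=> x /flattenP[s /nseqP[-> _]].
have fl0 : 0 \notin flatten (nseq l A) by apply: contra A0; exact: sub0.
have [c [L [nzc sL detB]]] := dvd_lin_prod fl0 detE.
have LA : {subset L <= A} by move=> x /(mem_subseq sL)/sub0.
exists c, L; split=> //.
apply: contraT => /not_uniq_perm[a [L' pL]].
have aA : a \in A by apply: LA; rewrite (perm_mem pL) mem_head.
have a0 : a != 0 by apply: contraNneq A0 => <-.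
have la : lin_poly a != 0 by rewrite lin_poly_eq0.
have [T [TD [k [nzk detT]]]] := simple_factor_mx aA.
have [X TX] := Bgen T TD.
have : dvdl a (k *: (\prod_(b <- rem a A) lin_poly b) ^+ l).
  exists (\det X * (c *: \prod_(b <- L') lin_poly b)); apply: (mulfI la).
  rewrite -scalerAr -detT TX det_mulmx detB (perm_big _ pL) !big_cons.
  by rewrite -!scalerAr !mulrA; congr (_ *: _); ring.
rewrite -mul_mpolyC => /(dvdlM a0)[].
  case=> g /(congr1 (fun p => k^-1%:MP * p)); rewrite -mpolyCM mulVf // mpolyC1 mulrCA => H.
  by case: (dvdl1 a0); exists (k^-1%:MP * g).
move=> /(dvdl_exp a0)/(dvdl_prod a0)[b br ba].
have bA : b \in A by apply: mem_rem br.
by move: br; rewrite -(Aprop aA bA ba) mem_rem_uniq // inE eqxx.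
Qed.
End BasisDet.

(** * An obstruction to freeness *)

Definition dot l (a v : 'rV[rat]_l) : rat := \sum_i a 0 i * v 0 i.

Lemma dotDr l (a v w : 'rV[rat]_l) : dot a (v + w) = dot a v + dot a w.
Proof. by rewrite /dot -big_split /=; apply: eq_bigr => i _; rewrite mxE mulrDr. Qed.

Lemma dotZr l c (a v : 'rV[rat]_l) : dot a (c *: v) = c * dot a v.
Proof. by rewrite /dot mulr_sumr; apply: eq_bigr => i _; rewrite mxE mulrCA. Qed.

Definition line_eval l (p v : 'rV[rat]_l) : S l -> {poly rat} :=
  mmap polyC (fun i => (p 0 i)%:P + v 0 i *: 'X).

HB.instance Definition _ l (p v : 'rV[rat]_l) := GRing.RMorphism.copy (line_eval p v)
  (mmap (polyC : {rmorphism rat -> {poly rat}}) (fun i => (p 0 i)%:P + v 0 i *: 'X)).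

Lemma line_eval_lin l (p v a : 'rV[rat]_l) :
  line_eval p v (lin_poly a) = (dot a p)%:P + dot a v *: 'X.
Proof.
rewrite /line_eval (mmap_lin_poly (polyC : {rmorphism rat -> {poly rat}})).
rewrite /dot rmorph_sum scaler_suml -big_split /=; apply: eq_bigr => i _.
by rewrite mulrDr -polyCM mul_polyC scalerA.
Qed.

Lemma line_evalZ l (p v : 'rV[rat]_l) c f : line_eval p v (c *: f) = c *: line_eval p v f.
Proof. by rewrite -mul_polyC -mul_mpolyC rmorphM /= /line_eval (mmapC _ (polyC : {rmorphism rat -> {poly rat}})). Qed.

Lemma seq_choice (T : eqType) (U : Type) (s : seq T) (R : T -> U -> Prop) (u0 : U) :
  (forall x, x \in s -> exists u, R x u) -> exists f, forall x, x \in s -> R x (f x).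
Proof.
elim: s => [|x s IH] H; first by exists (fun=> u0).
have [f Hf] := IH (fun y ys => H y (mem_behead (s := x :: s) ys)).
have [u Hu] := H x (mem_head _ _).
exists (fun y => if y == x then u else f y) => y; rewrite in_cons.
by case: eqP => [-> //|_] /= /Hf.
Qed.

Lemma X_val_leq K m (Q R : {poly rat}) : 'X^K * Q = 'X^m * R -> R.[0] != 0 -> (K <= m)%N.
Proof.
move=> E; apply: contraR; rewrite -ltnNge => lt_mK; apply/eqP.
have : 'X^(K - m) * Q = R.
  apply: (@mulfI _ ('X^m)); first by rewrite monic_neq0 ?monicXn.
  by rewrite mulrA -exprD subnKC // ltnW.
by move=> <-; rewrite hornerM hornerXn expr0n subn_eq0 leqNgt lt_mK mul0r.
Qed.

Section Obstruction.
Variables (l : nat) (A : arrangement l).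
Hypotheses (A0 : 0 \notin A) (uA : uniq A).
Hypothesis Aprop : forall a b, a \in A -> b \in A -> (b <= a)%MS -> a = b.
Variables (p v : 'rV[rat]_l).
Hypothesis pv : forall a, a \in A -> dot a p = 0 -> dot a v != 0.

Lemma line_eval_prod L : {subset L <= A} -> exists R, R.[0] != 0 /\
  line_eval p v (\prod_(a <- L) lin_poly a) = 'X^(count (fun a => dot a p == 0) L) * R.
Proof.
elim: L => [|a L IH] LA; first by exists 1; rewrite hornerC oner_eq0 big_nil rmorph1 mul1r.
have [|R [R0 HR]] := IH; first by move=> x xL; apply: LA; rewrite in_cons xL orbT.
have aA : a \in A by apply: LA; rewrite mem_head.
rewrite big_cons rmorphM /= HR line_eval_lin; have [ap|ap] := eqVneq (dot a p) 0.
  exists (dot a v *: R); split; first by rewrite hornerZ mulf_neq0 // pv.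
  by rewrite /= ap add0r add1n exprS -scalerAl -scalerAr mulrA.
exists (((dot a p)%:P + dot a v *: 'X) * R); split; last by rewrite /= add0n mulrCA.
by rewrite hornerM hornerD hornerC hornerZ hornerX mulr0 addr0 mulf_neq0.
Qed.

Variables (r k : nat) (z : 'I_r.+1 -> 'rV[rat]_l).
Hypothesis zA : forall i, z i \in A.
Hypothesis zp : forall i, dot (z i) p = 0.
Hypothesis zfree : row_free (\matrix_i z i).
Hypothesis agree : forall theta (g : 'rV[rat]_l -> S l),
  (forall a, a \in A -> der_app theta a = lin_poly a * g a) ->
  forall i, exists h, line_eval p v (g (z i)) - line_eval p v (g (z 0)) = 'X^k * h.

(** Along the line the columns belonging to [u] vanish to orders 1 and [k + 1], while the
    determinant is a product of distinct forms, which vanish at most simply at [p] by [pv]. *)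
Lemma free_obstruction : free_arr A -> (1 + r * k.+1 <= count (fun a => dot a p == 0%R) A)%N.
Proof.
move=> /(basis_det A0 uA Aprop)[B [BD [c [L [nzc uL LA detB]]]]].
have zv i : dot (z i) v != 0 by rewrite pv.
(* The coefficients equalise the linear factors on the line, so a derivation sends [u i] to a
   multiple of [t] times the difference of two quotients. *)
pose u (i : 'I_r.+1) := if i == 0 then z 0 else dot (z 0) v *: z i - dot (z i) v *: z 0.
pose w (i : 'I_r.+1) := if i == 0 then 1%N else k.+1.
have ufree : row_free (\matrix_i u i).
  apply: row_freeE => x; rewrite mulmx_sum_row.
  under eq_bigr => i _ do rewrite rowK.
  rewrite big_ord_recl /= => Hx.
  pose y : 'rV[rat]_r.+1 := \row_i (if i == 0 then x 0 0 - \sum_(j < r) x 0 (lift 0 j) * dot (z (lift 0 j)) v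
     else x 0 i * dot (z 0) v).
  have : y *m \matrix_i z i = 0.
    rewrite mulmx_sum_row; under eq_bigr => i _ do rewrite rowK.
    rewrite big_ord_recl /= mxE eqxx -[RHS]Hx /u eqxx scalerBl -addrA; congr (_ + _).
    rewrite scaler_suml addrC -sumrB; apply: eq_bigr => j _.
    by rewrite mxE /= scalerBr !scalerA.
  move/eqP; rewrite mulmx_free_eq0 // => /eqP/rowP y0.
  have xj j : x 0 (lift 0 j) = 0.
    have := y0 (lift 0 j); rewrite !mxE /= => /eqP; rewrite mulf_eq0 (negbTE (zv 0)) orbF.
    by move/eqP.
  apply/rowP => i; rewrite mxE; have [j ->|->] := unliftP 0 i; first exact: xj.
  have := y0 0; rewrite !mxE eqxx big1 ?subr0 // => j _; by rewrite xj mul0r.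
have [P uP [f f_inj fP]] := row_free_complete ufree.
pose ev : {rmorphism S l -> {poly rat}} := line_eval p v.
have evE q : ev q = line_eval p v q by [].
pose W := map_mx ev B *m (map_mx polyC P)^T.
have Wf j i : exists h, W j (f i) = 'X^(w i) * h.
  have -> : W j (f i) = ev (der_app (B j) (u i)).
    rewrite mxE /der_app rmorph_sum; apply: eq_bigr => x _; rewrite !mxE.
    transitivity (u i 0 x *: ev (B j x)); last exact/esym/line_evalZ.
    rewrite -mul_polyC mulrC; congr (_%:P * _).
    by have /rowP/(_ x) := fP i; rewrite rowK !mxE.
  have [g Hg] := seq_choice 0 (BD j).
  have evz i' : ev (der_app (B j) (z i')) = dot (z i') v *: ('X * line_eval p v (g (z i'))).
    by rewrite Hg // rmorphM /= line_eval_lin zp add0r scalerAl.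
  rewrite /u /w; case: eqP => [_|_].
    by exists (dot (z 0) v *: line_eval p v (g (z 0))); rewrite evz expr1 scalerAr.
  have [h Hh] := agree Hg i; exists ((dot (z 0) v * dot (z i) v) *: h).
  have evl a b q q' : ev (der_app (B j) (a *: q - b *: q')) =
      a *: ev (der_app (B j) q) - b *: ev (der_app (B j) q').
    have -> : der_app (B j) (a *: q - b *: q') = a *: der_app (B j) q - b *: der_app (B j) q'.
      by rewrite linearB !linearZ.
    by rewrite rmorphB; congr (_ - _); exact: line_evalZ.
  rewrite evl !evz !scalerA.
  rewrite [dot (z i) v * _]mulrC -scalerBr -mulrBr Hh mulrA -exprS.
  exact: scalerAr.
pose wx (x : 'I_l) : nat := \sum_(i | f i == x) w i.
have Wx j x : exists h, W j x = h * 'X^(wx x).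
  have [/existsP[i /eqP fi]|/existsPn nf] := boolP [exists i, f i == x].
    have [h Hh] := Wf j i; exists h; rewrite -fi Hh mulrC /wx (big_pred1 i) // => i'.
    by rewrite (inj_eq f_inj).
  exists (W j x); rewrite /wx big1 ?expr0 ?mulr1 // => i fi.
  by have := nf i; rewrite fi.
have /fin_all_exists[W' HW'] : forall j, exists W' : 'I_l -> {poly rat}, forall x, W j x = W' x * 'X^(wx x).
  by move=> j; have /fin_all_exists[h Hh] := Wx j; exists h.
have detW : \det W = 'X^(1 + r * k.+1) * \det (\matrix_(j, x) W' j x).
  have -> : W = (\matrix_(j, x) W' j x) *m diag_mx (\row_x 'X^(wx x)).
    by apply/matrixP => j x; rewrite mul_mx_diag [RHS]mxE [X in _ = X * _]mxE [X in _ = _ * X]mxE HW'.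
  rewrite det_mulmx det_diag mulrC; congr (_ * _).
  under eq_bigr => x _ do rewrite mxE.
  rewrite -expr_sum; congr ('X^_).
  rewrite (exchange_big_dep xpredT) //= (eq_bigr w) => [|i _]; last by rewrite (big_pred1 (f i)) // => x; rewrite eq_sym.
  rewrite big_ord_recl /w eqxx; congr (_ + _)%N.
  by rewrite (eq_bigr (fun=> k.+1)) // sum_nat_const card_ord.
have detW' : \det W = ev (\det B) * (\det P)%:P.
  by rewrite det_mulmx det_tr !det_map_mx.
have [R [R0 HR]] := line_eval_prod LA.
have le_K : (1 + r * k.+1 <= count (fun a => dot a p == 0%R) L)%N.
  have nzP : \det P != 0 by rewrite -unitfE.
  apply: (@X_val_leq _ _ (\det (\matrix_(j, x) W' j x)) ((c * \det P) *: R)).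
    by rewrite -detW detW' detB evE line_evalZ HR mulrC mul_polyC scalerA [_ * c]mulrC scalerAr.
  by rewrite hornerZ !mulf_neq0.
apply: leq_trans le_K _; rewrite -!size_filter; apply: uniq_leq_size; first exact: filter_uniq.
by move=> x; rewrite !mem_filter => /andP[-> /LA].
Qed.
End Obstruction.

(* The coefficient of t^d along the line p + t x is a form of degree d in x; only its
   behaviour on lines is needed. *)
Definition line_poly l d (F : 'rV[rat]_l -> rat) :=
  forall x y, exists2 pi : {poly rat}, (size pi <= d.+1)%N & forall s, pi.[s] = F (x + s *: y).

Lemma line_polyB l d (F G : 'rV[rat]_l -> rat) :
  line_poly d F -> line_poly d G -> line_poly d (fun x => F x - G x).
Proof.
move=> HF HG x y; have [p sp Hp] := HF x y; have [q sq Hq] := HG x y.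
exists (p - q); last by move=> s; rewrite hornerD hornerN Hp Hq.
by apply: leq_trans (size_polyD _ _) _; rewrite size_polyN geq_max sp.
Qed.

Lemma line_poly_zero l d (F : 'rV[rat]_l -> rat) x y (rs : seq rat) : line_poly d F ->
  uniq rs -> (d < size rs)%N -> {in rs, forall s, F (x + s *: y) = 0} -> forall s, F (x + s *: y) = 0.
Proof.
move=> HF urs sz H s; have [pi spi Hpi] := HF x y; rewrite -Hpi.
suff -> : pi = 0 by rewrite horner0.
apply: (roots_geq_poly_eq0 (rs := rs)) => //; last exact: leq_trans spi sz.
by apply/allP => t tr; rewrite /root Hpi H.
Qed.

Lemma line_coef_poly l (p : 'rV[rat]_l) (g : S l) d :
  line_poly d (fun x => (line_eval p x g)`_d).
Proof.
move=> x y.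
(* The generic point [p + t (x + s y)], with [t] the outer and [s] the inner variable. *)
pose h (i : 'I_l) : {poly {poly rat}} := (p 0 i)%:P%:P + ((x 0 i)%:P + y 0 i *: 'X)%:P * 'X.
pose cc : {rmorphism rat -> {poly {poly rat}}} := (polyC : {rmorphism {poly rat} -> {poly {poly rat}}}) \o
   (polyC : {rmorphism rat -> {poly rat}}).
pose ev : {rmorphism S l -> {poly {poly rat}}} := mmap cc h.
suff [H1 H2] : (forall d : nat, (size ((ev g)`_d)%R <= d.+1)%N) /\
    forall s, map_poly (horner_eval s) (ev g) = line_eval p (x + s *: y) g.
  by exists (ev g)`_d => // s; rewrite -H2 coef_map.
have evC c : ev c%:MP = c%:P%:P by apply: (mmapC _ cc).
have evX i : ev 'X_i = h i by rewrite /ev /= mmapX mmap1U.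
elim/mpoly_ind_ring: (g) => [c|i|a b [Ha1 Ha2] [Hb1 Hb2]|a b [Ha1 Ha2] [Hb1 Hb2]].
- split=> [e|s]; rewrite evC.
    rewrite coefC; case: eqP => _; rewrite ?size_poly0 // size_polyC.
    by case: (c != 0).
  by rewrite map_polyC /= [horner_eval _ _]hornerC /line_eval (mmapC _ (polyC : {rmorphism rat -> {poly rat}})).
- split=> [e|s]; rewrite evX /h.
    rewrite coefD coefC coefMX coefC.
    case: e => [|[|e]] /=; rewrite ?addr0 ?add0r ?size_poly0 //.
      by rewrite size_polyC; case: (_ != 0).
    apply: leq_trans (size_polyD _ _) _; rewrite geq_max size_polyC; apply/andP; split; first by case: (_ != 0).
    by apply: leq_trans (size_scale_leq _ _) _; rewrite size_polyX.
  rewrite rmorphD rmorphM /= !map_polyC map_polyX /= !/(horner_eval _ _).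
  rewrite /line_eval mmapX mmap1U !mxE hornerC hornerD hornerC hornerZ hornerX mul_polyC.
  by rewrite [s * _]mulrC.
- split=> [e|s]; first by rewrite rmorphD coefD (leq_trans (size_polyD _ _)) // geq_max Ha1 Hb1.
  by rewrite !rmorphD /= Ha2 Hb2.
- split=> [e|s]; last by rewrite !rmorphM /= Ha2 Hb2.
  rewrite rmorphM coefM; apply: (big_ind (fun q : {poly rat} => (size q <= e.+1)%N)).
  + by rewrite size_poly0.
  + by move=> u w Hu Hw; rewrite (leq_trans (size_polyD _ _)) // geq_max Hu Hw.
  + move=> k _; apply: leq_trans (size_polyMleq _ _) _.
    have ke := ltn_ord k; rewrite ltnS in ke.
    have := leq_add (Ha1 k) (Hb1 (e - k)%N); rewrite addSn addnS subnKC //.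
    by case: (_ + _)%N.
Qed.

Lemma line_coef0 l (p x : 'rV[rat]_l) (g : S l) : (line_eval p x g)`_0 = g.@[p 0].
Proof.
elim/mpoly_ind_ring: g => [c|i|a b Ha Hb|a b Ha Hb].
- by rewrite /line_eval (mmapC _ (polyC : {rmorphism rat -> {poly rat}})) coefC mevalC.
- by rewrite /line_eval mmapX mmap1U mevalXU coefD coefC coefZ coefX mulr0 addr0.
- by rewrite rmorphD coefD Ha Hb mevalD.
- by rewrite rmorphM coef0M Ha Hb mevalM.
Qed.

Section Syzygy.
Variables (l : nat) (A : arrangement l) (p : 'rV[rat]_l) (theta : der l) (g : 'rV[rat]_l -> S l).
Hypothesis Hg : forall a, a \in A -> der_app theta a = lin_poly a * g a.

(** Apply [theta] to the relation and compare the coefficients of [t^(d+1)] along [p + t x]; each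
    form restricts to a multiple of [t], as it vanishes at [p]. *)
Lemma syzygy (I : finType) (c : I -> rat) (z : I -> 'rV[rat]_l) d x :
  (forall i, z i \in A) -> (forall i, dot (z i) p = 0) -> \sum_i c i *: z i = 0 ->
  \sum_i c i * dot (z i) x * (line_eval p x (g (z i)))`_d = 0.
Proof.
move=> zA zp z0.
have E : \sum_i c i *: (line_eval p x (lin_poly (z i)) * line_eval p x (g (z i))) = 0.
  transitivity (line_eval p x (der_app theta (\sum_i c i *: z i))).
    rewrite linear_sum rmorph_sum /=; apply: eq_bigr => i _.
    by rewrite linearZ /= Hg // line_evalZ rmorphM.
  by rewrite z0 linear0 rmorph0.
have := congr1 (fun q : {poly rat} => q`_d.+1) E; rewrite coef0 coef_sum => E'.
rewrite -[RHS]E'; apply: eq_bigr => i _.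
by rewrite line_eval_lin zp add0r coefZ -scalerAl coefZ coefXM /= mulrA.
Qed.
End Syzygy.

Lemma poly_agree (k : nat) (a b : {poly rat}) :
  (forall d, (d < k)%N -> a`_d = b`_d) -> exists h, a - b = 'X^k * h.
Proof.
move=> H; exists (\poly_(i < size (a - b)) (a - b)`_(k + i)); apply/polyP => i.
rewrite coefXnM; case: ltnP => [ik|ki]; first by rewrite coefB H // subrr.
rewrite coef_poly subnKC //; case: ltnP => // le; rewrite nth_default //.
by apply: leq_trans le _; rewrite leq_subr.
Qed.

(** For [k = 1] only the values of the quotients at [p] count. They produce a second linear relation
    among the [z i]; a circuit has only one up to scaling, so the values coincide. *)
Lemma circuit_obstruction l (A : arrangement l) (p v : 'rV[rat]_l) (r : nat)
    (z : 'I_r.+2 -> 'rV[rat]_l) (c : 'I_r.+2 -> rat) :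
  0 \notin A -> uniq A -> (forall a b, a \in A -> b \in A -> (b <= a)%MS -> a = b) ->
  (forall a, a \in A -> dot a p = 0 -> dot a v != 0) ->
  (forall i, z i \in A) -> (forall i, dot (z i) p = 0) -> (forall i, c i != 0) ->
  \sum_i c i *: z i = 0 -> row_free (\matrix_(i < r.+1) z (lift ord_max i)) ->
  free_arr A -> (1 + r * 2 <= count (fun a => dot a p == 0%R) A)%N.
Proof.
move=> A0 uA Aprop pv zA zp c0 zc zf.
apply: (free_obstruction A0 uA Aprop pv (z := fun i => z (lift ord_max i))) => // theta g Hg.
have E x := syzygy Hg 0 x zA zp zc.
pose G i := (g (z i)).@[p 0].
have {}E : \sum_i (c i * (G i - G ord_max)) *: z i = 0.
  have -> : \sum_i (c i * (G i - G ord_max)) *: z i =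
      \sum_i (c i * G i) *: z i - G ord_max *: \sum_i c i *: z i.
    rewrite scaler_sumr -sumrB; apply: eq_bigr => i _.
    by rewrite scalerA -scalerBl [G ord_max * _]mulrC mulrBr.
  rewrite zc scaler0 subr0.
  apply/rowP => u; rewrite summxE mxE; have := E (delta_mx 0 u).
  move=> E'; rewrite -[RHS]E'; apply: eq_bigr => i _; rewrite line_coef0 -/(G i) mxE.
  rewrite /dot (bigD1 u) //= mxE !eqxx mulr1 big1 ?addr0 => [|j ne]; first by ring.
  by rewrite mxE (negbTE ne) andbF mulr0.
have {}E : (\row_i (c (lift ord_max i) * (G (lift ord_max i) - G ord_max))) *m
    (\matrix_(i < r.+1) z (lift ord_max i)) = 0.
  rewrite mulmx_sum_row -[RHS]E [RHS](bigD1_ord ord_max) //= subrr mulr0 scale0r add0r.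
  by apply: eq_bigr => i _; rewrite rowK mxE.
have {}E i : G (lift ord_max i) = G ord_max.
  move/eqP: E; rewrite mulmx_free_eq0 // => /eqP/rowP/(_ i); rewrite !mxE => /eqP.
  by rewrite mulf_eq0 (negbTE (c0 _)) subr_eq0 => /eqP.
move=> i; apply: poly_agree => -[|d] // _.
by rewrite !line_coef0 -/(G _) -/(G _) !E.
Qed.

(** * Connected subgraphs and contractions *)

Section Connected.
Variables (n : nat) (E : rel 'I_n).
Hypothesis symE : ssrbool.symmetric E.
Implicit Types I J : {set 'I_n}.

Lemma induced_sym I : connect_sym (induced_rel E I).
Proof. by apply: sym_connect_sym => x y; rewrite /induced_rel /= symE andbCA. Qed.

Lemma conn_neq0 I : induced_connected E I -> exists x, x \in I.
Proof. by case/andP => /set0Pn. Qed.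

Lemma conn_connect I x y : induced_connected E I -> x \in I -> y \in I -> connect (induced_rel E I) x y.
Proof. by case/andP => _ /forall_inP/(_ x) H xI yI; have /forall_inP := H xI; apply. Qed.

Lemma conn_closed I (P : pred 'I_n) : induced_connected E I ->
  (forall x y, x \in I -> y \in I -> E x y -> P x = P y) -> forall x y, x \in I -> y \in I -> P x = P y.
Proof.
move=> cI HP x y xI yI; apply: (@closed_connect _ (induced_rel E I)); last exact: conn_connect.
by move=> a b /= /and3P[aI bI eab]; exact: HP.
Qed.

Lemma induced_sub I J x y : I \subset J -> connect (induced_rel E I) x y -> connect (induced_rel E J) x y.
Proof.
move/subsetP => sIJ; apply: connect_sub => a b /= /and3P[aI bI eab].
by apply: connect1; rewrite /induced_rel /= !sIJ.
Qed.

Lemma conn1 x : induced_connected E [set x].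
Proof.
apply/andP; split; first by apply/set0Pn; exists x; rewrite inE.
apply/forall_inP => a /set1P ->; apply/forall_inP => b /set1P ->; exact: connect0.
Qed.

Lemma conn_union I J x y : induced_connected E I -> induced_connected E J ->
  x \in I -> y \in J -> E x y -> induced_connected E (I :|: J).
Proof.
move=> cI cJ xI yJ exy; apply/andP; split; first by apply/set0Pn; exists x; rewrite inE xI.
have to_x a : a \in I :|: J -> connect (induced_rel E (I :|: J)) a x.
  case/setUP => [aI|aJ]; first by apply: (induced_sub (subsetUl I J)); exact: conn_connect.
  apply: (@connect_trans _ _ y); first by apply: (induced_sub (subsetUr I J)); exact: conn_connect.
  by apply: connect1; rewrite /induced_rel /= !inE yJ xI orbT symE exy.
apply/forall_inP => a aIJ; apply/forall_inP => b bIJ.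
by apply: (connect_trans (to_x a aIJ)); rewrite induced_sym; exact: to_x.
Qed.

Lemma subset_form_inj : injective (@subset_form n).
Proof.
move=> I J IJ; apply/setP => x; have := congr1 (fun M : 'rV_n => M 0 x) IJ; rewrite !mxE => /eqP.
by rewrite eqr_nat; case: (x \in I) (x \in J) => [] [].
Qed.

Lemma conn_arrP a : reflect (exists2 I, induced_connected E I & a = subset_form I)
  (a \in connected_subgraph_arr E).
Proof.
apply: (iffP mapP) => [[I]|[I cI ->]]; first by rewrite mem_enum inE => cI ->; exists I.
by exists I; rewrite // mem_enum inE.
Qed.

Lemma conn_arr_uniq : uniq (connected_subgraph_arr E).
Proof. by rewrite map_inj_uniq ?enum_uniq //; exact: subset_form_inj. Qed.

Lemma conn_arr0 : 0 \notin connected_subgraph_arr E.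
Proof.
apply/negP => /conn_arrP[I /conn_neq0[x xI]] /(congr1 (fun M : 'rV_n => M 0 x)).
by rewrite !mxE xI => /eqP; rewrite eq_sym oner_eq0.
Qed.

Lemma conn_arr_prop a b : a \in connected_subgraph_arr E -> b \in connected_subgraph_arr E ->
  (b <= a)%MS -> a = b.
Proof.
move=> /conn_arrP[I _ ->] /conn_arrP[J /conn_neq0[x xJ] ->] /sub_rVP[c] cE.
suff c1 : c = 1 by rewrite cE c1 scale1r.
have := congr1 (fun M : 'rV_n => M 0 x) cE; rewrite !mxE xJ.
case: (x \in I); first by rewrite mulr1.
by rewrite mulr0 => /eqP; rewrite oner_eq0.
Qed.

Lemma dot_subset_delta I y : dot (subset_form I) (delta_mx 0 y) = (y \in I)%:R.
Proof.
rewrite /dot (bigD1 y) //= !mxE !eqxx mulr1 big1 ?addr0 // => x ne.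
by rewrite !mxE (negbTE ne) andbF mulr0.
Qed.
End Connected.

(** Uniqueness of base [M] expansions of 0. It lets one explicit point avoid all the unwanted
    hyperplanes at once, in place of a genericity argument. *)
Lemma balanced_digits (M : int) m (d : nat -> int) : (0 < M) ->
  (forall k, (k < m)%N -> `|d k| < M) -> \sum_(k < m) d k * M ^+ k = 0 ->
  forall k, (k < m)%N -> d k = 0.
Proof.
move=> M0; elim: m d => [|m IH] d Hd //; rewrite big_ord_recl expr0 mulr1.
under eq_bigr => i _ do rewrite exprS mulrCA.
rewrite -mulr_sumr => S0.
have d0 : d 0%N = 0.
  apply/eqP; rewrite -normr_eq0; apply/negPn/negP => nz.
  have Md : (M %| d 0%N)%Z.
    by move/eqP: S0; rewrite addr_eq0 => /eqP ->; rewrite -mulrN dvdz_mulr.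
  have := Hd 0%N isT; rewrite ltNge => /negP; apply.
  case/dvdzP: Md nz => q ->; rewrite normrM (ger0_norm (ltW M0)) => nz.
  rewrite ler_peMl ?(ltW M0) // -gtz0_ge1 lt_def normr_ge0 andbT.
  by apply: contraNneq nz => ->; rewrite mul0r.
have S1 : \sum_(i < m) d i.+1 * M ^+ i = 0.
  by move/eqP: S0; rewrite d0 add0r mulf_eq0 (gt_eqF M0) => /eqP.
by move=> [|k] //; rewrite ltnS => km; apply: (IH (fun k => d k.+1)) => // i im; exact: Hd.
Qed.

Fixpoint subs (s : seq nat) : seq (seq nat) :=
  if s is x :: s' then subs s' ++ map (cons x) (subs s') else [:: [::]].

Lemma filter_subs P s : filter P s \in subs s.
Proof.
elim: s => //= x s IH; rewrite mem_cat; case: (P x); last by rewrite IH.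
by rewrite map_f ?orbT.
Qed.

(* Connectivity certificates for lists of blocks: in a buildable list each block is joined to a
   later one; in a separable list the component of the head is a proper part. *)
Fixpoint buildable (e : rel nat) (J : seq nat) : bool :=
  if J is j :: J' then (if J' is [::] then true else has (e j) J' && buildable e J') else false.

Definition component (e : rel nat) (J : seq nat) : seq nat :=
  iter (size J) (fun C => [seq j <- J | (j \in C) || has (e j) C]) [:: head 0%N J].

Definition separable (e : rel nat) (J : seq nat) : bool :=
  let C := component e J in
  [&& head 0%N J \in C, has (fun j => j \notin C) J &
      all (fun j => (j \in C) || all (fun c => ~~ e j c) C) J].

Definition wsum (q : nat -> int) (J : seq nat) : int := foldr (fun j s => q j + s) 0 J.

Lemma wsumE q J : wsum q J = \sum_(j <- J) q j.
Proof. by elim: J => [|j J IH]; rewrite ?big_nil // big_cons /= IH. Qed.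

Section Blocks.
Variables (n : nat) (E : rel 'I_n) (r : nat) (f : 'I_n -> nat) (e : rel nat) (rho : nat -> 'I_n).
Hypothesis symE : ssrbool.symmetric E.
Hypothesis rhoK : forall j, (j < r)%N -> f (rho j) = j.
Hypothesis block_conn : forall j, (j < r)%N -> induced_connected E [set x | f x == j].
Hypothesis block_edge : forall x y, (f x < r)%N -> (f y < r)%N -> f x != f y -> E x y -> e (f x) (f y).
Hypothesis edge_block : forall i j, (i < r)%N -> (j < r)%N -> i != j -> e i j ->
  exists x y, [/\ f x = i, f y = j & E x y].
Implicit Types (J : seq nat).

Definition blocks J : {set 'I_n} := [set x | f x \in J].

Lemma buildable_conn J : all (fun j => j < r)%N J -> uniq J -> buildable e J ->
  induced_connected E (blocks J).
Proof.
elim: J => // j J IH /= /andP[jr Jr] /andP[jJ uJ].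
have b1 : blocks [:: j] = [set x | f x == j] by apply/setP => x; rewrite !inE.
case: J IH Jr jJ uJ => [|j' J] IH Jr jJ uJ; first by rewrite b1 => _; exact: block_conn.
have -> : blocks [:: j, j' & J] = blocks [:: j] :|: blocks (j' :: J).
  by apply/setP => x; rewrite !inE.
case/andP=> /hasP[c cJ ejc] bJ.
have cr : (c < r)%N by apply: (allP Jr).
have jc : j != c by apply: contraNneq jJ => ->.
have [x [y [fx fy exy]]] := edge_block jr cr jc ejc.
apply: (@conn_union _ _ symE _ _ x y) => //; first by rewrite b1; exact: block_conn.
- exact: IH.
- by rewrite !inE fx.
- by rewrite inE fy.
Qed.

Lemma separable_disconn J : all (fun j => j < r)%N J -> separable e J ->
  ~ induced_connected E (blocks J).
Proof.
move=> Jr; rewrite /separable; set C := component e J.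
case/and3P=> hC /hasP[j jJ jC] /allP sep cJ.
have hJ : head 0%N J \in J by case: (J) jJ => //= x s _; rewrite mem_head.
have rJ i : i \in J -> rho i \in blocks J by move=> iJ; rewrite inE rhoK // (allP Jr).
have := conn_closed (P := fun x => f x \in C) cJ _ (rJ _ hJ) (rJ _ jJ).
rewrite !rhoK ?(allP Jr) // hC (negbTE jC) => H; suff: true = false by []; apply: H.
have key x y : x \in blocks J -> y \in blocks J -> E x y -> f y \in C -> f x \in C.
  rewrite !inE => xJ yJ exy yC; have /orP[//|/allP nx] := sep _ xJ.
  have [->//|fxy] := eqVneq (f x) (f y).
  by have := nx _ yC; rewrite block_edge // (allP Jr).
move=> x y xJ yJ exy; apply/idP/idP; apply: key => //.
by rewrite symE.
Qed.

Variable q : nat -> int.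

(** The point has to lie only on the hyperplanes of weight-zero unions of blocks. Each vertex
    receives its own power of [M], compensated at the representative of its block unless it is
    deleted, so the form of [I] is an expansion in base [M] that vanishes only if [I] is a union of
    blocks and has weight 0. [M] exceeds [\sum_j |q j|], which bounds the lowest digit, and 1, which
    bounds the others. *)
Definition block_point : 'rV[rat]_n :=
  let M : int := (2 + \sum_(j < r) `|q j|)%R in
  \sum_(j < r) (q j)%:~R *: delta_mx 0 (rho j) +
  \sum_(y < n) (M ^+ y.+1)%:~R *: (delta_mx 0 y - (f y < r)%N%:R *: delta_mx 0 (rho (f y))).

Lemma dot_suml l (I : Type) (s : seq I) (P : pred I) (F : I -> 'rV[rat]_l) a :
  dot a (\sum_(i <- s | P i) F i) = \sum_(i <- s | P i) dot a (F i).
Proof.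
elim/big_rec2: _ => [|i x y _ <-]; last by rewrite dotDr.
by rewrite /dot big1 // => i _; rewrite mxE mulr0.
Qed.

Lemma dot_block_point (I : {set 'I_n}) : dot (subset_form I) block_point =
  (\sum_(j < r) q j * (rho j \in I)%:R + \sum_(y < n)
    (2 + \sum_(j < r) `|q j|) ^+ y.+1 * ((y \in I)%:R - (f y < r)%N%:R * (rho (f y) \in I)%:R))%:~R.
Proof.
rewrite /block_point dotDr !dot_suml rmorphD !rmorph_sum /=; congr (_ + _); apply: eq_bigr => x _.
  by rewrite dotZr dot_subset_delta rmorphM rmorph_nat.
rewrite dotZr dotDr -scaleN1r dotZr dotZr !dot_subset_delta.
by rewrite rmorphM rmorphB rmorphM /= !rmorph_nat mulN1r.
Qed.

Lemma block_point_zero (I : {set 'I_n}) : dot (subset_form I) block_point = 0 ->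
  let J := [seq j <- iota 0 r | rho j \in I] in I = blocks J /\ wsum q J = 0.
Proof.
rewrite dot_block_point => /eqP; rewrite intr_eq0 => /eqP S0 J.
set M := 2 + _ in S0.
pose d (k : nat) : int := if k is y.+1 then
    (if insub y is Some u then ((u : 'I_n) \in I)%:R - (f u < r)%N%:R * (rho (f u) \in I)%:R else 0)
  else \sum_(j < r) q j * (rho j \in I)%:R.
have M0 : (0 < M) by rewrite ltr_pwDl // sumr_ge0.
have dS (y : 'I_n) : d y.+1 = (y \in I)%:R - (f y < r)%N%:R * (rho (f y) \in I)%:R by rewrite /d valK.
have H : forall k, (k < n.+1)%N -> d k = 0.
  apply: (balanced_digits M0) => [[|k]|].
  - move=> _; apply: (@le_lt_trans _ _ (\sum_(j < r) `|q j|)); last by rewrite ltrDr.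
    apply: le_trans (ler_norm_sum _ _ _) _; apply: ler_sum => j _.
    by rewrite normrM; case: (_ \in I); rewrite ?normr1 ?mulr1 // normr0 mulr0.
  - rewrite ltnS => kn; rewrite (dS (Ordinal kn)).
    apply: (@le_lt_trans _ _ 1); last by rewrite -[1]addr0 ltr_leD // sumr_ge0.
    by case: (_ \in I); case: (_ < r)%N; case: (_ \in I).
  - rewrite big_ord_recl expr0 mulr1 -[RHS]S0; congr (_ + _); apply: eq_bigr => y _.
    by rewrite mulrC; congr (_ * _); exact: dS.
have IJ : I = blocks J.
  apply/setP => y; have := H y.+1 (ltn_ord y); rewrite dS => /eqP.
  rewrite subr_eq0 -natrM eqr_nat !inE mem_filter mem_iota /= add0n => /eqP E1.
  by move: E1; case: (y \in I); case: (f y < r)%N; case: (_ \in I).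
split=> //; rewrite wsumE /J big_filter.
have := H 0%N isT; rewrite /= => E0.
rewrite big_mkcond -[RHS]E0 -(big_mkord xpredT (fun j => q j * (rho j \in I)%:R)) /index_iota subn0.
by apply: eq_bigr => j _; case: (_ \in I); rewrite ?mulr1 ?mulr0.
Qed.

Definition block_vec (X : nat -> rat) : 'rV[rat]_n := \sum_(j < r) X j *: delta_mx 0 (rho j).

Lemma sum_blocks (R : pzRingType) (X : nat -> R) J : all (fun j => j < r)%N J -> uniq J ->
  \sum_(j < r) X j * (rho j \in blocks J)%:R = \sum_(j <- J) X j.
Proof.
move=> Jr uJ; rewrite (eq_bigr (fun j : 'I_r => if (j : nat) \in J then X j else 0)); last first.
  by move=> j _; rewrite inE rhoK //; case: (_ \in J); rewrite ?mulr1 ?mulr0.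
rewrite -(big_mkord xpredT (fun j => if j \in J then X j else 0)) -big_mkcond -big_filter.
apply: perm_big; apply: uniq_perm => //; first by rewrite filter_uniq // iota_uniq.
move=> x; rewrite mem_filter mem_index_iota /=.
by case: (boolP (x \in J)) => // /(allP Jr).
Qed.

Lemma dot_block_vec X J : all (fun j => j < r)%N J -> uniq J ->
  dot (subset_form (blocks J)) (block_vec X) = \sum_(j <- J) X j.
Proof.
move=> Jr uJ; rewrite -(sum_blocks X Jr uJ) /block_vec dot_suml; apply: eq_bigr => j _.
by rewrite dotZr dot_subset_delta.
Qed.

Lemma dot_block_point_blocks J : all (fun j => j < r)%N J -> uniq J ->
  dot (subset_form (blocks J)) block_point = (wsum q J)%:~R.
Proof.
move=> Jr uJ; rewrite wsumE dot_block_point (sum_blocks q Jr uJ) [X in _ + X]big1 ?addr0 // => y _.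
rewrite !inE; case: ltnP => [fr|rf]; first by rewrite rhoK // mul1r subrr mulr0.
have -> : (f y \in J) = false by apply/negP => /(allP Jr); rewrite ltnNge rf.
by rewrite mul0r subr0 mulr0.
Qed.

(** [Zs] lists the connected unions of blocks of weight 0, so it bounds the hyperplanes through the
    point. The two hypotheses are boolean and can be decided by computation for a given contracted
    graph. *)
Variable Zs : seq (seq nat).
Hypothesis Zs_ok : all (fun J => [&& all (fun j => j < r)%N J, uniq J, J != [::], buildable e J &
  wsum q J == 0]) Zs.
Hypothesis Zs_all : all (fun J => [|| J == [::], wsum q J != 0, separable e J | has (perm_eq J) Zs])
  (subs (iota 0 r)).

Let A := connected_subgraph_arr E.

Lemma Zs_lt J : J \in Zs -> all (fun j => j < r)%N J.
Proof. by move=> /(allP Zs_ok)/and5P[]. Qed.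

Lemma Zs_uniq J : J \in Zs -> uniq J.
Proof. by move=> /(allP Zs_ok)/and5P[]. Qed.

Lemma Zs_conn J : J \in Zs -> subset_form (blocks J) \in A.
Proof.
move=> JZ; have /and5P[Jr uJ _ bJ _] := allP Zs_ok _ JZ; apply/conn_arrP; exists (blocks J) => //.
exact: buildable_conn.
Qed.

Lemma Zs_dot J : J \in Zs -> dot (subset_form (blocks J)) block_point = 0.
Proof.
move=> JZ; have /and5P[Jr uJ _ _ /eqP w0] := allP Zs_ok _ JZ.
by rewrite dot_block_point_blocks // w0.
Qed.

Lemma zero_Zs a : a \in A -> dot a block_point = 0 -> exists2 J, J \in Zs & a = subset_form (blocks J).
Proof.
case/conn_arrP => I cI -> /block_point_zero; set J := filter _ _ => -[IJ wJ].
have /or4P[/eqP J0|/eqP//|sJ|/hasP[J' J'Z pJ]] := allP Zs_all _ (filter_subs (fun j => rho j \in I) (iota 0 r)).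
- by have [x] := conn_neq0 cI; rewrite IJ /J J0 inE.
- case: (@separable_disconn J) => //; last by rewrite -IJ.
  by apply/allP => j; rewrite mem_filter mem_iota => /andP[_].
- exists J' => //; rewrite IJ; congr subset_form; apply/setP => x.
  by rewrite !inE (perm_mem pJ).
Qed.

Lemma count_Zs : (count (fun a => dot a block_point == 0%R) A <= size Zs)%N.
Proof.
rewrite -size_filter -(size_map (fun J => subset_form (blocks J)) Zs); apply: uniq_leq_size.
  by rewrite filter_uniq // conn_arr_uniq.
move=> a; rewrite mem_filter => /andP[/eqP a0 aA]; have [J JZ ->] := zero_Zs aA a0.
exact: (map_f (fun J => subset_form (blocks J))).
Qed.

(** The direction with value 1 on each block is transversal, because a nonempty union of blocks
    takes its number of blocks as value. *)
Lemma block_dir a : a \in A -> dot a block_point = 0 -> dot a (block_vec (fun=> 1)) != 0.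
Proof.
move=> aA /(zero_Zs aA)[J JZ ->]; have /and5P[Jr uJ nJ _ _] := allP Zs_ok _ JZ.
by rewrite dot_block_vec // big_const_seq count_predT iter_addr_0 pnatr_eq0 size_eq0.
Qed.

(** If the hyperplanes through the point form a circuit, freeness requires [1 + 2 m <= m + 2],
    impossible for [m > 1]. *)
Lemma block_circuit_not_free m (c : nat -> rat) : size Zs = m.+2 -> (1 < m)%N ->
  (forall i, (i < m.+2)%N -> c i != 0) ->
  (forall x, (x < r)%N -> \sum_(i < m.+2) c i * (x \in nth [::] Zs i)%:R = 0) ->
  (forall lam : nat -> rat,
    (forall x, (x < r)%N -> \sum_(i < m.+1) lam i * (x \in nth [::] Zs i)%:R = 0) ->
    forall i, (i < m.+1)%N -> lam i = 0) ->
  ~ free_arr A.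
Proof.
move=> sZ m1 c0 cZ indep fA.
have nZ (i : 'I_m.+2) : nth [::] Zs i \in Zs by rewrite mem_nth // sZ.
pose z (i : 'I_m.+2) := subset_form (blocks (nth [::] Zs i)).
have := circuit_obstruction (@conn_arr0 n E) (conn_arr_uniq E) (@conn_arr_prop n E) block_dir
  (z := z) (c := fun i => c i) _ _ _ _ _ fA.
have -> : (1 + m * 2 <= count (fun a => dot a block_point == 0%R) A)%N = false.
  by apply/negP => /leq_trans /(_ count_Zs); rewrite sZ; lia.
move=> H; suff: false by []; apply: H => [i|i|i||].
- exact: Zs_conn.
- exact: Zs_dot.
- exact: c0.
- apply/rowP => x; rewrite summxE mxE.
  have [xr|xr] := ltnP (f x) r.
    by rewrite -[RHS](cZ _ xr); apply: eq_bigr => i _; rewrite !mxE inE.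
  rewrite big1 // => i _; rewrite !mxE inE.
  have -> : (f x \in nth [::] Zs i) = false; last by rewrite mulr0.
  by apply/negP => /(allP (Zs_lt (nZ i))); rewrite ltnNge xr.
- apply: row_freeE => w; rewrite mulmx_sum_row => w0; apply/rowP => i; rewrite mxE.
  pose lam (k : nat) : rat := if insub k is Some u then w 0 (u : 'I_m.+1) else 0.
  have lamE (k : 'I_m.+1) : lam k = w 0 k by rewrite /lam valK.
  rewrite -lamE; apply: (indep lam) => // x xr.
  have := congr1 (fun M : 'rV_n => M 0 (rho x)) w0.
  rewrite summxE mxE => E0; rewrite -[RHS]E0; apply: eq_bigr => k _.
  by rewrite lamE !mxE inE rhoK // lift_max.
Qed.

Lemma block_vecD X Y s : block_vec X + s *: block_vec Y = block_vec (fun j => X j + s * Y j).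
Proof.
rewrite /block_vec scaler_sumr -big_split /=; apply: eq_bigr => j _.
by rewrite scalerA scalerDl.
Qed.

Lemma eq_block_vec X Y : X =1 Y -> block_vec X = block_vec Y.
Proof. by move=> XY; apply: eq_bigr => j _; rewrite XY. Qed.

Section Coefficients.
Variables (theta : der n) (g : 'rV[rat]_n -> S n) (d : nat).
Hypothesis Hg : forall a, a \in A -> der_app theta a = lin_poly a * g a.

Definition block_coef J x : rat := (line_eval block_point x (g (subset_form (blocks J))))`_d.

Lemma block_syzygy J1 J2 J3 X : J1 \in Zs -> J2 \in Zs -> J3 \in Zs -> perm_eq J3 (J1 ++ J2) ->
  (\sum_(j <- J1) X j) * block_coef J1 (block_vec X) + (\sum_(j <- J2) X j) * block_coef J2 (block_vec X)
  = (\sum_(j <- J3) X j) * block_coef J3 (block_vec X).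
Proof.
move=> Z1 Z2 Z3 p3; rewrite -!dot_block_vec ?Zs_lt ?Zs_uniq //.
have form3 : subset_form (blocks J3) = subset_form (blocks J1) + subset_form (blocks J2).
  have := Zs_uniq Z3; rewrite (perm_uniq p3) cat_uniq => /and3P[_ /hasPn dj _].
  apply/rowP => x; rewrite !mxE !inE (perm_mem p3) mem_cat -natrD; congr (_%:R).
  by have := dj (f x); case: (f x \in J2); case: (f x \in J1) => // /(_ isT).
pose z (i : 'I_3) := [tuple subset_form (blocks J1); subset_form (blocks J2); subset_form (blocks J3)]`_i.
pose c (i : 'I_3) : rat := [tuple 1; 1; - 1]`_i.
have := @syzygy _ A block_point theta g Hg _ c z d (block_vec X).
rewrite !big_ord_recl !big_ord0 /c /z /= => H.
have {}H := H _ _ _; apply/eqP; rewrite -subr_eq0; apply/eqP; rewrite -[RHS]H.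
- by rewrite /block_coef; ring.
- by case=> [[|[|[|]]]] //= _; apply: Zs_conn.
- by case=> [[|[|[|]]]] //= _; apply: Zs_dot.
- by rewrite !scale1r scaleN1r addr0 form3 addrA subrr.
Qed.

Lemma block_coef_line J : line_poly d (block_coef J).
Proof. exact: line_coef_poly. Qed.

(* Two blocks J1, J2 whose union is a zero-sum set agree where the union vanishes. *)
Lemma block_coef_eq J1 J2 J3 X : J1 \in Zs -> J2 \in Zs -> J3 \in Zs -> perm_eq J3 (J1 ++ J2) ->
  \sum_(j <- J3) X j = 0 -> \sum_(j <- J1) X j != 0 ->
  block_coef J1 (block_vec X) = block_coef J2 (block_vec X).
Proof.
move=> Z1 Z2 Z3 p3 s3 s1; have := block_syzygy X Z1 Z2 Z3 p3.
have -> : \sum_(j <- J2) X j = - \sum_(j <- J1) X j.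
  by move: s3; rewrite (perm_big _ p3) big_cat /= => /eqP; rewrite addrC addr_eq0 => /eqP.
by rewrite s3 mul0r mulNr => /eqP; rewrite subr_eq0 => /eqP/(mulfI s1).
Qed.

Lemma block_coef_eq_union J1 J2 J3 X : J1 \in Zs -> J2 \in Zs -> J3 \in Zs -> perm_eq J3 (J1 ++ J2) ->
  \sum_(j <- J2) X j = 0 -> \sum_(j <- J1) X j != 0 ->
  block_coef J1 (block_vec X) = block_coef J3 (block_vec X).
Proof.
move=> Z1 Z2 Z3 p3 s2 s1; have := block_syzygy X Z1 Z2 Z3 p3.
by rewrite (perm_big _ p3) big_cat /= s2 mul0r !addr0 => /(mulfI s1).
Qed.

Definition point4 i j k (a b c h : rat) (m : nat) : rat :=
  if m == i then a else if m == j then b else if m == k then c else h.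

Lemma line_point4 i j k a b c h a' b' c' h' s :
  block_vec (point4 i j k a b c h) + s *: block_vec (point4 i j k a' b' c' h') =
  block_vec (point4 i j k (a + s * a') (b + s * b') (c + s * c') (h + s * h')).
Proof.
rewrite block_vecD; apply: eq_block_vec => m.
by rewrite /point4; case: (m == i); case: (m == j); case: (m == k).
Qed.

(** The syzygies compare coefficients only on special subspaces. A line in a direction [Y] that
    meets these subspaces more than [d] times carries the equality to the point [X] itself. *)
Lemma block_coef_diff_zero J J' X Y (rs : seq rat) : uniq rs -> (d < size rs)%N ->
  {in rs, forall s, block_coef J (block_vec X + s *: block_vec Y) = block_coef J' (block_vec X + s *: block_vec Y)} ->
  block_coef J (block_vec X) = block_coef J' (block_vec X).
Proof.
move=> urs sz H; apply/eqP; rewrite -subr_eq0; apply/eqP.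
have := line_poly_zero (x := block_vec X) (y := block_vec Y) (line_polyB (block_coef_line J) (block_coef_line J')) urs sz _ 0.
rewrite scale0r addr0; apply=> s /H ->.
by rewrite subrr.
Qed.

Section K4.
Hypothesis d4 : (d < 4)%N.
Variables (i j k l : nat) (Jij Jik Jjk Jil Jjl Jjkl Jikl W : seq nat).
Hypotheses (uq : uniq [:: i; j; k; l]).
Hypotheses (Zi : [:: i] \in Zs) (Zj : [:: j] \in Zs) (Zk : [:: k] \in Zs) (Zl : [:: l] \in Zs).
Hypotheses (Zij : Jij \in Zs) (Zik : Jik \in Zs) (Zjk : Jjk \in Zs) (Zil : Jil \in Zs) (Zjl : Jjl \in Zs).
Hypotheses (Zjkl : Jjkl \in Zs) (Zikl : Jikl \in Zs) (ZW : W \in Zs).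
Hypotheses (pij : perm_eq Jij [:: i; j]) (pik : perm_eq Jik [:: i; k]) (pjk : perm_eq Jjk [:: j; k])
  (pil : perm_eq Jil [:: i; l]) (pjl : perm_eq Jjl [:: j; l])
  (pjkl : perm_eq Jjkl [:: j; k; l]) (pikl : perm_eq Jikl [:: i; k; l])
  (pW : perm_eq W [:: i; j; k; l]).

Lemma point4E a b c h : [/\ point4 i j k a b c h i = a, point4 i j k a b c h j = b,
  point4 i j k a b c h k = c & point4 i j k a b c h l = h].
Proof.
move: uq; rewrite /= !inE !negb_or !andbT => /and3P[/and3P[ij ik il] /andP[jk jl] kl].
rewrite /point4 !eqxx; split=> //.
- by rewrite eq_sym (negbTE ij).
- by rewrite eq_sym (negbTE ik) eq_sym (negbTE jk).
- by rewrite eq_sym (negbTE il) eq_sym (negbTE jl) eq_sym (negbTE kl).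
Qed.

Let F J a b c h := block_coef J (block_vec (point4 i j k a b c h)).

Lemma K4_opposite_ij a c h : a != 0 -> F [:: i] a (- a) c h = F [:: j] a (- a) c h.
Proof.
move=> a0; have [ei ej ek el] := point4E a (- a) c h.
apply: (block_coef_eq Zi Zj Zij pij); rewrite ?(perm_big _ pij) /= !big_cons big_nil ?ei ?ej ?addr0 //.
by rewrite subrr.
Qed.

Lemma K4_opposite_k a h : a != 0 -> F [:: i] a a (- a) h = F [:: j] a a (- a) h.
Proof.
move=> a0; have [ei ej ek el] := point4E a a (- a) h.
transitivity (F [:: k] a a (- a) h).
  apply: (block_coef_eq Zi Zk Zik pik); rewrite ?(perm_big _ pik) /= !big_cons big_nil ?ei ?ek ?addr0 //.
  by rewrite subrr.
symmetry; apply: (block_coef_eq Zj Zk Zjk pjk); rewrite ?(perm_big _ pjk) /= !big_cons big_nil ?ej ?ek ?addr0 //.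
by rewrite subrr.
Qed.

Lemma K4_opposite_l a c : a != 0 -> F [:: i] a a c (- a) = F [:: j] a a c (- a).
Proof.
move=> a0; have [ei ej ek el] := point4E a a c (- a).
transitivity (F [:: l] a a c (- a)).
  apply: (block_coef_eq Zi Zl Zil pil); rewrite ?(perm_big _ pil) /= !big_cons big_nil ?ei ?el ?addr0 //.
  by rewrite subrr.
symmetry; apply: (block_coef_eq Zj Zl Zjl pjl); rewrite ?(perm_big _ pjl) /= !big_cons big_nil ?ej ?el ?addr0 //.
by rewrite subrr.
Qed.

Lemma K4_opposite_sum a c h : a != 0 -> a + c + h = 0 -> F [:: i] a a c h = F [:: j] a a c h.
Proof.
move=> a0 s0; have [ei ej ek el] := point4E a a c h.
transitivity (F W a a c h).
  apply: (block_coef_eq_union (J2 := Jjkl) Zi Zjkl ZW).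
  - by apply: (perm_trans pW); rewrite perm_cons perm_sym.
  - by rewrite (perm_big _ pjkl) /= !big_cons big_nil ej ek el addr0 addrA.
  - by rewrite big_seq1 ei.
symmetry; apply: (block_coef_eq_union (J2 := Jikl) Zj Zikl ZW).
- apply: (perm_trans pW); rewrite (perm_catCA [:: i] [:: j] [:: k; l]) perm_cons perm_sym; exact: pikl.
- by rewrite (perm_big _ pikl) /= !big_cons big_nil ei ek el addr0 addrA.
- by rewrite big_seq1 ej.
Qed.

(** The difference has degree at most 3 on a line. The points [(1 - s, 1 - s, 1, 1 + 3 s)] satisfy
    [x_k = - x_i] for [s = 2], [x_i + x_j = 0] for [s = 1], [x_l = - x_i] for [s = -1] and
    [x_i + x_k + x_l = 0] for [s = -3/2]. *)
Lemma K4_agree : F [:: i] 1 1 1 1 = F [:: j] 1 1 1 1.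
Proof.
apply: (@block_coef_diff_zero _ _ _ (point4 i j k (- 1) (- 1) 0 3) [:: 2; 1; - 1; - (3 / 2)]) => //.
move=> s; rewrite !inE line_point4 => /or4P[] /eqP ->.
- have -> : 1 + 2 * 0 = - (1 + 2 * -1) :> rat by lra.
  by apply: K4_opposite_k.
(* At [(0, 0, 1, 4)] the syzygy cannot be divided by [x_i = 0]; this point is reached along a second
   line [(t, -t, 1, 4)]. *)
- have -> : 1 + 1 * -1 = 0 :> rat by lra.
  have := @block_coef_diff_zero [:: i] [:: j] (point4 i j k 0 0 (1 + 1 * 0) (1 + 1 * 3))
    (point4 i j k 1 (- 1) 0 0) [:: 1; 2; 3; 4].
  apply=> // t; rewrite !inE line_point4 => t14.
  have -> : 0 + t * -1 = - (0 + t * 1) by lra.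
  by apply: K4_opposite_ij; case/or4P: t14 => /eqP ->.
- have -> : 1 + -1 * 3 = - (1 + -1 * -1) :> rat by lra.
  by apply: K4_opposite_l.
- by apply: K4_opposite_sum.
Qed.
End K4.

Section Diamond.
Hypothesis d2 : (d < 2)%N.
Variables (i j k l : nat) (Jij Jikl Jjkl W : seq nat).
Hypotheses (uq : uniq [:: i; j; k; l]).
Hypotheses (Zi : [:: i] \in Zs) (Zj : [:: j] \in Zs) (Zij : Jij \in Zs).
Hypotheses (Zjkl : Jjkl \in Zs) (Zikl : Jikl \in Zs) (ZW : W \in Zs).
Hypotheses (pij : perm_eq Jij [:: i; j])
  (pjkl : perm_eq Jjkl [:: j; k; l]) (pikl : perm_eq Jikl [:: i; k; l])
  (pW : perm_eq W [:: i; j; k; l]).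

Let F J a b c h := block_coef J (block_vec (point4 i j k a b c h)).

(** Two points of the line [(1, 1 - 2 s, 1 - 3 s, 1)] suffice in degree at most 1: for [s = 3/5] one
    has [x_j + x_k + x_l = 0], and for [s = 1] both [x_i + x_j] and [x_i + x_k + x_l] vanish, so
    that [j] links [i] to [W]. *)
Lemma diamond_agree : F [:: i] 1 1 1 1 = F W 1 1 1 1.
Proof.
have key a b c h : a != 0 -> b + c + h = 0 -> F [:: i] a b c h = F W a b c h.
  move=> a0 s0; have [ei ej ek el] := point4E uq a b c h.
  apply: (block_coef_eq_union (J2 := Jjkl) Zi Zjkl ZW).
  - by apply: (perm_trans pW); rewrite perm_cons perm_sym.
  - by rewrite (perm_big _ pjkl) /= !big_cons big_nil ej ek el addr0 addrA.
  - by rewrite big_seq1 ei.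
apply: (@block_coef_diff_zero _ _ _ (point4 i j k 0 (- 2) (- 3) 0) [:: 3 / 5; 1]) => //.
move=> s; rewrite !inE line_point4 => /orP[] /eqP ->; first by apply: key.
have [ei ej ek el] := point4E uq (1 + 1 * 0) (1 + 1 * -2) (1 + 1 * -3) (1 + 1 * 0).
transitivity (F [:: j] (1 + 1 * 0) (1 + 1 * -2) (1 + 1 * -3) (1 + 1 * 0)).
  by apply: (block_coef_eq Zi Zj Zij pij); rewrite ?(perm_big _ pij) /= !big_cons big_nil ?ei ?ej.
apply: (block_coef_eq_union (J2 := Jikl) Zj Zikl ZW).
- apply: (perm_trans pW); rewrite (perm_catCA [:: i] [:: j] [:: k; l]) perm_cons perm_sym; exact: pikl.
- by rewrite (perm_big _ pikl) /= !big_cons big_nil ei ek el.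
- by rewrite big_seq1 ej.
Qed.
End Diamond.
End Coefficients.

Lemma point4_1 i j k : block_vec (point4 i j k 1 1 1 1) = block_vec (fun=> 1).
Proof.
by apply: eq_block_vec => m; rewrite /point4; case: (m == i); case: (m == j); case: (m == k).
Qed.

(** All 15 unions of blocks have weight 0, whereas agreement to order 4 of four independent forms
    would need [1 + 3 * 5 = 16] hyperplanes. *)
Lemma block_K4_not_free : r = 4%N ->
  Zs = [:: [:: 0%N]; [:: 1%N]; [:: 2%N]; [:: 3%N]; [:: 0; 1]%N; [:: 0; 2]%N; [:: 0; 3]%N;
    [:: 1; 2]%N; [:: 1; 3]%N; [:: 2; 3]%N; [:: 0; 1; 2]%N; [:: 0; 1; 3]%N; [:: 0; 2; 3]%N;
    [:: 1; 2; 3]%N; [:: 0; 1; 2; 3]%N] -> ~ free_arr A.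
Proof.
move=> r4 ZE fA; pose z (i : 'I_4) := subset_form (blocks [:: i : nat]).
have iZ (i : 'I_4) : [:: i : nat] \in Zs by rewrite ZE; case: i => [[|[|[|[|]]]]].
have := @free_obstruction n A (@conn_arr0 n E) (conn_arr_uniq E) (@conn_arr_prop n E) _ _ block_dir 3 4 z.
have -> : (1 + 3 * 5 <= count (fun a => dot a block_point == 0%R) A)%N = false.
  by apply/negP => /leq_trans /(_ count_Zs); rewrite ZE.
move=> H; suff: false by []; apply: H => // [i|i||theta g Hg i].
- exact: Zs_conn.
- exact: Zs_dot.
- apply: row_freeE => w; rewrite mulmx_sum_row => w0; apply/rowP => i; rewrite mxE.
  have := congr1 (fun M : 'rV_n => M 0 (rho i)) w0; rewrite summxE mxE => E0; rewrite -[RHS]E0.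
  rewrite (bigD1 i) //= rowK !mxE !inE rhoK ?r4 // eqxx mulr1 big1 ?addr0 // => j ne.
  by rewrite rowK !mxE !inE rhoK ?r4 // val_eqE eq_sym (negbTE ne) mulr0.
apply: poly_agree => d d4.
have mZ J : J \in Zs = (J \in [:: [:: 0%N]; [:: 1%N]; [:: 2%N]; [:: 3%N]; [:: 0; 1]%N; [:: 0; 2]%N;
  [:: 0; 3]%N; [:: 1; 2]%N; [:: 1; 3]%N; [:: 2; 3]%N; [:: 0; 1; 2]%N; [:: 0; 1; 3]%N;
  [:: 0; 2; 3]%N; [:: 1; 2; 3]%N; [:: 0; 1; 2; 3]%N]) by rewrite ZE.
have K1 := @K4_agree _ _ _ Hg d4 1 0 2 3 [:: 0; 1]%N [:: 1; 2]%N [:: 0; 2]%N [:: 1; 3]%N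
    [:: 0; 3]%N [:: 0; 2; 3]%N [:: 1; 2; 3]%N [:: 0; 1; 2; 3]%N.
have K2 := @K4_agree _ _ _ Hg d4 2 0 1 3 [:: 0; 2]%N [:: 1; 2]%N [:: 0; 1]%N [:: 2; 3]%N
    [:: 0; 3]%N [:: 0; 1; 3]%N [:: 1; 2; 3]%N [:: 0; 1; 2; 3]%N.
have K3 := @K4_agree _ _ _ Hg d4 3 0 1 2 [:: 0; 3]%N [:: 1; 3]%N [:: 0; 1]%N [:: 2; 3]%N
    [:: 0; 2]%N [:: 0; 1; 2]%N [:: 1; 2; 3]%N [:: 0; 1; 2; 3]%N.
rewrite point4_1 !mZ in K1; rewrite point4_1 !mZ in K2; rewrite point4_1 !mZ in K3.
by case: i => [[|[|[|[|]]]]] //= i4; [apply: K1 | apply: K2 | apply: K3].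
Qed.

(** Agreement to order 2 of three independent forms would need [1 + 2 * 3 = 7] hyperplanes, and
    there are 6. *)
Lemma block_diamond_not_free : r = 4%N ->
  Zs = [:: [:: 0%N]; [:: 1%N]; [:: 0; 1]%N; [:: 2; 3; 0]%N; [:: 2; 3; 1]%N; [:: 2; 3; 0; 1]%N] ->
  ~ free_arr A.
Proof.
move=> r4 ZE fA; pose J (i : 'I_3) : seq nat := nth [::] [:: [:: 2; 3; 0; 1]; [:: 0]; [:: 1]]%N i.
pose z (i : 'I_3) := subset_form (blocks (J i)).
have JZ (i : 'I_3) : J i \in Zs by rewrite ZE; case: i => [[|[|[|]]]].
have := @free_obstruction n A (@conn_arr0 n E) (conn_arr_uniq E) (@conn_arr_prop n E) _ _ block_dir 2 2 z.
have -> : (1 + 2 * 3 <= count (fun a => dot a block_point == 0%R) A)%N = false.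
  by apply/negP => /leq_trans /(_ count_Zs); rewrite ZE.
move=> H; suff: false by []; apply: H => // [i|i||theta g Hg i].
- exact: Zs_conn.
- exact: Zs_dot.
- apply: row_freeE => w; rewrite mulmx_sum_row => w0.
  have key x : (x < 4)%N -> \sum_(i < 3) w 0 i * (x \in J i)%:R = 0.
    move=> x4; have := congr1 (fun M : 'rV_n => M 0 (rho x)) w0; rewrite summxE mxE => E0.
    by rewrite -[RHS]E0; apply: eq_bigr => k _; rewrite !mxE inE rhoK ?r4.
  have k2 := key 2%N isT; have k0 := key 0%N isT; have k1 := key 1%N isT.
  move: k0 k1 k2; rewrite !big_ord_recl !big_ord0 /= !mulr0 !mulr1 !addr0 => k0 k1 k2.
  rewrite k2 !add0r in k0 k1.
  apply/rowP => -[[|[|[|]]]] // i; rewrite mxE.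
  + by rewrite -[RHS]k2; congr (w 0 _); apply: val_inj.
  + by rewrite -[RHS]k0; congr (w 0 _); apply: val_inj.
  + by rewrite -[RHS]k1; congr (w 0 _); apply: val_inj.
apply: poly_agree => d d2.
have mZ J' : J' \in Zs = (J' \in [:: [:: 0%N]; [:: 1%N]; [:: 0; 1]%N; [:: 2; 3; 0]%N; [:: 2; 3; 1]%N;
  [:: 2; 3; 0; 1]%N]) by rewrite ZE.
have K1 := @diamond_agree _ _ _ Hg d2 0 1 2 3 [:: 0; 1]%N [:: 2; 3; 0]%N [:: 2; 3; 1]%N [:: 2; 3; 0; 1]%N.
have K2 := @diamond_agree _ _ _ Hg d2 1 0 2 3 [:: 0; 1]%N [:: 2; 3; 1]%N [:: 2; 3; 0]%N [:: 2; 3; 0; 1]%N.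
rewrite point4_1 !mZ in K1; rewrite point4_1 !mZ in K2.
by case: i => [[|[|[|]]]] //= i4; [apply: K1 | apply: K2].
Qed.
End Blocks.

(** * Forbidden contractions *)

Definition edge_rel (es : seq (nat * nat)) : rel nat := fun i j => ((i, j) \in es) || ((j, i) \in es).

(** Labels from [r] on mark the deleted vertices, so the contracted graph has exactly the blocks
    [0, ..., r - 1]. *)
Definition contracts_to n (E : rel 'I_n) (r : nat) (f : 'I_n -> nat) (es : seq (nat * nat)) : Prop :=
  [/\ exists rho : nat -> 'I_n, forall j, (j < r)%N -> f (rho j) = j,
      forall j, (j < r)%N -> induced_connected E [set x | f x == j],
      forall x y, (f x < r)%N -> (f y < r)%N -> f x != f y -> E x y -> edge_rel es (f x) (f y) &
      forall i j, (i < r)%N -> (j < r)%N -> i != j -> edge_rel es i j ->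
        exists x y, [/\ f x = i, f y = j & E x y]].

Section Obstructions.
Variables (n : nat) (E : rel 'I_n) (f : 'I_n -> nat).
Hypothesis symE : ssrbool.symmetric E.

(* [p] gives the values on the blocks of the point of the obstruction, [Zs] the connected unions of
   blocks whose forms vanish there, [c] the only linear relation between these forms. *)
Ltac circuit_obstructs p Zs rk c :=
  case; case;
  let rho := fresh in let rhoK := fresh in let bc := fresh in let be := fresh in let eb := fresh in
  move=> rho rhoK bc be eb;
  apply: (@block_circuit_not_free n E _ f _ rho symE rhoK bc be eb (nth 0 p) Zs _ _ rk (nth 0 c));
  [by vm_compute | by vm_compute | by [] | by [] | by do 7?(case=> //)
  | by do 8?(case=> [|]; first by move=> _; rewrite !big_ord_recl big_ord0 /=; lra)
  | let lam := fresh in let H := fresh in move=> lam H;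
    let eval_at k := try (let h := fresh in have h := H k isT; rewrite !big_ord_recl !big_ord0 /= in h) in
    eval_at 0%N; eval_at 1%N; eval_at 2%N; eval_at 3%N; eval_at 4%N; eval_at 5%N; eval_at 6%N;
    by do 7?(case=> [|]; first by move=> _; lra)].

Lemma K14_not_free : contracts_to E 5 f [:: (0, 1); (0, 2); (0, 3); (0, 4)]%N ->
  ~ free_arr (connected_subgraph_arr E).
Proof.
circuit_obstructs ([:: 0; 1; -1; 2; -2] : seq int)
  [:: [:: 0]; [:: 1; 2; 0]; [:: 3; 4; 0]; [:: 1; 2; 3; 4; 0]]%N
  2%N ([:: 1; -1; -1; 1] : seq rat).
Qed.

(** Opposite weights are placed on non-adjacent blocks, as an adjacent pair would be one more
    connected set of weight 0. *)
Lemma cricket_not_free : contracts_to E 5 f [:: (0, 1); (0, 2); (1, 2); (0, 3); (0, 4)]%N ->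
  ~ free_arr (connected_subgraph_arr E).
Proof.
circuit_obstructs ([:: 0; 1; 2; -1; -2] : seq int)
  [:: [:: 0]; [:: 1; 3; 0]; [:: 2; 4; 0]; [:: 1; 2; 3; 4; 0]]%N
  2%N ([:: 1; -1; -1; 1] : seq rat).
Qed.

Lemma butterfly_not_free : contracts_to E 5 f [:: (0, 1); (0, 2); (1, 2); (0, 3); (0, 4); (3, 4)]%N ->
  ~ free_arr (connected_subgraph_arr E).
Proof.
circuit_obstructs ([:: 0; 1; 2; -1; -2] : seq int)
  [:: [:: 0]; [:: 1; 3; 0]; [:: 2; 4; 0]; [:: 1; 2; 3; 4; 0]]%N
  2%N ([:: 1; -1; -1; 1] : seq rat).
Qed.

(** The relation comes from exchanging 1 and 3, of equal weight, once beside 0 alone and once beside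
    0, 2 and 4. *)
Lemma pan_not_free : contracts_to E 5 f [:: (0, 1); (1, 2); (2, 3); (3, 0); (0, 4)]%N ->
  ~ free_arr (connected_subgraph_arr E).
Proof.
circuit_obstructs ([:: -1; 1; 5; 1; -5] : seq int)
  [:: [:: 1; 0]; [:: 3; 0]; [:: 4; 2; 1; 0]; [:: 4; 2; 3; 0]]%N
  2%N ([:: 1; -1; -1; 1] : seq rat).
Qed.

Lemma net_not_free : contracts_to E 6 f [:: (0, 1); (0, 2); (1, 2); (0, 3); (1, 4); (2, 5)]%N ->
  ~ free_arr (connected_subgraph_arr E).
Proof.
circuit_obstructs ([:: 1; -1; 10; -11; -10; 1] : seq int)
  [:: [:: 1; 0]; [:: 3; 2; 0]; [:: 4; 2; 1; 0]; [:: 5; 3; 2; 1; 0]; [:: 5; 4; 2; 1]]%N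
  3%N ([:: 1; 1; -1; -1; 1] : seq rat).
Qed.

Lemma spider_not_free : contracts_to E 7 f [:: (0, 1); (0, 2); (0, 3); (1, 4); (2, 5); (3, 6)]%N ->
  ~ free_arr (connected_subgraph_arr E).
Proof.
circuit_obstructs ([:: -12; 1; 1; 11; 10; 10; -10] : seq int)
  [:: [:: 3; 1; 0]; [:: 3; 2; 0]; [:: 4; 2; 1; 0]; [:: 5; 1; 2; 0]; [:: 6; 4; 3; 1; 0]; [:: 6; 5; 3; 2; 0]]%N
  4%N ([:: 1; -1; 1; -1; -1; 1] : seq rat).
Qed.

Lemma K4_not_free : contracts_to E 4 f [:: (0, 1); (0, 2); (0, 3); (1, 2); (1, 3); (2, 3)]%N ->
  ~ free_arr (connected_subgraph_arr E).
Proof.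
move=> [[rho rhoK] bc be eb].
by apply: (@block_K4_not_free n E _ f _ rho symE rhoK bc be eb (fun=> 0) _ _ _ erefl erefl); vm_compute.
Qed.

Lemma diamond_not_free : contracts_to E 4 f [:: (0, 1); (0, 2); (0, 3); (1, 2); (1, 3)]%N ->
  ~ free_arr (connected_subgraph_arr E).
Proof.
move=> [[rho rhoK] bc be eb].
by apply: (@block_diamond_not_free n E _ f _ rho symE rhoK bc be eb (nth 0 [:: 0; 0; 1; -1]) _ _ _ erefl erefl);
  vm_compute.
Qed.
End Obstructions.

(** * Classification of the components *)

Section Intervals.
Variables (n : nat) (E : rel 'I_n) (M : nat) (p : nat -> 'I_n) (e : rel nat).
Hypothesis symE : ssrbool.symmetric E.
Hypothesis pI : forall c d, (c < M)%N -> (d < M)%N -> p c = p d -> c = d.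
Hypothesis pE : forall c d, (c < M)%N -> (d < M)%N -> E (p c) (p d) = e c d.

Definition in_itv (c : nat) (ab : nat * nat) : bool := (ab.1 <= c <= ab.2)%N.

Definition itv_label (bs : seq (nat * nat)) (x : 'I_n) : nat :=
  if [pick c : 'I_M | p c == x] is Some c then find (in_itv c) bs else size bs.

(** A certificate for a contraction: [bs] holds the blocks as intervals of codes, [es] the edges of
    the contracted graph, and [ws] an adjacent pair of codes realising each edge. *)
Lemma itv_contracts bs es ws :
  (forall i, (i < size bs)%N -> let I := nth (0, 0)%N bs i in
     (I.1 <= I.2 < M)%N /\ forall c, (I.1 <= c < I.2)%N -> e c c.+1) ->
  (forall i j, (i < j < size bs)%N -> let I := nth (0, 0)%N bs i in let J := nth (0, 0)%N bs j in
     ((I.2 < J.1) || (J.2 < I.1))%N /\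
     (edge_rel es i j \/ forall c d, in_itv c I -> in_itv d J -> ~~ e c d)) ->
  all2 (fun ij cd => [&& in_itv cd.1 (nth (0, 0)%N bs ij.1), in_itv cd.2 (nth (0, 0)%N bs ij.2) & e cd.1 cd.2]) es ws ->
  contracts_to E (size bs) (itv_label bs) es.
Proof.
move=> Hb Hs Hw.
have lab c i : (i < size bs)%N -> in_itv c (nth (0, 0)%N bs i) -> itv_label bs (p c) = i.
  move=> ib ci; have cM : (c < M)%N by have := Hb i ib; move: ci; rewrite /in_itv /= => ? [] ? _; lia.
  rewrite /itv_label; case: pickP => [c' /eqP pc|/(_ (Ordinal cM))]; last by rewrite /= eqxx.
  have -> : c' = c :> nat by apply: pI.
  have hc : has (in_itv c) bs by apply/(has_nthP (0, 0)%N); exists i.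
  have fl := hc; rewrite has_find in fl; have fi := nth_find (0, 0)%N hc.
  apply/eqP; apply: contraT; rewrite neq_ltn => /orP[lt|lt].
    have [|+ _] := Hs (find (in_itv c) bs) i; first by rewrite lt.
    by move: fi ci; rewrite /in_itv /= => ? ? ?; lia.
  have [|+ _] := Hs i (find (in_itv c) bs); first by rewrite lt.
  by move: fi ci; rewrite /in_itv /= => ? ? ?; lia.
have labP x : (itv_label bs x < size bs)%N -> exists c, [/\ p c = x, (c < M)%N & in_itv c (nth (0, 0)%N bs (itv_label bs x))].
  rewrite /itv_label; case: pickP => [c /eqP pc lt|_]; last by rewrite ltnn.
  by exists c; split=> //; apply: nth_find; rewrite has_find.
split.
- exists (fun j => p (nth (0, 0)%N bs j).1) => j js; apply: (lab _ _ js).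
  by have [] := Hb j js; rewrite /in_itv /=; lia.
- move=> j js; have [/= lM st] := Hb j js.
  set I := nth _ bs j in lM st.
  have -> : [set x | itv_label bs x == j] = [set p c | c : 'I_M & in_itv c I].
    apply/setP => x; rewrite inE; apply/eqP/imsetP => [lx|[c cI ->]]; last by apply: lab => //; move: cI; rewrite inE.
    have [|c [pc cM ci]] := labP x; first by rewrite lx.
    by exists (Ordinal cM) => //; rewrite inE /= /I -lx.
  have key k : (I.1 + k <= I.2)%N -> induced_connected E [set p c | c : 'I_M & in_itv c (I.1, I.1 + k)%N].
    elim: k => [|k IH] le.
      have -> : [set p c | c : 'I_M & in_itv c (I.1, I.1 + 0)%N] = [set p I.1]; last exact: conn1.
      have IM : (I.1 < M)%N by lia.
      apply/setP => x; rewrite inE; apply/imsetP/eqP => [[c + ->]|->].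
        by rewrite inE /in_itv /= => ?; congr p; lia.
      by exists (Ordinal IM) => //; rewrite inE /in_itv /=; lia.
    have IM : ((I.1 + k).+1 < M)%N by lia.
    have IM' : ((I.1 + k) < M)%N by lia.
    have -> : [set p c | c : 'I_M & in_itv c (I.1, I.1 + k.+1)%N] =
              [set p c | c : 'I_M & in_itv c (I.1, I.1 + k)%N] :|: [set p (I.1 + k).+1].
      apply/setP => x; rewrite in_setU in_set1; apply/imsetP/orP => [[c + ->]|[/imsetP[c + ->]|/eqP ->]].
      - rewrite inE /in_itv /= => cI; case: (leqP c (I.1 + k)) => ck; [left|right].
          by apply/imsetP; exists c => //; rewrite inE /in_itv /=; lia.
        by apply/eqP; congr p; lia.
      - by rewrite inE /in_itv /= => cI; exists c => //; rewrite inE /in_itv /=; lia.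
      - by exists (Ordinal IM) => //; rewrite inE /in_itv /=; lia.
    apply: (conn_union symE (IH _) (conn1 E _)); first by lia.
    + by apply/imsetP; exists (Ordinal IM') => //; rewrite inE /in_itv /=; lia.
    + by rewrite inE.
    + by rewrite /= pE // st //; lia.
  have := key (I.2 - I.1)%N; rewrite subnKC; last by lia.
  by case: (I) => a b; apply; lia.
- move=> x y lx ly ne exy.
  have [c [pc cM ci]] := labP x lx; have [d [pd dM di]] := labP y ly.
  move: exy; rewrite -pc -pd pE // => ecd.
  move: ne; rewrite neq_ltn => /orP[lt|lt].
    have [|_ [es_|/(_ c d ci di)]] := Hs (itv_label bs x) (itv_label bs y); first by rewrite lt.
      by rewrite pc pd.
    by rewrite ecd.
  have [|_ [es_|/(_ d c di ci)]] := Hs (itv_label bs y) (itv_label bs x); first by rewrite lt.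
    by move: es_; rewrite /edge_rel pc pd orbC.
  by rewrite -pE // symE pE // ecd.
- have wit i j : (i, j) \in es -> (i < size bs)%N -> (j < size bs)%N -> exists x y, [/\ itv_label bs x = i, itv_label bs y = j & E x y].
    move=> ijes ib jb; elim: es ws Hw ijes {Hs} => [|ij es IH] [|cd ws] //= /andP[w Hw].
    rewrite in_cons => /orP[/eqP ijE|]; last exact: IH Hw.
    move: w; rewrite -ijE /= => /and3P[ci dj ecd]; exists (p cd.1), (p cd.2); split; [exact: lab|exact: lab|].
    have := Hb i ib; have := Hb j jb; move: ci dj; rewrite /in_itv /= => ? ? [] ? _ [] ? _; rewrite pE //; lia.
  move=> i j ib jb _ /orP[]; first by move/wit => /(_ ib jb).
  by move/wit => /(_ jb ib)[x [y [lx ly exy]]]; exists y, x; rewrite symE.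
Qed.
End Intervals.

(** * Vertices attached to an induced path *)

Section Classification.
Variables (n : nat) (E : rel 'I_n).
Hypothesis symE : ssrbool.symmetric E.
Hypothesis irrE : ssrbool.irreflexive E.
Hypothesis freeE : free_arr (connected_subgraph_arr E).

Definition ipath (m : nat) (p : nat -> 'I_n) : Prop :=
  (forall c d, (c < m)%N -> (d < m)%N -> p c = p d -> c = d) /\
  (forall c d, (c < m)%N -> (d < m)%N -> E (p c) (p d) = (c.+1 == d) || (d.+1 == c)).

Definition offpath (m : nat) (p : nat -> 'I_n) (v : 'I_n) : Prop := forall c, (c < m)%N -> v != p c.

Definition nbrs (m : nat) (p : nat -> 'I_n) (v : 'I_n) (nv : pred nat) : Prop :=
  forall c, (c < m)%N -> E v (p c) = nv c.

(* Numbers code the vertices: c < m stands for p c, m for v and m + 1 for w. All the blocks of the case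
   analysis are then intervals of codes. *)
Definition ext_rel (m : nat) (nv nw : pred nat) (vw : bool) : rel nat :=
  fun c d => [|| [&& c < m, d < m & (c.+1 == d) || (d.+1 == c)],
                 [&& c == m, d < m & nv d], [&& d == m, c < m & nv c],
                 [&& c == m.+1, d < m & nw d], [&& d == m.+1, c < m & nw c],
                 [&& c == m, d == m.+1 & vw] | [&& d == m, c == m.+1 & vw]]%N.

Definition ext (m : nat) (p : nat -> 'I_n) (v w : 'I_n) : nat -> 'I_n :=
  fun c => if (c < m)%N then p c else if c == m then v else w.

Lemma ext_lt m p v w c : (c < m)%N -> ext m p v w c = p c.
Proof. by rewrite /ext => ->. Qed.
Lemma ext_m m p v w : ext m p v w m = v.
Proof. by rewrite /ext ltnn eqxx. Qed.
Lemma ext_m1 m p v w : ext m p v w m.+1 = w.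
Proof. by rewrite /ext ltnNge leqnSn /= gtn_eqF. Qed.

Lemma ext_ind m (P : nat -> Prop) : (forall c, (c < m)%N -> P c) -> P m -> P m.+1 -> forall c, (c < m.+2)%N -> P c.
Proof.
move=> H0 H1 H2 c cm; case: (ltnP c m) => cm'; first exact: H0.
by case: (eqVneq c m) => [->//|ne]; have -> : c = m.+1 by lia.
Qed.

Lemma ext_inj m p v w : ipath m p -> offpath m p v -> offpath m p w -> v != w ->
  forall c, (c < m.+2)%N -> forall d, (d < m.+2)%N -> ext m p v w c = ext m p v w d -> c = d.
Proof.
move=> [pI _] ov ow vw; apply: ext_ind => [c cm||]; rewrite ?ext_m ?ext_m1.
- apply: ext_ind => [d dm||]; rewrite ?ext_m ?ext_m1 !ext_lt //; first exact: pI.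
    by move=> pc; move: (ov c cm); rewrite pc eqxx.
  by move=> pc; move: (ow c cm); rewrite pc eqxx.
- apply: ext_ind => [d dm|//|]; rewrite ?ext_m1 ?ext_lt //.
    by move=> pc; move: (ov d dm); rewrite pc eqxx.
  by move=> E0; rewrite E0 eqxx in vw.
apply: ext_ind => [d dm||//]; rewrite ?ext_m ?ext_lt //.
  by move=> pc; move: (ow d dm); rewrite pc eqxx.
by move=> E0; rewrite E0 eqxx in vw.
Qed.

Lemma ext_edge m p v w nv nw : ipath m p -> nbrs m p v nv -> nbrs m p w nw ->
  forall c, (c < m.+2)%N -> forall d, (d < m.+2)%N ->
    E (ext m p v w c) (ext m p v w d) = ext_rel m nv nw (E v w) c d.
Proof.
move=> [_ pE] nv_ nw_; apply: ext_ind => [c cm||].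
- apply: ext_ind => [d dm||]; rewrite ?ext_m ?ext_m1 !ext_lt // /ext_rel.
  + by rewrite pE //; lia.
  + by rewrite symE nv_ //; lia.
  + by rewrite symE nw_ //; lia.
- apply: ext_ind => [d dm||]; rewrite ?ext_m ?ext_m1 ?ext_lt // /ext_rel.
  + by rewrite nv_ //; lia.
  + by rewrite irrE; lia.
  + by case: (E v w); lia.
apply: ext_ind => [d dm||]; rewrite ?ext_m ?ext_m1 ?ext_lt // /ext_rel.
  + by rewrite nw_ //; lia.
  + by rewrite symE; case: (E v w); lia.
  + by rewrite irrE; lia.
Qed.

Lemma itv_contracts1 m p v nv bs es ws : ipath m p -> offpath m p v -> nbrs m p v nv ->
  let e := ext_rel m nv pred0 false in
  (forall i, (i < size bs)%N -> let I := nth (0, 0)%N bs i in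
     (I.1 <= I.2 < m.+1)%N /\ forall c, (I.1 <= c < I.2)%N -> e c c.+1) ->
  (forall i j, (i < j < size bs)%N -> let I := nth (0, 0)%N bs i in let J := nth (0, 0)%N bs j in
     ((I.2 < J.1) || (J.2 < I.1))%N /\
     (edge_rel es i j \/ forall c d, in_itv c I -> in_itv d J -> ~~ e c d)) ->
  all2 (fun ij cd => [&& in_itv cd.1 (nth (0, 0)%N bs ij.1), in_itv cd.2 (nth (0, 0)%N bs ij.2) & e cd.1 cd.2]) es ws ->
  exists f, contracts_to E (size bs) f es.
Proof.
move=> ip ov nv_ e Hb Hs Hw; exists (itv_label m.+1 (ext m p v v) bs); apply: (@itv_contracts n E m.+1 (ext m p v v) e symE _ _ bs es ws) => //.
  have aux c : (c < m.+1)%N -> (c < m)%N \/ c = m by lia.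
  have [pI _] := ip.
  move=> c d /aux[cm|->] /aux[dm|->]; rewrite ?ext_m ?ext_lt //; first exact: pI.
    by move=> pc; move: (ov c cm); rewrite pc eqxx.
  by move=> pc; move: (ov d dm); rewrite pc eqxx.
move=> c d cm dm; rewrite (ext_edge ip nv_ nv_) 1?ltnW // irrE /e /ext_rel; lia.
Qed.

Lemma itv_contracts2 m p v w nv nw vw bs es ws : ipath m p -> offpath m p v -> offpath m p w -> v != w ->
  nbrs m p v nv -> nbrs m p w nw -> E v w = vw ->
  let e := ext_rel m nv nw vw in
  (forall i, (i < size bs)%N -> let I := nth (0, 0)%N bs i in
     (I.1 <= I.2 < m.+2)%N /\ forall c, (I.1 <= c < I.2)%N -> e c c.+1) ->
  (forall i j, (i < j < size bs)%N -> let I := nth (0, 0)%N bs i in let J := nth (0, 0)%N bs j in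
     ((I.2 < J.1) || (J.2 < I.1))%N /\
     (edge_rel es i j \/ forall c d, in_itv c I -> in_itv d J -> ~~ e c d)) ->
  all2 (fun ij cd => [&& in_itv cd.1 (nth (0, 0)%N bs ij.1), in_itv cd.2 (nth (0, 0)%N bs ij.2) & e cd.1 cd.2]) es ws ->
  exists f, contracts_to E (size bs) f es.
Proof.
move=> ip ov ow vw_ nv_ nw_ eE e Hb Hs Hw; exists (itv_label m.+2 (ext m p v w) bs).
apply: (@itv_contracts n E m.+2 (ext m p v w) e symE _ _ bs es ws) => //; first by move=> c d cm dm; exact: ext_inj.
by move=> c d cm dm; rewrite (ext_edge ip nv_ nw_) // eE.
Qed.

Lemma ext_rel_pp m nv nw vw c d : (c < m)%N -> (d < m)%N -> (c.+1 == d) || (d.+1 == c) -> ext_rel m nv nw vw c d.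
Proof. by rewrite /ext_rel => -> -> ->. Qed.
Lemma ext_rel_vp m (nv : pred nat) nw vw c d : c = m -> (d < m)%N -> nv d -> ext_rel m nv nw vw c d.
Proof. by rewrite /ext_rel => -> -> ->; rewrite eqxx /= orbT. Qed.
Lemma ext_rel_pv m (nv : pred nat) nw vw c d : d = m -> (c < m)%N -> nv c -> ext_rel m nv nw vw c d.
Proof. by rewrite /ext_rel => -> -> ->; rewrite eqxx /= !orbT. Qed.
Lemma ext_rel_wp m nv (nw : pred nat) vw c d : c = m.+1 -> (d < m)%N -> nw d -> ext_rel m nv nw vw c d.
Proof. by rewrite /ext_rel => -> -> ->; rewrite eqxx /= !orbT. Qed.
Lemma ext_rel_pw m nv (nw : pred nat) vw c d : d = m.+1 -> (c < m)%N -> nw c -> ext_rel m nv nw vw c d.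
Proof. by rewrite /ext_rel => -> -> ->; rewrite eqxx /= !orbT. Qed.
Lemma ext_rel_vw m nv nw c d : c = m -> d = m.+1 -> ext_rel m nv nw true c d.
Proof. by rewrite /ext_rel => -> ->; rewrite !eqxx /= !orbT. Qed.
Lemma ext_rel_wv m nv nw c d : c = m.+1 -> d = m -> ext_rel m nv nw true c d.
Proof. by rewrite /ext_rel => -> ->; rewrite !eqxx /= !orbT. Qed.

Ltac ext_edge_tac :=
  first [by apply: ext_rel_pp; lia | by apply: ext_rel_vp => /=; rewrite ?eqxx ?orbT //; lia | by apply: ext_rel_pv => /=; rewrite ?eqxx ?orbT //; lia
       | by apply: ext_rel_wp => /=; rewrite ?eqxx ?orbT //; lia | by apply: ext_rel_pw => /=; rewrite ?eqxx ?orbT //; lia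
       | by apply: ext_rel_vw; lia | by apply: ext_rel_wv; lia].
Ltac itv_blocks :=
  first [by move=> ? /= ?; exfalso; lia
        | case=> [_|]; [by split=> /=; [lia | move=> ? ?; first [by exfalso; lia | ext_edge_tac]] | itv_blocks]].
Ltac ext_nonedge_tac :=
  let c := fresh in let d := fresh in
  move=> c d; rewrite /in_itv /= => ? ?; apply/negP; rewrite /ext_rel;
  repeat case/orP; case/and3P => ? ? /= ?; try discriminate; lia.
Ltac itv_pair :=
  first [by []
        | by move=> /= ?; exfalso; lia
        | by move=> _; split=> /=; [lia | first [by left | by right; ext_nonedge_tac]]].
Ltac itv_pairs :=
  case=> [|[|[|[|[|[|[|?]]]]]]] [|[|[|[|[|[|[|?]]]]]]]; itv_pair.
Ltac itv_wit := rewrite /= /in_itv /=; repeat (apply/andP; split); match goal with |- is_true (ext_rel _ _ _ _ _ _) => ext_edge_tac | _ => first [by [] | lia] end.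

(** A neighbour strictly between the first and the last one gives the diamond. If these two are
    neither equal nor consecutive, they close a cycle of length at least 4 through [v], and a path
    vertex beyond the cycle gives the pan. *)
Lemma nbrs_one m p v k : ipath m p -> offpath m p v -> (k < m)%N -> E v (p k) ->
  exists i j, [/\ (i <= j < m)%N, nbrs m p v (fun c => (c == i) || (c == j)) &
    (j <= i.+1)%N \/ (i = 0 /\ j = m.-1 /\ 3 <= m)%N].
Proof.
move=> ip ov km vk; pose nv c := (c < m)%N && E v (p c).
have nv_ : nbrs m p v nv by move=> c cm; rewrite /nv cm.
have ex : exists c, nv c by exists k; rewrite /nv km.
have bd c : nv c -> (c <= m)%N by case/andP => /ltnW.
case: (ex_minnP ex) => i /[dup] /andP[im _] nvi imin; case: (ex_maxnP ex bd) => j /[dup] /andP[jm _] nvj jmax.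
have ij : (i <= j)%N by exact: imin.
have mid l : (i < l < j)%N -> ~~ nv l.
  move=> lij; apply/negP => nvl.
  suff [f /(diamond_not_free symE)] : exists f, contracts_to E 4 f [:: (0, 1); (0, 2); (0, 3); (1, 2); (1, 3)]%N by apply.
  apply: (@itv_contracts1 m p v nv [:: (m, m); (l, l); (i, l.-1); (l.+1, j)]%N _
     [:: (m, l); (m, i); (m, j); (l, l.-1); (l, l.+1)]%N) => //.
  - itv_blocks.
  - itv_pairs.
  - itv_wit.
have nvE : nbrs m p v (fun c => (c == i) || (c == j)).
  move=> c cm; rewrite nv_ //; case: eqP => [->|ci]; first by rewrite nvi.
  case: eqP => [->|cj]; first by rewrite nvj.
  apply: contraTF isT => nvc; have := imin c nvc; have := jmax c nvc => cj' ic'.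
  by have := mid c; rewrite nvc; apply; lia.
exists i, j; split=> //; first by rewrite ij.
case: (leqP j i.+1) => ji; first by left.
right; case: (posnP i) => [i0|i0].
  split=> //; case: (eqVneq j m.-1) => [jE|jne]; first by split=> //; lia.
  exfalso; suff [f /(pan_not_free symE)] : exists f, contracts_to E 5 f [:: (0, 1); (1, 2); (2, 3); (3, 0); (0, 4)]%N by apply.
  apply: (@itv_contracts1 m p v _ [:: (j, j); (m, m); (i, i); (i.+1, j.-1); (j.+1, j.+1)]%N _
     [:: (j, m); (m, i); (i, i.+1); (j.-1, j); (j, j.+1)]%N ip ov nvE).
  - itv_blocks.
  - itv_pairs.
  - itv_wit.
exfalso; suff [f /(pan_not_free symE)] : exists f, contracts_to E 5 f [:: (0, 1); (1, 2); (2, 3); (3, 0); (0, 4)]%N by apply.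
apply: (@itv_contracts1 m p v _ [:: (i, i); (m, m); (j, j); (i.+1, j.-1); (i.-1, i.-1)]%N _
     [:: (i, m); (m, j); (j, j.-1); (i.+1, i); (i, i.-1)]%N ip ov nvE).
- itv_blocks.
- itv_pairs.
- itv_wit.
Qed.

Section TwoVertices.
Variables (m : nat) (p : nat -> 'I_n) (v w : 'I_n).
Hypotheses (ip : ipath m p) (ov : offpath m p v) (ow : offpath m p w) (vw : v != w).

Ltac obstruct L bs_ ws_ nv_ nw_ vwE :=
  refine (ex_ind (fun f Hf => L _ E f symE Hf freeE) _);
  apply: (itv_contracts2 (bs := bs_) (ws := ws_) ip ov ow vw nv_ nw_ vwE);
  [itv_blocks | itv_pairs | itv_wit].

Notation two_nbrs i j := (fun c : nat => (c == i) || (c == j)).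

(** Contracting arcs of the cycle formed by [v] and the path leaves a K4, a diamond or a pan,
    according to how [w] is attached. *)
Lemma cycle_extra (j j' : nat) : (3 <= m)%N -> nbrs m p v (two_nbrs 0%N m.-1) -> nbrs m p w (two_nbrs j j') ->
  (j <= j' < m)%N -> (j' <= j.+1)%N \/ (j = 0 /\ j' = m.-1)%N -> (j = j' -> 0 < j < m.-1)%N -> False.
Proof.
move=> m3 nv_ nw_ jj sh mx; case vwE: (E v w).
  case: sh => [sh|[j0 jm]]; last first.
    subst j j'; obstruct K4_not_free [:: (0, 0); (1, m.-1); (m, m); (m.+1, m.+1)]%N
      [:: (0, 1); (0, m); (0, m.+1); (m.-1, m); (m.-1, m.+1); (m, m.+1)]%N nv_ nw_ vwE.
  have [je|jne] : j = j' \/ (j < j')%N by lia.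
    have jb := mx je; subst j'.
    obstruct diamond_not_free [:: (m, m); (j, m.-1); (0, j.-1); (m.+1, m.+1)]%N
      [:: (m, m.-1); (m, 0); (m, m.+1); (j, j.-1); (j, m.+1)]%N nv_ nw_ vwE.
  have je : j' = j.+1 by lia.
  subst j'.
  obstruct K4_not_free [:: (m, m); (0, j); (j.+1, m.-1); (m.+1, m.+1)]%N
    [:: (m, 0); (m, m.-1); (m, m.+1); (j, j.+1); (j, m.+1); (j.+1, m.+1)]%N nv_ nw_ vwE.
case: sh => [sh|[j0 jm]]; last first.
  subst j j'; obstruct diamond_not_free [:: (0, 0); (1, m.-1); (m, m); (m.+1, m.+1)]%N
      [:: (0, 1); (0, m); (0, m.+1); (m.-1, m); (m.-1, m.+1)]%N nv_ nw_ vwE.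
have [je|jne] : j = j' \/ (j < j')%N by lia.
  have jb := mx je; subst j'.
  obstruct pan_not_free [:: (j, j); (0, j.-1); (m, m); (j.+1, m.-1); (m.+1, m.+1)]%N
    [:: (j, j.-1); (0, m); (m, m.-1); (j.+1, j); (j, m.+1)]%N nv_ nw_ vwE.
have je : j' = j.+1 by lia.
subst j'.
obstruct diamond_not_free [:: (0, j); (j.+1, m.-1); (m, m); (m.+1, m.+1)]%N
  [:: (j, j.+1); (0, m); (j, m.+1); (m.-1, m); (j.+1, m.+1)]%N nv_ nw_ vwE.
Qed.

Lemma cycle_pendant : (3 <= m)%N -> nbrs m p v (two_nbrs 0%N m.-1) -> nbrs m p w pred0 -> E v w -> False.
Proof.
move=> m3 nv_ nw_ vwE.
obstruct pan_not_free [:: (m, m); (0, 0); (1, m.-2); (m.-1, m.-1); (m.+1, m.+1)]%N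
  [:: (m, 0); (0, 1); (m.-2, m.-1); (m.-1, m); (m, m.+1)]%N nv_ nw_ vwE.
Qed.

Lemma single_pendant (i : nat) : (1 < i)%N -> (i.+2 < m)%N -> nbrs m p v (two_nbrs i i) -> nbrs m p w pred0 -> E v w -> False.
Proof.
move=> i2 im nv_ nw_ vwE.
obstruct spider_not_free [:: (i, i); (i.-1, i.-1); (i.+1, i.+1); (m, m); (i.-2, i.-2); (i.+2, i.+2); (m.+1, m.+1)]%N
  [:: (i, i.-1); (i, i.+1); (i, m); (i.-1, i.-2); (i.+1, i.+2); (m, m.+1)]%N nv_ nw_ vwE.
Qed.

Lemma pair_pendant (i : nat) : (0 < i)%N -> (i.+2 < m)%N -> nbrs m p v (two_nbrs i i.+1) -> nbrs m p w pred0 -> E v w -> False.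
Proof.
move=> i2 im nv_ nw_ vwE.
obstruct net_not_free [:: (i, i); (i.+1, i.+1); (m, m); (i.-1, i.-1); (i.+2, i.+2); (m.+1, m.+1)]%N
  [:: (i, i.+1); (i, m); (i.+1, m); (i, i.-1); (i.+1, i.+2); (m, m.+1)]%N nv_ nw_ vwE.
Qed.

(** Contracting the path from [i] to [j] makes [v], [w] and the two adjoining path vertices the legs
    of a claw. An edge between [v] and [w] gives the cricket instead, or the pan when [i] and [j]
    differ. *)
Lemma single_single (i j : nat) : (0 < i <= j)%N -> (j.+1 < m)%N -> nbrs m p v (two_nbrs i i) -> nbrs m p w (two_nbrs j j) -> False.
Proof.
move=> ij jm nv_ nw_; case vwE: (E v w).
  have [e|ne] : i = j \/ (i < j)%N by lia.
    subst j.
    obstruct cricket_not_free [:: (i, i); (m, m); (m.+1, m.+1); (i.-1, i.-1); (i.+1, i.+1)]%N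
      [:: (i, m); (i, m.+1); (m, m.+1); (i, i.-1); (i, i.+1)]%N nv_ nw_ vwE.
  obstruct pan_not_free [:: (i, i); (m, m); (m.+1, m.+1); (i.+1, j); (i.-1, i.-1)]%N
      [:: (i, m); (m, m.+1); (m.+1, j); (i.+1, i); (i, i.-1)]%N nv_ nw_ vwE.
obstruct K14_not_free [:: (i, j); (m, m); (m.+1, m.+1); (i.-1, i.-1); (j.+1, j.+1)]%N
      [:: (i, m); (j, m.+1); (i, i.-1); (j, j.+1)]%N nv_ nw_ vwE.
Qed.

Lemma single_pair (i j : nat) : (0 < i)%N -> (i.+1 < m)%N -> (j.+1 < m)%N -> nbrs m p v (two_nbrs i i) -> nbrs m p w (two_nbrs j j.+1) -> False.
Proof.
move=> i0 im jm nv_ nw_; case vwE: (E v w).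
  case: (ltngtP i j) => [lt|gt|e].
  - obstruct diamond_not_free [:: (m, m.+1); (j, j); (i, j.-1); (j.+1, j.+1)]%N
      [:: (m.+1, j); (m, i); (m.+1, j.+1); (j, j.-1); (j, j.+1)]%N nv_ nw_ vwE.
  - have [e|ne] : i = j.+1 \/ (j.+1 < i)%N by lia.
      subst i.
      obstruct diamond_not_free [:: (j.+1, j.+1); (m.+1, m.+1); (m, m); (j, j)]%N
        [:: (j.+1, m.+1); (j.+1, m); (j.+1, j); (m.+1, m); (m.+1, j)]%N nv_ nw_ vwE.
    obstruct diamond_not_free [:: (m, m.+1); (j.+1, j.+1); (j, j); (j.+2, i)]%N
      [:: (m.+1, j.+1); (m.+1, j); (m, i); (j.+1, j); (j.+1, j.+2)]%N nv_ nw_ vwE.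
  - subst j.
    obstruct diamond_not_free [:: (i, i); (m.+1, m.+1); (m, m); (i.+1, i.+1)]%N
      [:: (i, m.+1); (i, m); (i, i.+1); (m.+1, m); (m.+1, i.+1)]%N nv_ nw_ vwE.
case: (leqP i j) => ij.
  obstruct cricket_not_free [:: (i, j); (m.+1, m.+1); (j.+1, j.+1); (m, m); (i.-1, i.-1)]%N
      [:: (j, m.+1); (j, j.+1); (m.+1, j.+1); (i, m); (i, i.-1)]%N nv_ nw_ vwE.
obstruct cricket_not_free [:: (j.+1, i); (m.+1, m.+1); (j, j); (m, m); (i.+1, i.+1)]%N
      [:: (j.+1, m.+1); (j.+1, j); (m.+1, j); (i, m); (i, i.+1)]%N nv_ nw_ vwE.
Qed.

Lemma pair_pair (i j : nat) : (i <= j)%N -> (j.+1 < m)%N -> nbrs m p v (two_nbrs i i.+1) -> nbrs m p w (two_nbrs j j.+1) -> False.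
Proof.
move=> ij jm nv_ nw_; case vwE: (E v w); (have [e|ne] : i = j \/ (i < j)%N by lia); try subst j.
- obstruct K4_not_free [:: (i, i); (i.+1, i.+1); (m, m); (m.+1, m.+1)]%N
      [:: (i, i.+1); (i, m); (i, m.+1); (i.+1, m); (i.+1, m.+1); (m, m.+1)]%N nv_ nw_ vwE.
- obstruct diamond_not_free [:: (m, m.+1); (i.+1, i.+1); (i, i); (i.+2, j.+1)]%N
      [:: (m, i.+1); (m, i); (m.+1, j.+1); (i.+1, i); (i.+1, i.+2)]%N nv_ nw_ vwE.
- obstruct diamond_not_free [:: (i, i); (i.+1, i.+1); (m, m); (m.+1, m.+1)]%N
      [:: (i, i.+1); (i, m); (i, m.+1); (i.+1, m); (i.+1, m.+1)]%N nv_ nw_ vwE.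
obstruct butterfly_not_free [:: (i.+1, j); (m, m); (i, i); (m.+1, m.+1); (j.+1, j.+1)]%N
      [:: (i.+1, m); (i.+1, i); (m, i); (j, m.+1); (j, j.+1); (m.+1, j.+1)]%N nv_ nw_ vwE.
Qed.
End TwoVertices.
End Classification.

(** * Longest induced paths in a component *)

Section LongestPath.
Variables (n : nat) (E : rel 'I_n).
Hypothesis symE : ssrbool.symmetric E.
Hypothesis irrE : ssrbool.irreflexive E.
Hypothesis freeE : free_arr (connected_subgraph_arr E).
Variable K : {set 'I_n}.

Notation two_nbrs i j := (fun c : nat => (c == i) || (c == j)).

Definition ipath_in (m : nat) (p : nat -> 'I_n) : Prop :=
  ipath E m p /\ forall c, (c < m)%N -> p c \in K.

Definition longest (m : nat) (p : nat -> 'I_n) : Prop :=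
  ipath_in m p /\ forall m' p', ipath_in m' p' -> (m' <= m)%N.

Lemma longest_exists x0 : x0 \in K -> exists m p, longest m p.
Proof.
move=> x0K.
pose P m := [exists t : m.-tuple 'I_n, [&& uniq t, [forall i : 'I_m, nth x0 t i \in K] &
  [forall i : 'I_m, forall j : 'I_m, E (nth x0 t i) (nth x0 t j) == ((i.+1 == j) || (j.+1 == i))]]].
have PP m p : ipath_in m p -> P m.
  move=> [[pI pE] pK]; apply/existsP; have sz : size (mkseq p m) == m by rewrite size_mkseq.
  exists (Tuple sz); apply/and3P; split=> /=.
  - rewrite map_inj_in_uniq ?iota_uniq // => c d; rewrite !mem_iota !add0n => /= cm dm; exact: pI.
  - by apply/forallP => i; rewrite nth_mkseq // pK.
  - by apply/forallP => i; apply/forallP => j; rewrite !nth_mkseq // pE.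
have P0 : P 0%N by apply: (PP _ (fun=> x0)); split; first split.
have bd m : P m -> (m <= n)%N.
  case/existsP => t /and3P[ut _ _]; rewrite -(size_tuple t) -[n in X in (_ <= X)%N]card_ord -(card_uniqP ut).
  exact: max_card.
have ex : exists m, P m by exists 0%N.
case: (ex_maxnP ex bd) => m /existsP[t /and3P[ut /forallP tK /forallP tE]] mx.
exists m, (nth x0 t); split; last by move=> m' p' /PP /mx.
split; last by move=> c cm; exact: (tK (Ordinal cm)).
split=> [c d cm dm /eqP|c d cm dm]; first by rewrite nth_uniq ?size_tuple // => /eqP.
by have /forallP/(_ (Ordinal dm))/eqP := tE (Ordinal cm).
Qed.

Lemma ipath_take m k p : (k <= m)%N -> ipath_in m p -> ipath_in k p.
Proof.
move=> km [[pI pE] pK]; split; first split.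
- by move=> c d ck dk; apply: pI; lia.
- by move=> c d ck dk; apply: pE; lia.
- by move=> c ck; apply: pK; lia.
Qed.

Lemma ipath_rev m p : ipath_in m p -> ipath_in m (fun c => p (m.-1 - c)%N).
Proof.
move=> [[pI pE] pK]; split; first split.
- by move=> c d cm dm /pI; lia.
- by move=> c d cm dm; rewrite pE; lia.
- by move=> c cm; apply: pK; lia.
Qed.

Lemma ipath_snoc k p x : ipath_in k p -> x \in K -> offpath k p x -> nbrs E k p x (fun c => c.+1 == k) ->
  ipath_in k.+1 (fun c => if (c < k)%N then p c else x).
Proof.
move=> [[pI pE] pK] xK ox nx; split; first split.
- move=> c d; rewrite !ltnS => cm dm; case: (ltnP c k) => ck; case: (ltnP d k) => dk; first exact: pI.
  + by move=> pc; have := ox c ck; rewrite pc eqxx.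
  + by move=> pc; have := ox d dk; rewrite pc eqxx.
  + lia.
- move=> c d; rewrite !ltnS => cm dm; case: (ltnP c k) => ck; case: (ltnP d k) => dk; first exact: pE.
  + by rewrite symE nx //; lia.
  + by rewrite nx //; lia.
  + by rewrite irrE; lia.
- by move=> c _; case: ifP => // ck; exact: pK.
Qed.

Lemma longest_rev m p : longest m p -> longest m (fun c => p (m.-1 - c)%N).
Proof. by move=> [ip mx]; split=> //; exact: ipath_rev. Qed.

Lemma offpath_rev m (p : nat -> 'I_n) v : offpath m p v -> offpath m (fun c => p (m.-1 - c)%N) v.
Proof. by move=> ov c cm; apply: ov; lia. Qed.

Lemma nbrs_rev m p v i j : (i < m)%N -> (j < m)%N -> nbrs E m p v (two_nbrs i j) ->
  nbrs E m (fun c => p (m.-1 - c)%N) v (two_nbrs (m.-1 - j)%N (m.-1 - i)%N).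
Proof. by move=> im jm nv c cm; rewrite nv; lia. Qed.

(** A vertex attached only to the end of the path would prolong it. *)
Lemma longest_last m p v i : longest m p -> v \in K -> offpath m p v -> (i < m)%N ->
  nbrs E m p v (two_nbrs i i) -> i != m.-1.
Proof.
move=> [ip mx] vK ov im nv; apply/negP => /eqP ie.
suff /mx : ipath_in m.+1 (fun c => if (c < m)%N then p c else v) by rewrite ltnn.
by apply: ipath_snoc => // c cm; rewrite nv //; lia.
Qed.

Lemma longest_single m p v i : longest m p -> v \in K -> offpath m p v -> (i < m)%N ->
  nbrs E m p v (two_nbrs i i) -> (0 < i < m.-1)%N.
Proof.
move=> lp vK ov im nv; have := longest_last lp vK ov im nv.
have im' : (m.-1 - i < m)%N by lia.
by have := longest_last (longest_rev lp) vK (offpath_rev ov) im' (nbrs_rev im im nv); lia.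
Qed.

(** The path [p 0, ..., p i, v, w] is induced, so it has at most [m] vertices. Together with the
    reversed path this provides the room on both sides that the spider and the net require. *)
Lemma longest_pendant m p v w i j : longest m p -> v \in K -> w \in K -> offpath m p v -> offpath m p w -> v != w ->
  (i <= j < m)%N -> nbrs E m p v (two_nbrs i j) -> nbrs E m p w pred0 -> E v w -> (i.+2 < m)%N.
Proof.
move=> [ip mx] vK wK ov ow vw ijm nv nw vwE.
have i1 : (i.+1 <= m)%N by lia.
have ip1 := ipath_take i1 ip.
have ip2 : ipath_in i.+2 (fun c => if (c < i.+1)%N then p c else v).
  apply: ipath_snoc => // [c ci|c ci]; first by apply: ov; lia.
  by rewrite nv; lia.
have := ipath_snoc ip2 wK _ _; move=> ip3; apply: (mx i.+3); apply: ip3.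
- by move=> c ci /=; case: ifP => ci'; [apply: ow; lia | rewrite eq_sym].
- move=> c ci /=; case: ifP => ci'; first by rewrite nw /=; lia.
  by rewrite symE vwE; lia.
Qed.

Definition touch_shape (m i j : nat) : Prop := (j <= i.+1)%N \/ (i = 0 /\ j = m.-1 /\ 3 <= m)%N.

Lemma longest_no_two m p v w i j i' j' : longest m p -> v \in K -> w \in K ->
  offpath m p v -> offpath m p w -> v != w ->
  (i <= j < m)%N -> nbrs E m p v (two_nbrs i j) -> touch_shape m i j ->
  (i' <= j' < m)%N -> nbrs E m p w (two_nbrs i' j') -> touch_shape m i' j' -> False.
Proof.
move=> lp vK wK ov ow vw ij nv sv ij' nw sw.
have ip : ipath E m p by case: lp => [[]].
have wv : w != v by rewrite eq_sym.
have single x k l : x \in K -> offpath m p x -> (k <= l < m)%N -> nbrs E m p x (two_nbrs k l) -> k = l -> (0 < k < m.-1)%N.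
  by move=> xK ox kl nx e; subst l; apply: longest_single lp xK ox _ nx; lia.
have siv := single _ _ _ vK ov ij nv; have siw := single _ _ _ wK ow ij' nw.
case: sv => [sv|[i0 [jm m3]]]; last first.
  subst i j; apply: (cycle_extra symE irrE freeE ip ov ow vw m3 nv nw ij' _ siw).
  by case: sw => [|[? []]]; [left|right].
case: sw => [sw|[i0 [jm m3]]]; last first.
  subst i' j'; apply: (cycle_extra symE irrE freeE ip ow ov wv m3 nw nv ij _ siv).
  by left.
have [e|e] : j = i \/ j = i.+1 by lia.
  have [e'|e'] : j' = i' \/ j' = i'.+1 by lia.
    subst j j'; case: (leqP i i') => ii.
      by apply: (single_single symE irrE freeE ip ov ow vw _ _ nv nw); have := siv erefl; have := siw erefl; lia.
    by apply: (single_single symE irrE freeE ip ow ov wv _ _ nw nv); have := siv erefl; have := siw erefl; lia.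
  subst j j'; by apply: (single_pair symE irrE freeE ip ov ow vw _ _ _ nv nw); have := siv erefl; lia.
have [e'|e'] : j' = i' \/ j' = i'.+1 by lia.
  subst j j'; by apply: (single_pair symE irrE freeE ip ow ov wv _ _ _ nw nv); have := siw erefl; lia.
subst j j'; case: (leqP i i') => ii.
  by apply: (pair_pair symE irrE freeE ip ov ow vw _ _ nv nw); lia.
by apply: (pair_pair symE irrE freeE ip ow ov wv _ _ nw nv); lia.
Qed.

Lemma longest_no_pendant m p v w i j : longest m p -> v \in K -> w \in K ->
  offpath m p v -> offpath m p w -> v != w ->
  (i <= j < m)%N -> nbrs E m p v (two_nbrs i j) -> touch_shape m i j ->
  nbrs E m p w pred0 -> E v w -> False.
Proof.
move=> lp vK wK ov ow vw ij nv sv nw vwE.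
have ip : ipath E m p by case: lp => [[]].
case: sv => [sv|[i0 [jm m3]]]; last first.
  by subst i j; apply: (cycle_pendant symE irrE freeE ip ov ow vw m3 nv nw vwE).
have hi := longest_pendant lp vK wK ov ow vw ij nv nw vwE.
have nwr : nbrs E m (fun c => p (m.-1 - c)%N) w pred0 by move=> c cm; rewrite nw //; lia.
have [im jm] : (i < m /\ j < m)%N by lia.
have ijr : (m.-1 - j <= m.-1 - i < m)%N by lia.
have hj := longest_pendant (longest_rev lp) vK wK (offpath_rev ov) (offpath_rev ow) vw ijr (nbrs_rev im jm nv) nwr vwE.
have [e|e] : j = i \/ j = i.+1 by lia.
  by subst j; apply: (single_pendant symE irrE freeE ip ov ow vw _ _ nv nw vwE); lia.
by subst j; apply: (pair_pendant symE irrE freeE ip ov ow vw _ _ nv nw vwE); lia.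
Qed.

(** For [m = 0] the component is the single vertex [v] and nothing is asked of [i] and [j]. *)
Definition touched_path (m : nat) (p : nat -> 'I_n) (v : 'I_n) (i j : nat) : Prop :=
  [/\ ipath E m p, offpath m p v, K = v |: [set p c | c : 'I_m] &
    (0 < m)%N -> [/\ (i <= j < m)%N, nbrs E m p v (two_nbrs i j) & (j <= i.+1)%N \/ (i = 0 /\ j = m.-1)%N]].

Lemma component_shape : induced_connected E K -> exists m p v i j, touched_path m p v i j.
Proof.
move=> cK; have [x0 x0K] := conn_neq0 cK; have [m [p lp]] := longest_exists x0K.
have [[[pI pE] pK] mx] := lp; have ip : ipath E m p by [].
pose on x := [exists c : 'I_m, x == p c].
have onP c : (c < m)%N -> on (p c) by move=> cm; apply/existsP; exists (Ordinal cm).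
have offP x : ~~ on x -> offpath m p x.
  by move=> nx c cm; apply: contra nx => /eqP ->; exact: onP.
have m0 : (0 < m)%N.
  apply: (mx 1%N (fun=> x0)); split; last by [].
  by split=> [] [|c] [|d] // _ _; rewrite irrE.
case: (boolP [forall x in K, on x]) => [/forall_inP allP|].
  (* When the longest path covers the component, its first vertex plays the part of [v], attached to
     the first vertex of the rest. *)
  exists m.-1, (fun c => p c.+1), (p 0%N), 0%N, 0%N; split.
  - split=> [c d cm dm /pI|c d cm dm]; first by lia.
    by rewrite pE; lia.
  - by move=> c cm; apply/eqP => /pI; lia.
  - apply/setP => x; rewrite in_setU1; apply/idP/orP => [/allP/existsP[c /eqP ->]|[/eqP ->|/imsetP[c _ ->]]].
    + case: (c : nat) (ltn_ord c) => [|k] km; first by left.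
      right; apply/imsetP; have km' : (k < m.-1)%N by lia.
      by exists (Ordinal km').
    + exact: pK.
    + by apply: pK; have := ltn_ord c; lia.
  - by move=> m1; split; [lia | move=> c cm; rewrite pE; lia | left].
move=> nall; have [v vK [nv [k km vk]]] : exists2 v, v \in K & ~~ on v /\ exists2 k, (k < m)%N & E v (p k).
  case: (pickP [pred v | [&& v \in K, ~~ on v & [exists k : 'I_m, E v (p k)]]]) => [v /and3P[vK nv /existsP[k vk]]|no].
    by exists v => //; split=> //; exists k.
  case/negP: nall; apply/forall_inP => x xK.
  rewrite (@conn_closed n E K on cK _ x (p 0%N) xK (pK _ m0)) ?onP // => {x xK} x y xK yK xy.
  have aux a b : a \in K -> E a b -> on b -> on a.
    move=> aK ab /existsP[c /eqP bE]; apply: contraFT (no a) => na.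
    by rewrite /= aK na; apply/existsP; exists c; rewrite -bE.
  by apply/idP/idP; apply: aux => //; rewrite symE.
have ov := offP _ nv; have [i [j [ij nbv sv]]] := nbrs_one symE irrE freeE ip ov km vk.
exists m, p, v, i, j; split=> //; last first.
  by move=> _; split=> //; case: sv => [|[? []]]; [left|right].
apply/setP => x; rewrite in_setU1; apply/idP/orP => [xK|[/eqP -> //|/imsetP[c _ ->]]]; last exact: pK.
(* By connectedness it is enough that no edge leaves [Q]; the far end of such an edge would touch
   the path as well, or hang on [v] alone. *)
pose Q x := (x == v) || on x.
suff : Q x.
  by case/orP => [->|/existsP[c /eqP ->]]; [left|right; apply: imset_f].
suff QE a b : a \in K -> b \in K -> E a b -> Q a -> Q b.
  have <- // := @conn_closed n E K Q cK _ v x vK xK; first by rewrite /Q eqxx.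
  by move=> a b aK bK ab; apply/idP/idP; apply: QE => //; rewrite symE.
move=> aK bK ab Qa; apply: contraT; rewrite negb_or => /andP[bv nb].
have vb : v != b by rewrite eq_sym.
have ob := offP _ nb.
case: (boolP [exists k : 'I_m, E b (p k)]) => [/existsP[k' bk]|nbk].
  have [i' [j' [ij' nbb sb]]] := nbrs_one symE irrE freeE ip ob (ltn_ord k') bk.
  by have := longest_no_two lp vK bK ov ob vb ij nbv sv ij' nbb sb.
have nbb : nbrs E m p b pred0.
  by move=> c cm; apply: contraNF nbk => bc; apply/existsP; exists (Ordinal cm).
case/orP: Qa => [/eqP av|/existsP[c /eqP ac]].
  by have := longest_no_pendant lp vK bK ov ob vb ij nbv sv nbb; rewrite -av ab => /(_ isT).
by case/existsP: nbk; exists c; rewrite -ac symE.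
Qed.
End LongestPath.

(** * Block-Shi presentations of the components *)

Section PathSegments.
Variables (n : nat) (E : rel 'I_n) (m : nat) (p : nat -> 'I_n).
Hypothesis symE : ssrbool.symmetric E.
Hypothesis ip : ipath E m p.

Definition pseg (a b : nat) : {set 'I_n} := [set p c | c : 'I_m & (a <= c < b)%N].

Lemma psegP a b x : reflect (exists c, [/\ (c < m)%N, (a <= c < b)%N & x = p c]) (x \in pseg a b).
Proof.
apply: (iffP imsetP) => [[c cab ->]|[c [cm cab ->]]]; first by exists c; split=> //; move: cab; rewrite inE.
by exists (Ordinal cm); rewrite ?inE.
Qed.

Lemma mem_pseg a b c : (c < m)%N -> (p c \in pseg a b) = (a <= c < b)%N.
Proof.
move=> cm; apply/psegP/idP => [[d [dm dab /(proj1 ip _ _ cm dm) ->]] //|cab].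
by exists c.
Qed.

Lemma pseg_recr a b : (a <= b < m)%N -> pseg a b.+1 = pseg a b :|: [set p b].
Proof.
move=> ab; apply/setP => x; rewrite in_setU in_set1; apply/psegP/orP => [[c [cm cab ->]]|[/psegP[c [cm cab ->]]|/eqP ->]].
- have [e|lt] : c = b \/ (c < b)%N by lia.
    by right; rewrite e.
  by left; rewrite mem_pseg //; lia.
- by exists c; split=> //; lia.
- by exists b; split=> //; lia.
Qed.

Lemma pseg_empty a b : (b <= a)%N -> pseg a b = set0.
Proof. by move=> ba; apply/setP => x; rewrite in_set0; apply/psegP => -[c [_ + _]]; lia. Qed.

Lemma sum_pseg (V : nmodType) (F : 'I_n -> V) a b : (b <= m)%N ->
  \sum_(x in pseg a b) F x = \sum_(a <= c < b) F (p c).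
Proof.
elim: b => [|b IH] bm; first by rewrite pseg_empty // big_set0 big_geq.
case: (leqP a b) => ab; last by rewrite pseg_empty // big_set0 big_geq.
rewrite pseg_recr ?ab // setUC big_setU1 ?mem_pseg ?ltnn ?andbF //= IH 1?ltnW // addrC.
by rewrite big_nat_recr.
Qed.

Lemma pseg_conn a b : (a < b <= m)%N -> induced_connected E (pseg a b).
Proof.
elim: b => [|b IH] // abm; have [e|lt] : a = b \/ (a < b)%N by lia.
  by rewrite pseg_recr ?pseg_empty ?set0U ?e; [exact: conn1 | lia..].
rewrite pseg_recr; last by lia.
apply: (conn_union symE (IH _) (conn1 E _) (x := p b.-1) (y := p b)); rewrite ?inE //; first by lia.
  by rewrite mem_pseg; lia.
by rewrite (proj2 ip); lia.
Qed.

(** A path vertex missing between two vertices of [J] would separate them. *)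
Lemma pseg_convex (J : {set 'I_n}) : induced_connected E J -> J \subset pseg 0 m ->
  exists a b, (a < b <= m)%N /\ J = pseg a b.
Proof.
move=> cJ /subsetP sJ.
pose inJ c := (c < m)%N && (p c \in J).
have ex : exists c, inJ c.
  by have [x xJ] := conn_neq0 cJ; have /psegP[c [cm _ xE]] := sJ x xJ; exists c; rewrite /inJ cm -xE.
have bd c : inJ c -> (c <= m)%N by case/andP => /ltnW.
case: (ex_minnP ex) => a /andP[am aJ] amin; case: (ex_maxnP ex bd) => b /andP[bm bJ] bmax.
exists a, b.+1; split; first by rewrite bm andbT ltnS amin // /inJ bm.
apply/setP => x; apply/idP/psegP => [xJ|[c [cm cab ->]]].
  have /psegP[c [cm _ xE]] := sJ x xJ; exists c; split=> //.
  have ic : inJ c by rewrite /inJ cm -xE.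
  by rewrite ltnS amin // bmax.
apply: contraT => ncJ.
have nab : (c != a) && (c != b) by apply/andP; split; apply: contraNneq ncJ => ->.
have := conn_closed (P := fun u => u \in pseg 0 c) cJ _ aJ bJ.
rewrite !mem_pseg //; move=> H; suff : (0 <= a < c)%N = (0 <= b < c)%N by lia.
apply: H => x' y' xJ' yJ'; have /psegP[d [dm _ xE]] := sJ _ xJ'; have /psegP[d' [dm' _ yE]] := sJ _ yJ'.
rewrite xE yE (proj2 ip) // !mem_pseg // => adj.
have dc : d != c by apply: contraNneq ncJ => <-; rewrite -xE.
have dc' : d' != c by apply: contraNneq ncJ => <-; rewrite -yE.
lia.
Qed.
End PathSegments.

Section Touched.
Variables (n : nat) (E : rel 'I_n) (K : {set 'I_n}) (m : nat) (p : nat -> 'I_n) (v : 'I_n) (i j : nat).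
Hypothesis symE : ssrbool.symmetric E.
Hypothesis tp : touched_path E K m p v i j.
Notation pseg := (pseg m p).

Let ip : ipath E m p. Proof. by case: tp. Qed.

Lemma touched_seg : [set p c | c : 'I_m] = pseg 0 m.
Proof. by apply/setP => x; apply/imsetP/imsetP => -[c _ ->]; exists c => //; rewrite inE /=. Qed.

Lemma touched_K : K = v |: pseg 0 m.
Proof. by case: tp => _ _ -> _; rewrite touched_seg. Qed.

Lemma touched_off a b : v \notin pseg a b.
Proof. by case: tp => _ ov _ _; apply/psegP => -[c [cm _ /eqP]]; rewrite (negbTE (ov c cm)). Qed.

Lemma touched_card : #|K| = m.+1.
Proof.
rewrite touched_K cardsU1 touched_off /= add1n -touched_seg card_imset ?card_ord // => c d /(proj1 ip) H.
by apply/val_inj/H.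
Qed.

Lemma touched_adj c : (c < m)%N -> E v (p c) = (c == i) || (c == j).
Proof. by move=> cm; case: tp => _ _ _ /(_ (leq_ltn_trans (leq0n _) cm))[_ nv _]; exact: nv. Qed.

Lemma touched_ij : (0 < m)%N -> (i <= j < m)%N.
Proof. by case: tp => _ _ _ H /H[]. Qed.

Lemma touched_memP x : reflect (x = v \/ exists2 c, (c < m)%N & x = p c) (x \in K).
Proof.
rewrite touched_K in_setU1; apply: (iffP orP) => [[/eqP|/psegP[c [cm _ ->]]]|[->|[c cm ->]]].
- by left.
- by right; exists c.
- by left.
- by right; rewrite (mem_pseg ip).
Qed.

Lemma touched_v : v \in K.
Proof. by apply/touched_memP; left. Qed.

Lemma touched_pv c : (c < m)%N -> (p c == v) = false.
Proof. by move=> cm; case: tp => _ ov _ _; rewrite eq_sym; exact/negbTE/ov. Qed.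

Lemma conn_off J : induced_connected E J -> J \subset K -> v \notin J ->
  exists a b, (a < b <= m)%N /\ J = pseg a b.
Proof.
move=> cJ sJ vJ; apply: (pseg_convex ip cJ); apply/subsetP => x xJ.
have := subsetP sJ x xJ; rewrite touched_K in_setU1 => /orP[/eqP xv|//].
by rewrite -xv xJ in vJ.
Qed.

(** The detour through [v] cannot bridge a missing vertex [p c]: as [i] and [j] are equal or
    consecutive, all the neighbours of [v] in [J] lie on the same side of [c], and [v] can be
    counted on that side. *)
Lemma conn_on_acyclic J : (j <= i.+1)%N -> induced_connected E J -> J \subset K -> v \in J ->
  J = [set v] \/ exists a b, [/\ (b <= m)%N, (a <= i < b)%N || (a <= j < b)%N & J = v |: pseg a b].
Proof.
move=> ji cJ sJ vJ.
pose inJ c := (c < m)%N && (p c \in J).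
have memJ x : x \in J -> x = v \/ exists2 c, inJ c & x = p c.
  move=> xJ; have /touched_memP[->|[c cm xE]] := subsetP sJ x xJ; first by left.
  by right; exists c; rewrite // /inJ cm -xE.
case: (pickP (fun c : 'I_m => inJ c)) => [c0 c0J|noJ]; last first.
  left; apply/setP => x; rewrite in_set1; apply/idP/eqP => [/memJ[//|[c /[dup] /andP[cm _] cJ' _]]|->//].
  by have := noJ (Ordinal cm); rewrite cJ'.
right; have ex : exists c, inJ c by exists c0.
have bd c : inJ c -> (c <= m)%N by case/andP => /ltnW.
case: (ex_minnP ex) => a /[dup] ia /andP[am aJ] amin; case: (ex_maxnP ex bd) => b /[dup] ib /andP[bm bJ] bmax.
have ijm : (i <= j < m)%N by apply: touched_ij; lia.
have ab : (a <= b)%N by exact: amin.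
have gap c : (a <= c <= b)%N -> inJ c.
  move=> cab; have cm : (c < m)%N by lia.
  apply: contraT => ncJ.
  have nab : (c != a) && (c != b) by apply/andP; split; apply: contraNneq ncJ => ->.
  pose P u := if u == v then (i < c)%N else u \in pseg 0 c.
  have Pp d : (d < m)%N -> P (p d) = (d < c)%N by move=> dm; rewrite /P touched_pv // (mem_pseg ip).
  have Pv : P v = (i < c)%N by rewrite /P eqxx.
  have adj d : inJ d -> E v (p d) -> P v = P (p d).
    move=> dJ; have /andP[dm _] := dJ; rewrite touched_adj // Pv Pp // => dij.
    have dc : d != c by apply: contraNneq ncJ => <-.
    by case/orP: dij => /eqP dE; apply/idP/idP; clear -dE dc ijm ji; lia.
  suff /(_ (p a) (p b) aJ bJ) : forall x y, x \in J -> y \in J -> P x = P y 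
    by rewrite !Pp //; clear -cab nab; lia.
  apply: (conn_closed cJ) => x y /memJ[->|[d dJ ->]] /memJ[->|[d' dJ' ->]] //; first exact: adj.
    by rewrite symE => /(adj _ dJ) ->.
  have /andP[dm _] := dJ; have /andP[dm' _] := dJ'; rewrite (proj2 ip) // !Pp // => dd.
  have dc : d != c by apply: contraNneq ncJ => <-.
  have dc' : d' != c by apply: contraNneq ncJ => <-.
  by case/orP: dd => /eqP dE; apply/idP/idP; clear -dE dc dc'; lia.
exists a, b.+1; split=> //.
  apply: contraT; rewrite negb_or => /andP[ni nj].
  suff /(_ v (p a) vJ aJ) : forall x y, x \in J -> y \in J -> (x == v) = (y == v) by rewrite eqxx touched_pv.
  have adj d : inJ d -> ~~ E v (p d).
    move=> dJ; have /andP[dm _] := dJ; rewrite touched_adj //.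
    apply/norP; split; [apply: contraNneq ni | apply: contraNneq nj] => <-; by rewrite amin //= ltnS bmax.
  apply: (conn_closed cJ) => x y /memJ[->|[d dJ ->]] /memJ[->|[d' dJ' ->]] //; first by rewrite (negbTE (adj _ dJ')).
    by rewrite symE (negbTE (adj _ dJ)).
  by have /andP[dm _] := dJ; have /andP[dm' _] := dJ'; rewrite !touched_pv.
apply/setP => x; rewrite in_setU1; apply/idP/orP => [/memJ[->|[c cJ' ->]]|[/eqP -> //|/psegP[c [cm cab ->]]]].
- by left.
- by right; have /andP[cm _] := cJ'; rewrite (mem_pseg ip) // amin // ltnS bmax.
- by have /andP[] := gap c cab.
Qed.

(** What [J] omits from the path is a segment: two omitted vertices cut the cycle, and everything
    strictly between them lies on the side away from [v]. *)
Lemma conn_on_cyclic J : (i = 0 /\ j = m.-1)%N -> induced_connected E J -> J \subset K -> v \in J ->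
  exists a b, (a <= b <= m)%N /\ J = v |: (pseg 0 a :|: pseg b m).
Proof.
move=> [i0 jm] cJ sJ vJ.
pose nJ c := (c < m)%N && (p c \notin J).
have memJ x : x \in J -> x = v \/ exists c, [/\ (c < m)%N, ~~ nJ c & x = p c].
  move=> xJ; have /touched_memP[->|[c cm xE]] := subsetP sJ x xJ; first by left.
  by right; exists c; split=> //; rewrite /nJ cm -xE xJ.
have fin a b : (a <= b <= m)%N -> (forall c, nJ c = (a <= c < b)%N) -> J = v |: (pseg 0 a :|: pseg b m).
  move=> ab H; apply/setP => x; rewrite in_setU1 in_setU.
  apply/idP/idP => [/memJ[->|[c [cm + ->]]]|/orP[/eqP -> //|/orP[]/psegP[c [cm cab ->]]]]; first by rewrite eqxx.
  - by rewrite H !(mem_pseg ip) //; case: (p c == v) => //=; lia.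
  - by have := H c; rewrite /nJ cm /=; case: (p c \in J) => //=; lia.
  - by have := H c; rewrite /nJ cm /=; case: (p c \in J) => //=; lia.
case: (pickP (fun c : 'I_m => nJ c)) => [c0 c0J|noJ]; last first.
  exists 0%N, 0%N; split=> //; apply: fin => // c; rewrite andbF; apply/negP => /[dup] cJ' /andP[cm _].
  by have := noJ (Ordinal cm); rewrite cJ'.
have ex : exists c, nJ c by exists c0.
have bd c : nJ c -> (c <= m)%N by case/andP => /ltnW.
case: (ex_minnP ex) => a /[dup] ia /andP[am aJ] amin; case: (ex_maxnP ex bd) => b /[dup] ib /andP[bm bJ] bmax.
have ab : (a <= b)%N by exact: amin.
exists a, b.+1; split; first by lia.
apply: fin; first by lia.
move=> c; apply/idP/idP => [cJ'|cab]; first by rewrite amin // ltnS bmax.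
have cm : (c < m)%N by lia.
rewrite /nJ cm /=; apply/negP => cJ'.
have nab : (c != a) && (c != b).
  by apply/andP; split; [apply: contraNneq aJ => <- | apply: contraNneq bJ => <-].
suff /(_ v (p c) vJ cJ') : forall x y, x \in J -> y \in J -> (x \in pseg a.+1 b) = (y \in pseg a.+1 b).
  by rewrite (negbTE (touched_off _ _)) (mem_pseg ip) //; clear -cab nab; lia.
have adj d : (d < m)%N -> ~~ nJ d -> E v (p d) -> (p d \in pseg a.+1 b) = false.
  move=> dm dJ; rewrite touched_adj // (mem_pseg ip) //.
  have da : d != a by apply: contraNneq dJ => ->.
  have db : d != b by apply: contraNneq dJ => ->.
  by clear -i0 jm am bm; case/orP => /eqP ->; lia.
apply: (conn_closed cJ) => x y /memJ[->|[d [dm dJ ->]]] /memJ[->|[d' [dm' dJ' ->]]] //.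
- by rewrite (negbTE (touched_off _ _)) => /adj ->.
- by rewrite (negbTE (touched_off _ _)) symE => /adj ->.
rewrite (proj2 ip) // !(mem_pseg ip) // => dd.
have da : d != a by apply: contraNneq dJ => ->.
have db : d != b by apply: contraNneq dJ => ->.
have da' : d' != a by apply: contraNneq dJ' => ->.
have db' : d' != b by apply: contraNneq dJ' => ->.
by case/orP: dd => /eqP dE; apply/idP/idP; clear -dE da da' db db'; lia.
Qed.

Lemma on_acyclic_conn a b : (b <= m)%N -> (a <= i < b)%N || (a <= j < b)%N -> induced_connected E (v |: pseg a b).
Proof.
move=> bm ij; have aux c : (a <= c < b)%N -> (c == i) || (c == j) -> induced_connected E (v |: pseg a b).
  move=> cab cij; apply: (conn_union symE (conn1 E v) (pseg_conn symE ip _) (x := v) (y := p c)).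
  - by lia.
  - by rewrite inE.
  - by rewrite (mem_pseg ip) //; lia.
  - by rewrite touched_adj //; lia.
by case/orP: ij => ?; [apply: (aux i) | apply: (aux j)]; rewrite ?eqxx ?orbT.
Qed.

Lemma on_cyclic_conn a b : (i = 0 /\ j = m.-1)%N -> (a <= b <= m)%N ->
  induced_connected E (v |: (pseg 0 a :|: pseg b m)).
Proof.
move=> [i0 jm] abm.
have c1 : induced_connected E (v |: pseg 0 a).
  case: (posnP a) => [->|a0]; first by rewrite pseg_empty // setU0; exact: conn1.
  by apply: on_acyclic_conn; lia.
case: (ltnP b m) => bm; last by rewrite (pseg_empty _ _ bm) setU0.
rewrite setUA; apply: (conn_union symE c1 (pseg_conn symE ip _) (x := v) (y := p m.-1)).
- by lia.
- by rewrite !inE eqxx.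
- by rewrite (mem_pseg ip); lia.
- by rewrite touched_adj; lia.
Qed.
End Touched.

Definition conn_arr_in n (E : rel 'I_n) (K : {set 'I_n}) : arrangement n :=
  [seq subset_form J | J <- enum [pred J : {set 'I_n} | induced_connected E J && (J \subset K)]].

Lemma conn_arr_inP n (E : rel 'I_n) (K : {set 'I_n}) a :
  reflect (exists J, [/\ induced_connected E J, J \subset K & a = subset_form J]) (a \in conn_arr_in E K).
Proof.
apply: (iffP mapP) => [[J]|[J [cJ sJ ->]]]; first by rewrite mem_enum inE => /andP[cJ sJ] ->; exists J.
by exists J; rewrite // mem_enum inE cJ.
Qed.

Section PathPresentation.
Variables (n : nat) (E : rel 'I_n) (K : {set 'I_n}) (m : nat) (p : nat -> 'I_n) (v : 'I_n) (i j : nat).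
Hypothesis symE : ssrbool.symmetric E.
Hypothesis tp : touched_path E K m p v i j.
Notation pseg := (pseg m p).
Let ip : ipath E m p. Proof. by case: tp. Qed.

Definition pt (c : nat) : 'rV[rat]_(1 + m.+1) := univ_y (inord c).

(* The coordinate of the vertex p c is the difference of the points c + 1 and c; that of v is s, or
   s minus the sum of all the path coordinates when cyc holds. *)
Definition touched_X (cyc : bool) : 'M[rat]_(n, 1 + m.+1) :=
  \matrix_u (if u == v then univ_s _ - (if cyc then pt m - pt 0 else 0)
             else if [pick c : 'I_m | p c == u] is Some c then pt c.+1 - pt c else 0).

(** Partial sums invert the differences: the point [c] is the sum of the path coordinates before
    [c], and [s] is the coordinate of [v], or the sum over the whole component when [cyc] holds. *)
Definition touched_T (cyc : bool) : 'M[rat]_(n, 1 + m.+1) :=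
  row_mx (\col_u (u \in if cyc then K else [set v])%:R)
         (\matrix_(u, c) (u \in pseg 0 (c : 'I_m.+1))%:R).

Variable cyc : bool.
Notation X := (touched_X cyc).

Lemma row_X_v : row v X = univ_s _ - (if cyc then pt m - pt 0 else 0).
Proof. by rewrite rowK eqxx. Qed.

Lemma row_X_p c : (c < m)%N -> row (p c) X = pt c.+1 - pt c.
Proof.
move=> cm; rewrite rowK (touched_pv tp cm); case: pickP => [d /eqP|/(_ (Ordinal cm))]; last by rewrite /= eqxx.
by move=> /(proj1 ip _ _ (ltn_ord d) cm) ->.
Qed.

Lemma row_X_out u : u \notin K -> row u X = 0.
Proof.
move=> uK; rewrite rowK; case: eqP => [uv|_]; first by rewrite uv (touched_v tp) in uK.
case: pickP => [c /eqP pc|//]; case/negP: uK; rewrite -pc; apply/(touched_memP tp); right.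
by exists c.
Qed.

Lemma subset_form_X J : subset_form J *m X = \sum_(u in J) row u X.
Proof.
rewrite mulmx_sum_row [RHS]big_mkcond; apply: eq_bigr => u _.
by rewrite mxE; case: (u \in J); rewrite ?scale1r ?scale0r.
Qed.

Lemma pseg_form a b : (a <= b <= m)%N -> \sum_(u in pseg a b) row u X = pt b - pt a.
Proof.
case/andP => ab bm; rewrite (sum_pseg ip) // big_nat.
rewrite (eq_bigr (fun c => pt c.+1 - pt c)); last by move=> c /andP[ac cb]; apply: row_X_p; lia.
by rewrite -big_nat telescope_sumr.
Qed.

Lemma v_form (A : {set 'I_n}) : v \notin A -> \sum_(u in v |: A) row u X = row v X + \sum_(u in A) row u X.
Proof. by move=> vA; rewrite big_setU1. Qed.

Lemma touched_section w : supported K w -> w *m touched_T cyc *m X^T = w.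
Proof.
move=> sw; set z := w *m touched_T cyc.
have zE u : (z *m X^T) 0 u = (row u X *m z^T) 0 0.
  rewrite -[z *m X^T]trmxK trmx_mul trmxK mxE !mxE; apply: eq_bigr => k _.
  by rewrite !mxE.
have zs : z 0 (lshift _ 0) = \sum_(u in if cyc then K else [set v]) w 0 u.
  rewrite /z mxE [RHS]big_mkcond; apply: eq_bigr => u _; rewrite row_mxEl mxE.
  by case: (u \in _); rewrite ?mulr1 ?mulr0.
have zy c : (c <= m)%N -> z 0 (rshift 1 (inord c)) = \sum_(0 <= d < c) w 0 (p d).
  move=> cm; rewrite -(sum_pseg ip (fun u => w 0 u)) // /z mxE [RHS]big_mkcond; apply: eq_bigr => u _.
  by rewrite row_mxEr mxE inordK ?ltnS //; case: (u \in _); rewrite ?mulr1 ?mulr0.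
have ptz c : (c <= m)%N -> pt c *m z^T = (\sum_(0 <= d < c) w 0 (p d))%:M.
  by move=> cm; rewrite /pt dot_univ_y zy.
apply/rowP => u; rewrite zE; case: (boolP (u \in K)) => [/(touched_memP tp)[->|[c cm ->]]|uK].
- rewrite row_X_v mulmxBl dot_univ_s zs; case: cyc => /=.
    rewrite mulmxBl !ptz // [X in _ - (_ - X%:M)](big_geq (leqnn 0)) (touched_K tp) big_setU1 ?(touched_off tp) //= (sum_pseg ip) //.
    by rewrite !mxE eqxx !mulr1n subr0 addrK.
  by rewrite mul0mx subr0 big_set1 mxE eqxx.
- rewrite row_X_p // mulmxBl !ptz //; last by rewrite ltnW.
  by rewrite big_nat_recr //= !mxE eqxx !mulr1n addrAC subrr add0r.
by rewrite row_X_out // mul0mx mxE sw.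
Qed.

Lemma touched_translation : (row_mx 0 (const_mx 1) : 'rV_(1 + m.+1)) *m X^T = 0.
Proof.
set z : 'rV_(1 + m.+1) := row_mx 0 _.
have zE u : (z *m X^T) 0 u = (row u X *m z^T) 0 0.
  rewrite -[z *m X^T]trmxK trmx_mul trmxK mxE !mxE; apply: eq_bigr => k _.
  by rewrite !mxE.
have ptz c : pt c *m z^T = 1%:M by rewrite /pt dot_univ_y /z row_mxEr mxE.
apply/rowP => u; rewrite zE [RHS]mxE; case: (boolP (u \in K)) => [/(touched_memP tp)[->|[c cm ->]]|uK].
- have zs : z 0 (lshift _ 0) = 0 by rewrite /z row_mxEl mxE.
  rewrite row_X_v mulmxBl dot_univ_s zs; case: cyc => /=; last by rewrite mul0mx subr0 mxE eqxx.
  by rewrite mulmxBl !ptz subrr subr0 mxE eqxx.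
- by rewrite row_X_p // mulmxBl !ptz subrr mxE.
by rewrite row_X_out // mul0mx mxE.
Qed.

Lemma inord_pt (k : 'I_m.+1) : univ_y k = pt k.
Proof. by rewrite /pt inord_val. Qed.

Lemma pt_pair_form (blk : 'I_m.+1 -> nat) (A : arrangement n) :
  (forall a b, (a < b <= m)%N -> exists2 f, f \in A & f *m X = pt b - pt a) ->
  forall k l : 'I_m.+1, k != l -> exists a c, [/\ a \in A, c != 0 & a *m X = c *: (univ_y l - univ_y k)].
Proof.
move=> H k l; rewrite !inord_pt -val_eqE /= neq_ltn => /orP[kl|lk].
  have [|f fA fE] := H k l; first by rewrite kl /= -ltnS ltn_ord.
  by exists f, 1; rewrite scale1r oner_eq0.
have [|f fA fE] := H l k; first by rewrite lk /= -ltnS ltn_ord.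
by exists f, (-1); rewrite scaleN1r opprB oppr_eq0 oner_eq0.
Qed.
End PathPresentation.

Section Presentations.
Variables (n : nat) (E : rel 'I_n) (K : {set 'I_n}) (m : nat) (p : nat -> 'I_n) (v : 'I_n) (i j : nat).
Hypothesis symE : ssrbool.symmetric E.
Hypothesis tp : touched_path E K m p v i j.
Notation pseg := (pseg m p).
Notation A := (conn_arr_in E K).
Let ip : ipath E m p. Proof. by case: tp. Qed.

Lemma pseg_sub a b : pseg a b \subset K.
Proof.
apply/subsetP => x /psegP[c [cm _ ->]]; apply/(touched_memP tp); right.
by exists c.
Qed.

Lemma v_pseg_sub (B : {set 'I_n}) : B \subset K -> v |: B \subset K.
Proof. by move=> BK; rewrite subUset BK sub1set (touched_v tp). Qed.

(* A segment [a, b) of the path together with v has the form s + Y_b - Y_a, so its connectedness has to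
   match blk b < blk a. *)
Lemma acyclic_presented : (j <= i.+1)%N -> shi_presented (fun c : 'I_m.+1 => (c <= i) + (c <= j))%N A K.
Proof.
move=> ji; split; first exact: touched_card tp.
have ij : (0 < m)%N -> (i <= j < m)%N by exact: touched_ij tp.
exists (touched_X m p v false), (touched_T K m p v false); split.
- move=> _ /conn_arr_inP[J [cJ sJ ->]]; rewrite subset_form_X.
  case: (boolP (v \in J)) => vJ.
    have [->|[a [b [bm abij ->]]]] := conn_on_acyclic symE tp ji cJ sJ vJ.
      by exists 1, (univ_s _); split; [constructor 1 | rewrite big_set1 row_X_v subr0 scale1r].
    exists (-1), (pt m a - pt m b - univ_s _); split.
      constructor 3; exists (inord b), (inord a); rewrite !inordK; [split=> //|lia..].
      by have := ij; lia.
    rewrite v_form ?(touched_off tp) // (pseg_form tp) ?row_X_v; last by lia.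
    by rewrite scaleN1r subr0 !opprB.
  have [a [b [ab ->]]] := conn_off tp cJ sJ vJ.
  exists 1, (pt m b - pt m a); rewrite scale1r (pseg_form tp); last by lia.
  split=> //; constructor 2; exists (inord a), (inord b); split=> //.
  by rewrite -val_eqE /= !inordK; lia.
- have Apseg a b : (a < b <= m)%N -> exists2 f, f \in A & f *m touched_X m p v false = pt m b - pt m a.
    move=> ab; exists (subset_form (pseg a b)); last by rewrite subset_form_X (pseg_form tp) //; lia.
    by apply/conn_arr_inP; exists (pseg a b); split; [exact: pseg_conn | exact: pseg_sub |].
  move=> f [->|[k [l [kl ->]]]|[k [l [kl ->]]]].
  + exists (subset_form [set v]), 1; rewrite oner_eq0 scale1r subset_form_X big_set1 row_X_v subr0; split=> //.
    by apply/conn_arr_inP; exists [set v]; split; rewrite ?sub1set ?(touched_v tp) //; exact: conn1.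
  + exact: (pt_pair_form (fun=> 0%N) Apseg).
  + exists (subset_form (v |: pseg l k)), (-1); split.
    * apply/conn_arr_inP; exists (v |: pseg l k); split; [|exact: v_pseg_sub (pseg_sub _ _)|] => //.
      by apply: (on_acyclic_conn symE tp); have := ltn_ord k; lia.
    * by rewrite oppr_eq0 oner_eq0.
    * rewrite subset_form_X v_form ?(touched_off tp) // (pseg_form tp) ?row_X_v; last by have := ltn_ord k; lia.
      by rewrite !inord_pt scaleN1r subr0 !opprB.
- by move=> w sw; apply: (touched_section tp).
- exact: (touched_translation tp).
by move=> u uK; rewrite (row_X_out tp).
Qed.

(** A connected set through [v] omits a segment [[a, b)], and [s] is the sum over the whole
    component, so its form is [s - (Y_b - Y_a)]. Every pair [a < b] occurs, hence the weights are
    all distinct: this is the cone over the Shi arrangement of type A. *)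
Lemma cyclic_presented : (i = 0 /\ j = m.-1)%N -> shi_presented (fun c : 'I_m.+1 => c : nat) A K.
Proof.
move=> ij0; split; first exact: touched_card tp.
have cform a b : (a <= b <= m)%N -> \sum_(u in v |: (pseg 0 a :|: pseg b m)) row u (touched_X m p v true) =
    univ_s _ - (pt m b - pt m a).
  move=> ab; rewrite v_form; last by rewrite in_setU !(negbTE (touched_off tp _ _)).
  rewrite (eq_bigl [predU pseg 0 a & pseg b m]); last by move=> x; rewrite !inE.
  rewrite bigU /=; last first.
    rewrite -setI_eq0; apply/eqP/setP => x; rewrite !inE; apply/negP => /andP[/psegP[c [cm c1 ->]]].
    by rewrite (mem_pseg ip) //; lia.
  rewrite !(pseg_form tp) ?row_X_v; [|lia..].
  rewrite addrACA addrC addrA; apply/eqP; rewrite -subr_eq0; apply/eqP.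
  by apply/rowP => k; rewrite !mxE; ring.
exists (touched_X m p v true), (touched_T K m p v true); split.
- move=> _ /conn_arr_inP[J [cJ sJ ->]]; rewrite subset_form_X.
  case: (boolP (v \in J)) => vJ.
    have [a [b [ab ->]]] := conn_on_cyclic symE tp ij0 cJ sJ vJ.
    rewrite cform //; have [e|lt] : a = b \/ (a < b)%N by lia.
      by exists 1, (univ_s _); split; [constructor 1 | rewrite e subrr subr0 scale1r].
    exists (-1), (pt m b - pt m a - univ_s _); split; last by rewrite scaleN1r !opprB.
    by constructor 3; exists (inord a), (inord b); rewrite !inordK //; lia.
  have [a [b [ab ->]]] := conn_off tp cJ sJ vJ.
  exists 1, (pt m b - pt m a); rewrite scale1r (pseg_form tp); last by lia.
  split=> //; constructor 2; exists (inord a), (inord b); split=> //.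
  by rewrite -val_eqE /= !inordK; lia.
- have Apseg a b : (a < b <= m)%N -> exists2 f, f \in A & f *m touched_X m p v true = pt m b - pt m a.
    move=> ab; exists (subset_form (pseg a b)); last by rewrite subset_form_X (pseg_form tp) //; lia.
    by apply/conn_arr_inP; exists (pseg a b); split; [exact: pseg_conn | exact: pseg_sub |].
  have Acyc a b : (a <= b <= m)%N -> subset_form (v |: (pseg 0 a :|: pseg b m)) \in A.
    move=> ab; apply/conn_arr_inP; exists (v |: (pseg 0 a :|: pseg b m)); split=> //.
      exact: (on_cyclic_conn symE tp).
    by rewrite v_pseg_sub // subUset !pseg_sub.
  move=> f [->|[k [l [kl ->]]]|[k [l [kl ->]]]].
  + exists (subset_form (v |: (pseg 0 0 :|: pseg 0 m))), 1; split; [exact: Acyc|exact: oner_neq0|].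
    by rewrite subset_form_X cform // subrr subr0 scale1r.
  + exact: (pt_pair_form (fun=> 0%N) Apseg).
  + have klm : (k <= l <= m)%N by have := ltn_ord l; lia.
    exists (subset_form (v |: (pseg 0 k :|: pseg l m))), (-1); split; [exact: Acyc|by rewrite oppr_eq0 oner_eq0|].
    by rewrite subset_form_X cform // !inord_pt scaleN1r !opprB.
- by move=> w sw; apply: (touched_section tp).
- exact: (touched_translation tp).
by move=> u uK; rewrite (row_X_out tp).
Qed.
End Presentations.

(** * Assembling the components *)

Lemma component_accurate n (E : rel 'I_n) (K : {set 'I_n}) : ssrbool.symmetric E -> ssrbool.irreflexive E ->
  free_arr (connected_subgraph_arr E) -> induced_connected E K -> exists e, accurate_on (conn_arr_in E K) K e.
Proof.
move=> symE irrE freeE cK; have [m [p [v [i [j tp]]]]] := component_shape symE irrE freeE cK.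
case: (posnP m) => m0.
  (* For an empty path [i] and [j] are arbitrary; the value 0 makes the acyclic case apply. *)
  have tp0 : touched_path E K m p v 0 0 by case: tp => ? ? ? _; split=> // m1; rewrite m0 in m1.
  by apply: shi_presented_accurate (acyclic_presented symE tp0 _).
case: (tp) => _ _ _ /(_ m0)[_ _ [ji|ij0]].
  exact: shi_presented_accurate (acyclic_presented symE tp ji).
exact: shi_presented_accurate (cyclic_presented symE tp ij0).
Qed.

(** Induction on sets closed under adjacency, splitting off the component of one vertex: a connected
    set lies on one side, so the arrangement is a product. *)
Lemma closed_accurate n (E : rel 'I_n) : ssrbool.symmetric E -> ssrbool.irreflexive E ->
  free_arr (connected_subgraph_arr E) ->
  forall C : {set 'I_n}, (forall x y, x \in C -> E x y -> y \in C) -> exists e, accurate_on (conn_arr_in E C) C e.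
Proof.
move=> symE irrE freeE C; move: {2}#|C|.+1 (ltnSn #|C|) => k; elim: k C => // k IH C Ck clC.
have [->|/set0Pn[x xC]] := eqVneq C set0.
  exists [::]; suff -> : conn_arr_in E set0 = [::] by exact: accurate_on_set0.
  case E0 : (conn_arr_in E set0) => [//|a s]; have : a \in conn_arr_in E set0 by rewrite E0 mem_head.
  case/conn_arr_inP => J [/conn_neq0[y yJ] + _] => /subsetP/(_ y yJ); by rewrite inE.
pose K := [set y | connect E x y].
have symc : connect_sym E by apply: sym_connect_sym.
have KC : K \subset C.
  apply/subsetP => y; rewrite inE => xy.
  have clE : closed E (mem C) by apply: intro_closed => // a b ab aC; apply: clC ab.
  by rewrite -(closed_connect clE xy).
have Kcl y z : E y z -> (y \in K) = (z \in K).
  by move=> yz; rewrite !inE; apply/idP/idP => H; apply: connect_trans H (connect1 _); rewrite // symE.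
have xK : x \in K by rewrite inE connect0.
have cK : induced_connected E K.
  apply/andP; split; first by apply/set0Pn; exists x.
  have to y : y \in K -> connect (induced_rel E K) x y.
    rewrite inE => /connectP[s]; elim/last_ind: s y => [|s z IHs] y /=; first by move=> _ ->.
    rewrite rcons_path last_rcons => /andP[ps ez] ->; have H := IHs _ ps erefl.
    apply: connect_trans H (connect1 _); rewrite /induced_rel /= ez andbT -(Kcl _ _ ez) andbb inE.
    by apply/connectP; exists s.
  apply/forall_inP => a aK; apply/forall_inP => b bK; apply: connect_trans (to b bK).
  by rewrite induced_sym //; exact: to.
have [e1 h1] := component_accurate symE irrE freeE cK.
have [|y z|e2 h2] := IH (C :\: K).
- rewrite -ltnS; apply: leq_trans Ck; rewrite ltnS; apply: proper_card.
  by rewrite properE subsetDl /=; apply/subsetPn; exists x; rewrite // in_setD xK.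
- by rewrite !inE => /andP[yK yC] yz; have := Kcl _ _ yz; rewrite !inE => <-; rewrite yK (clC y).
have KD : K :|: (C :\: K) = C by rewrite -{1}(setIidPr KC) setID.
exists (merge leq e1 e2); rewrite -{2}KD.
apply: accurate_on_merge h1 h2.
- by rewrite -setI_eq0; apply/eqP/setP => z; rewrite !(in_setI, in_setD, in_set0); case: (z \in K); rewrite ?andbF.
- move=> a; rewrite mem_cat; apply/conn_arr_inP/orP => [[J [cJ sJ ->]]|[]/conn_arr_inP[J [cJ sJ ->]]].
  + have [y yJ] := conn_neq0 cJ.
    have JK z : z \in J -> (y \in K) = (z \in K).
      by move=> zJ; apply: (conn_closed cJ) => // a' b' _ _; exact: Kcl.
    case: (boolP (y \in K)) => yK; [left|right]; apply/conn_arr_inP; exists J; split=> //; apply/subsetP => z zJ.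
      by rewrite -JK.
    by rewrite in_setD -JK // yK (subsetP sJ).
  + by exists J; split=> //; exact: subset_trans KC.
  + by exists J; split=> //; apply: subset_trans sJ (subsetDl _ _).
- move=> a /conn_arr_inP[J [_ sJ ->]] u uK; rewrite mxE; case: (boolP (u \in J)) => // uJ.
  by rewrite (subsetP sJ) in uK.
- move=> a /conn_arr_inP[J [_ sJ ->]] u uK; rewrite mxE; case: (boolP (u \in J)) => // uJ.
  by rewrite (subsetP sJ) in uK.
Qed.

Theorem mainTheorem5 (n : nat) (E : rel 'I_n) :
  simple_graph E ->
  (free_arr (connected_subgraph_arr E) <-> accurate (connected_subgraph_arr E)).
Proof.
(* Accuracy contains a homogeneous basis of [D(A)], so one implication is immediate. *)
move=> [symE irrE]; split=> [freeE|[e [_ [B [bB _]] _]]]; last by exists (size e), B.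
have [|e he] := closed_accurate symE irrE freeE (C := setT); first by move=> x y _ _; rewrite inE.
apply: (accurate_on_accurate (e := e) (conn_arr0 E)).
have -> : connected_subgraph_arr E = conn_arr_in E setT; last exact: he.
rewrite /conn_arr_in /connected_subgraph_arr; congr map; apply: eq_enum => J.
by rewrite !inE subsetT andbT.
Qed.
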